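(* Let $X$ be a Banach space with separable dual $X^*$, and let $M$ be a cylindrical orthogonal martingale-valued measure on $X^*$ which has a quadratic variation and whose family of intensity measures $(\nu_{x^*}:x^*\in X^* )$ satisfies the sequential boundedness property; let $\langle\!\langle M\rangle\!\rangle$ be its (unique) quadratic variation. Let $T>0$ and assume that for $\mathbb P$-a.e. $\omega\in\Omega$, $\sup_{A\in\mathcal A}\langle\!\langle M\rangle\!\rangle(\omega)([0,T]\times A)<\infty$. Let $\Gamma_M$ be the $\mathcal L(X^*,X^{**})$-valued random measure on $\mathcal B([0,T])\otimes\mathcal B(U)$ associated with $M$ (see context). Then there exists a process $Q_M:\Omega\times[0,T]\times U\to\mathcal L(X^*,X^{**})$ such that for $\mathbb P$-a.e. $\omega\in\Omega$ $$\langle\Gamma_M(\omega)(C)x^*,y^*\rangle=\int_C\langle Q_M(\omega,r,u)x^*,y^*\rangle\,\langle\!\langle M\rangle\!\rangle(\omega)(dr,du)$$ for all $x^*,y^*\in X^*$ and $C\in\mathcal B([0,T])\otimes\mathcal B(U)$. Moreover: (i) for every $x^*,y^*\in X^*$ the mapping $(\omega,r,u)\mapsto\langle Q_M(\omega,r,u)x^*,y^*\rangle$ is predictable, that is, $\mathcal P_T\otimes\mathcal B(U)$-measurable; (ii) for $\mathbb P$-a.e. $\omega$, $Q_M(\omega,\cdot,\cdot)$ is positive and symmetric $\langle\!\langle M\rangle\!\rangle(\omega)$-a.e.; (iii) for $\mathbb P$-a.e. $\omega$, $\|Q_M(\omega,\cdot,\cdot)\|_{\mathcal L(X^*,X^{**})}=1$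 $\langle\!\langle M\rangle\!\rangle(\omega)$-a.e.
   Context: $(\Omega,\mathcal F,\mathbb P)$ is a complete probability space with a filtration $(\mathcal F_t)_{t\ge0}$ satisfying the usual conditions. $\mathcal P_T$ is the predictable $\sigma$-algebra on $\Omega\times[0,T]$. $U$ is a Hausdorff topological space homeomorphic to a Borel subset of $\mathbb R$ (Lusin) and $\mathcal A$ is a ring of Borel subsets of $U$. For square integrable real martingales $Y,Z$, $\langle Y,Z\rangle$ is the predictable quadratic covariation (the unique predictable finite-variation process null at $0$ such that $YZ-\langle Y,Z\rangle$ is a martingale), $\langle Y\rangle=\langle Y,Y\rangle$, and $\langle Y,Z\rangle_s^t=\langle Y,Z\rangle_t-\langle Y,Z\rangle_s$. A set function $N:\Omega\times\mathcal A\to\mathbb R$ is a $\sigma$-finite $L^2$-valued measure if: (1) $\mathbb E|N(A)|^2<\infty$ for all $A\in\mathcal A$; (2) $N(A\cup B)=N(A)+N(B)$ $\mathbb P$-a.e. for disjoint $A,B\in\mathcal A$; (3) there is a sequence $(U_n)$ in $\mathcal B(U)$ with $U_n\uparrow U$, $\mathcal B(U_n)\subseteq\mathcal A$ and $\sup_{A\in\mathcal B(U_n)}\mathbb E|N(A)|^2<\infty$ for each $n$; (4) for each $n$ and each sequence $(A_j)$ in $\mathcal B(U_n)$ decreasing to $\emptyset$, $\mathbb E|N(A_j)|^2\to0$; (5) for each $A\in\mathcal A$, $N(A)$ is the $L^2$-limit of $N(A\cap U_n)$. A cylindrical random variable on $X$ is a continuous linear map $X^*\to L^0(\Omega,\mathcal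 F,\mathbb P)$ (with convergence in probability). A cylindrical orthogonal martingale-valued measure on $X^*$ is a collection $M=(M(t,A):t\ge0,A\in\mathcal A)$ of cylindrical random variables on $X$ such that: (i) $M(0,A)(x^* )=0$ $\mathbb P$-a.e. for all $A,x^*$; (ii) for each $A$ and $x^*$, $M(A)(x^* )=(M(t,A)(x^* ))_{t\ge0}$ is a real càdlàg mean-zero square integrable martingale, and each $M(t,A):X^*\to L^0$ is continuous; (iii) for $t>0$ and $x^*\in X^*$, $M(t,\cdot)(x^* )$ is a $\sigma$-finite $L^2$-valued measure; (iv) $\langle M(A)(x^* ),M(B)(x^* )\rangle_t=0$ for $t>0$, $x^*\in X^*$ and disjoint $A,B\in\mathcal A$. A random measure on a measurable space $(S,\Sigma)$ is a map $\mu:\Omega\times\Sigma\to[0,\infty]$ such that $\mu(\cdot,E)$ is measurable for every $E\in\Sigma$ and $\mu(\omega,\cdot)$ is a measure for a.e. $\omega$. Such a random measure on $\mathcal B(\mathbb R_+)\otimes\mathcal B(U)$ is predictable if $(\omega,t)\mapsto\mu(\omega)([0,t]\times B)$ is predictable for each $B\in\mathcal B(U)$. The intensity measure $\nu_{x^*}$ is the unique predictable $\sigma$-finite random measure on $\mathcal B(\mathbb R_+)\otimes\mathcal B(U)$ with $\nu_{x^*}([0,t]\times A)=\langle M(A)(x^* )\rangle_t$ $\mathbb P$-a.e. for every $t\ge0$, $A\in\mathcal A$. For random measures, $\eta\le\zeta$ means that for $\mathbb P$-a.e. $\omega$, $\eta(\omega)(C)\le\zeta(\omega)(C)$ for all measurable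 $C$. $M$ has a quadratic variation $\eta$ if $\eta$ is a random measure on $\mathcal B(\mathbb R_+)\otimes\mathcal B(U)$ such that: (a) for every $t\ge0$, $A\in\mathcal A$, $\eta([0,t]\times A)<\infty$ $\mathbb P$-a.e.; (b) $\eta$ is a minimal element (for $\le$) of the collection of all random measures $\zeta$ with $\nu_{x^*}\le\zeta$ for every $x^*\in X^*$ with $\|x^*\|=1$. The family $(\nu_{x^*})$ satisfies the sequential boundedness property if whenever $(x_n^* )$ is dense in the unit sphere of $X^*$, $\|x^*\|=1$ and $t>0$, there is $\Omega_{x^*}$ with $\mathbb P(\Omega_{x^*})=1$ such that for all $0\le s<t$, $A\in\mathcal A$, $\omega\in\Omega_{x^*}$: $\nu_{x^*}(\omega)((s,t]\times A)\le\sup_{n\ge1}\nu_{x_n^*}(\omega)((s,t]\times A)$. Under these two assumptions the quadratic variation is unique and equals the supremum of measures $\sup_n\nu_{x_n^*}$ (the smallest measure dominating all $\nu_{x_n^*}$, for each $\omega$) for any $(x_n^* )$ dense in the unit sphere. $\mathfrak{Bil}(X^*,X^* )$ is the Banach space of bounded real bilinear forms on $X^*\times X^*$. It is a standing assumption that for every $x^*,y^*\in X^*$ the set function $C\mapsto\frac14\bigl(\nu_{x^*+y^*}(\omega)(C)-\nu_{x^*-y^*}(\omega)(C)\bigr)$ is a well-defined signed measure on $\mathcal B([0,T])\otimes\mathcal B(U)$. Under the boundedness assumption of the theorem, $\alpha_M$ denotes the random $\mathfrak{Bil}(X^*,X^* )$-valued (countably additive) measure on $\mathcal B([0,T])\otimes\mathcal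 B(U)$ determined, for each $x^*,y^*$ and $\mathbb P$-a.e. $\omega$, by $\alpha_M(\omega)(C)(x^*,y^* )=\frac14(\nu_{x^*+y^*}(\omega)(C)-\nu_{x^*-y^*}(\omega)(C))$; in particular $\alpha_M((s,t]\times A)(x^*,y^* )=\langle M(A)(x^* ),M(A)(y^* )\rangle_s^t$ $\mathbb P$-a.e. for $0\le s\le t\le T$, $A\in\mathcal A$. The measure $\Gamma_M$ with values in $\mathcal L(X^*,X^{**})$ is defined by $\langle\Gamma_M(\omega)(C)x^*,y^*\rangle=\alpha_M(\omega)(C)(x^*,y^* )$, with $\langle\cdot,\cdot\rangle$ the duality between $X^{**}$ and $X^*$. *)

(* Defs.v *)
From HB Require Import structures.
From mathcomp Require Import all_boot all_order all_algebra.
From mathcomp Require Import all_classical all_reals all_analysis.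
From mathcomp Require Import measurable_realfun.

Set Implicit Arguments.
Unset Strict Implicit.
Unset Printing Implicit Defensive.

Import Order.TTheory GRing.Theory Num.Theory.
Import numFieldNormedType.Exports.

Local Open Scope classical_set_scope.
Local Open Scope ring_scope.

Section sup_norm.
Context {R : realType} {S : Type} {W : normedModType R}.
Implicit Types (B : set S) (f g : S -> W).

Definition sup_norm B f : R := sup [set `|f x| | x in B].

Lemma sup_norm_ub B f k x : (forall y, B y -> `|f y| <= k) -> B x ->
  `|f x| <= sup_norm B f.
Proof.
move=> fk Bx; apply: sup_ubound; last by exists x.
by exists k => _ [y By <-]; exact: fk.
Qed.

Lemma sup_norm_le B f k : B !=set0 -> (forall y, B y -> `|f y| <= k) ->
  sup_norm B f <= k.
Proof.
move=> [x Bx] fk; apply: ge_sup; first by exists `|f x|, x.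
by move=> _ [y By <-]; exact: fk.
Qed.

Lemma sup_normD B f g k l : B !=set0 -> (forall y, B y -> `|f y| <= k) ->
  (forall y, B y -> `|g y| <= l) ->
  sup_norm B (fun x => f x + g x) <= sup_norm B f + sup_norm B g.
Proof.
move=> B0 fk gl; apply: sup_norm_le => // y By.
by rewrite (le_trans (ler_normD _ _))// lerD//;
  [exact: sup_norm_ub fk By|exact: sup_norm_ub gl By].
Qed.

Lemma sup_normZ B (a : R) f k : B !=set0 -> (forall y, B y -> `|f y| <= k) ->
  sup_norm B (fun x => a *: f x) = `|a| * sup_norm B f.
Proof.
move=> B0 fk; apply/eqP; rewrite eq_le; apply/andP; split.
  apply: sup_norm_le => // y By.
  by rewrite normrZ ler_wpM2l//; exact: sup_norm_ub fk By.
have [->|a0] := eqVneq a 0.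
  rewrite normr0 mul0r; case: B0 => x Bx.
  apply: le_trans (normr_ge0 (0 *: f x)) _.
  apply: (@sup_norm_ub B (fun x => 0 *: f x) 0) => // y _.
  by rewrite scale0r normr0.
rewrite -ler_pdivlMl ?normr_gt0//; apply: sup_norm_le => // y By.
rewrite ler_pdivlMl ?normr_gt0// -normrZ.
apply: (@sup_norm_ub B (fun x => a *: f x) (`|a| * k)) => // z Bz.
by rewrite normrZ ler_wpM2l// fk.
Qed.

End sup_norm.

Section bounded_operators.
Context {R : realType} (V W : normedModType R).

Definition bounded_linear : {pred V -> W} := fun f =>
  `[< linear f /\ exists k, forall x, `|f x| <= k * `|x| >].

Record bop := Bop { bop_fun :> V -> W ; _ : bop_fun \in bounded_linear }.

HB.instance Definition _ := [isSub for bop_fun].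
HB.instance Definition _ := [Choice of bop by <:].

Lemma bounded_linear_submod : submod_closed bounded_linear.
Proof.
split.
  apply/asboolP; split=> [a u v|]; first by rewrite /= scaler0 addr0.
  by exists 0 => x; rewrite normr0 mul0r.
move=> a f g /asboolP[lf [k fk]] /asboolP[lg [l gl]]; apply/asboolP; split.
  move=> b u v; rewrite !fctE lf lg.
  by rewrite !scalerDr !scalerA (mulrC a b) addrACA.
exists (`|a| * k + l) => x; rewrite mulrDl (le_trans (ler_normD _ _))//.
by rewrite lerD// normrZ -mulrA ler_wpM2l.
Qed.

HB.instance Definition _ := GRing.isSubmodClosed.Build R (V -> W)
  bounded_linear bounded_linear_submod.
HB.instance Definition _ := [SubChoice_isSubLmodule of bop by <:].

Lemma bop_linear (f : bop) : linear f.
Proof. by case: f => f /= /asboolP[]. Qed.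

HB.instance Definition _ (f : bop) :=
  GRing.isLinear.Build R V W *:%R f (bop_linear f).

Let B1 := [set x : V | `|x| <= 1].

Let B10 : B1 !=set0.
Proof. by exists 0; rewrite /B1 /= normr0. Qed.

Let bop_bounded (f : bop) : exists k, forall x, B1 x -> `|f x| <= k.
Proof.
case: f => f /= /asboolP[_ [k fk]]; exists `|k| => x B1x.
rewrite (le_trans (fk x))// (le_trans (ler_wpM2r _ (ler_norm k)))//.
by rewrite ler_piMr.
Qed.

Definition op_norm (f : bop) : R := sup_norm [set x : V | `|x| <= 1] f.

Lemma op_normD (f g : bop) : op_norm (f + g) <= op_norm f + op_norm g.
Proof.
by have [k fk] := bop_bounded f; have [l gl] := bop_bounded g; exact: sup_normD fk gl.
Qed.

Lemma op_normZ (a : R) (f : bop) : op_norm (a *: f) = `|a| * op_norm f.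
Proof. by have [k fk] := bop_bounded f; exact: sup_normZ fk. Qed.

Lemma op_norm0 (f : bop) : op_norm f = 0 -> f = 0.
Proof.
have [k fk] := bop_bounded f => f0; apply/val_inj/funext => x /=.
have [->|x0] := eqVneq x 0; first by rewrite linear0.
have : f (`|x|^-1 *: x) = 0.
  apply/eqP; rewrite -normr_le0.
  move: f0; rewrite /op_norm => <-; apply: (sup_norm_ub fk).
  by rewrite /B1 /= normrZ normfV normr_id mulVf ?normr_eq0.
move/eqP; rewrite linearZ/= scaler_eq0 invr_eq0 normr_eq0 (negbTE x0)/=.
by move/eqP.
Qed.

HB.instance Definition _ :=
  Lmodule_isNormed.Build R bop op_normD op_normZ op_norm0.

Lemma bop_normE (f : bop) : `|f| = op_norm f.
Proof. by []. Qed.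

End bounded_operators.

Section bounded_bilinear_forms.
Context {R : realType} (V : normedModType R).

Definition bounded_bilinear : {pred V -> V -> R} := fun b =>
  `[< [/\ forall y, linear (b^~ y : V -> R^o), forall x, linear (b x : V -> R^o)
      & exists k, forall x y, `|b x y| <= k * `|x| * `|y|] >].

Record bil := Bil { bil_fun :> V -> V -> R ; _ : bil_fun \in bounded_bilinear }.

HB.instance Definition _ := [isSub for bil_fun].
HB.instance Definition _ := [Choice of bil by <:].

Lemma bounded_bilinear_submod : submod_closed bounded_bilinear.
Proof.
split.
  apply/asboolP; split=> [y a u v|x a u v|].
  - by rewrite /= scaler0 addr0.
  - by rewrite /= scaler0 addr0.
  - by exists 0 => x y; rewrite normr0 !mul0r.
move=> a f g /asboolP[lf lf' [k fk]] /asboolP[lg lg' [l gl]].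
apply/asboolP; split.
- move=> y b u v; rewrite !fctE /= lf lg.
  by rewrite !scalerDr !scalerA (mulrC a b) addrACA.
- move=> x b u v; rewrite !fctE /= lf' lg'.
  by rewrite !scalerDr !scalerA (mulrC a b) addrACA.
- exists (`|a| * k + l) => x y; rewrite !mulrDl (le_trans (ler_normD _ _))//.
  by rewrite lerD// normrM -!mulrA ler_wpM2l// mulrA.
Qed.

HB.instance Definition _ := GRing.isSubmodClosed.Build R (V -> V -> R)
  bounded_bilinear bounded_bilinear_submod.
HB.instance Definition _ := [SubChoice_isSubLmodule of bil by <:].

Let B2 := [set p : V * V | `|p.1| <= 1 /\ `|p.2| <= 1].

Let B20 : B2 !=set0.
Proof. by exists (0, 0); rewrite /B2 /= normr0. Qed.

Let bil_bounded (b : bil) : exists k, forall p, B2 p -> `|b p.1 p.2| <= k.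
Proof.
case: b => b /= /asboolP[_ _ [k bk]]; exists `|k| => -[x y] [/= x1 y1].
rewrite (le_trans (bk x y))// -mulrA.
rewrite (le_trans (ler_wpM2r _ (ler_norm k)))// ?mulr_ge0//.
by rewrite ler_piMr// mulr_ile1.
Qed.

Definition bil_norm (b : bil) : R :=
  sup_norm [set p : V * V | `|p.1| <= 1 /\ `|p.2| <= 1]
    (fun p => b p.1 p.2).

Lemma bil_normD (b c : bil) : bil_norm (b + c) <= bil_norm b + bil_norm c.
Proof.
by have [k bk] := bil_bounded b; have [l cl] := bil_bounded c;
  exact: (sup_normD B20 bk cl).
Qed.

Lemma bil_normZ (a : R) (b : bil) : bil_norm (a *: b) = `|a| * bil_norm b.
Proof. by have [k bk] := bil_bounded b; exact: (sup_normZ _ B20 bk). Qed.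

Lemma bil_norm0 (b : bil) : bil_norm b = 0 -> b = 0.
Proof.
have [k bk] := bil_bounded b => b0; apply/val_inj/funext => x; apply/funext => y.
have [lb lb' _] : [/\ forall y, linear (b^~ y : V -> R^o),
    forall x, linear (b x : V -> R^o)
    & exists k, forall x y, `|b x y| <= k * `|x| * `|y|].
  by case: (b) => b' /= /asboolP.
have b0l z : b 0 z = 0 by have := lb z (-1) 0 0; rewrite !scaleN1r addNr addNr.
have b0r z : b z 0 = 0 by have := lb' z (-1) 0 0; rewrite !scaleN1r addNr addNr.
have bZl a u z : b (a *: u) z = a * b u z.
  by have := lb z a u 0; rewrite !addr0 b0l addr0.
have bZr a u z : b z (a *: u) = a * b z u.
  by have := lb' z a u 0; rewrite !addr0 b0r addr0.
have [->|x0] := eqVneq x 0; first exact: b0l.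
have [->|y0] := eqVneq y 0; first exact: b0r.
have : b (`|x|^-1 *: x) (`|y|^-1 *: y) = 0.
  apply/eqP; rewrite -normr_le0.
  move: b0; rewrite /bil_norm => <-.
  apply: (@sup_norm_ub _ _ R^o B2 _ _ (_, _) bk).
  by rewrite /B2 /= !normrZ !normfV !normr_id !mulVf ?normr_eq0.
rewrite bZl bZr => /eqP.
by rewrite !mulf_eq0 !invr_eq0 !normr_eq0 (negbTE x0) (negbTE y0) => /eqP.
Qed.

HB.instance Definition _ :=
  Lmodule_isNormed.Build R bil bil_normD bil_normZ bil_norm0.

Lemma bil_normE (b : bil) : `|b| = bil_norm b.
Proof. by []. Qed.

End bounded_bilinear_forms.

Definition dual {R : realType} (X : normedModType R) : normedModType R :=
  bop X R.

Definition positive_op {R : realType} (V : normedModType R)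
    (q : bop V (dual V)) : Prop := forall x, 0 <= q x x.

Definition symmetric_op {R : realType} (V : normedModType R)
    (q : bop V (dual V)) : Prop := forall x y, q x y = q y x.

Definition separable_space (T : topologicalType) : Prop :=
  exists S : set T, countable S /\ dense S.

(* The witness [f] is a homeomorphism onto its range, a Borel subset of R;
   the last clause is the continuity of its inverse. *)
Definition lusin_space (R : realType) (U : topologicalType) : Prop :=
  hausdorff_space U /\
  exists f : U -> R, [/\ injective f, measurable (range f), continuous f
    & forall O : set U, open O ->
        exists2 O' : set R, open O' & f @` O = O' `&` range f].

Definition borel (U : ptopologicalType) := g_sigma_algebraType (@open U).

HB.instance Definition _ (U : ptopologicalType) :=
  Measurable.on (borel U).

(* [f], restricted to [D], is measurable for the sigma-algebra [G] on [D] *)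
Definition measurable_wrt {T : Type} {d} {T' : measurableType d}
    (D : set T) (G : set_system T) (f : T -> T') : Prop :=
  forall Y, measurable Y -> G (D `&` f @^-1` Y).

(* [G1] and [G2] are sigma-algebras on the subsets [D1] and [D2] *)
Definition prod_sigma_algebra {T1 T2 : Type} (D1 : set T1) (G1 : set_system T1)
    (D2 : set T2) (G2 : set_system T2) : set_system (T1 * T2) :=
  <<s D1 `*` D2, [set A `*` B | A in G1 & B in G2] >>.

Section measures.
Context {d} {S : measurableType d} {R : realType}.
Local Open Scope ereal_scope.

(* The values of [m] on non-measurable sets are irrelevant. *)
Definition is_measure (m : set S -> \bar R) : Prop :=
  exists mu : {measure set S -> \bar R}, forall E, measurable E -> m E = mu E.

Definition is_signed_measure (m : set S -> \bar R) : Prop :=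
  m set0 = 0 /\ semi_sigma_additive m.

End measures.

Section processes.
Context {d} {Omega : measurableType d} {R : realType} (P : probability Omega R).
Variable F : R -> set_system Omega.
Implicit Types (Y Z V : R -> Omega -> R).

Definition filtration : Prop :=
  [/\ forall t, 0 <= t -> sigma_algebra setT (F t),
      forall t, 0 <= t -> F t `<=` measurable
    & forall s t, 0 <= s -> s <= t -> F s `<=` F t].

Definition usual_conditions : Prop :=
  (forall t, 0 <= t -> F t = \bigcap_(s in [set s | t < s]) F s) /\
  (forall N, measurable N -> P N = 0%E -> F 0 N).

(* The predictable sigma-algebra on Omega x I, for I = [0, T] or [0, +oo[ *)
Definition predictable (I : set R) : set_system (Omega * R) :=
  <<s [set: Omega] `*` I,
    [set A `*` [set 0] | A in F 0] `|`
    [set E | exists s t A, [/\ 0 <= s < t, I t, F s A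
                             & E = A `*` `]s, t]%classic]] >>.

Definition is_cond_exp (G : set_system Omega) (Y Z : Omega -> R) : Prop :=
  [/\ measurable_wrt setT G Z, P.-integrable setT (EFin \o Z)
    & forall E, G E ->
        (\int[P]_(w in E) (Z w)%:E = \int[P]_(w in E) (Y w)%:E)%E].

Definition martingale Y : Prop :=
  [/\ forall t, 0 <= t -> measurable_wrt setT (F t) (Y t),
      forall t, 0 <= t -> P.-integrable setT (EFin \o Y t)
    & forall s t, 0 <= s -> s <= t -> is_cond_exp (F s) (Y t) (Y s)].

Definition cadlag (f : R -> R) : Prop :=
  (forall t, 0 <= t -> f x @[x --> t^'+] --> f t) /\
  (forall t, 0 < t -> cvg (f x @[x --> t^'-])).

Definition square_integrable_martingale Y : Prop :=
  [/\ martingale Y, \forall w \ae P, cadlag (Y^~ w)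
    & forall t, 0 <= t -> ('E_P[fun w => (`|Y t w| ^+ 2)%R] < +oo)%E].

(* As usual, finite variation processes are taken with cadlag paths: this is
   what makes [V] unique. *)
Definition predictable_finite_variation V : Prop :=
  measurable_wrt ([set: Omega] `*` `[0, +oo[%classic)
    (predictable `[0, +oo[%classic) (fun p : Omega * R => V p.2 p.1) /\
  \forall w \ae P, cadlag (V^~ w) /\
    forall t, 0 <= t -> bounded_variation 0 t (V^~ w).

(* V is the predictable quadratic covariation <Y, Z>. *)
Definition is_covariation Y Z V : Prop :=
  [/\ predictable_finite_variation V, \forall w \ae P, V 0 w = 0
    & martingale (fun t w => Y t w * Z t w - V t w)].

End processes.

Section random_measures.
Context {d} {Omega : measurableType d} {R : realType} (P : probability Omega R).
Local Open Scope ereal_scope.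

Definition random_measure {d'} {S : measurableType d'}
    (m : Omega -> set S -> \bar R) : Prop :=
  [/\ forall E, measurable E -> measurable_fun setT (m ^~ E),
      forall w E, measurable E -> 0 <= m w E
    & \forall w \ae P, is_measure (m w)].

Definition rm_le {d'} {S : measurableType d'}
    (m1 m2 : Omega -> set S -> \bar R) : Prop :=
  \forall w \ae P, forall C, measurable C -> m1 w C <= m2 w C.

Variables (F : R -> set_system Omega) (U : ptopologicalType).
Implicit Type m : Omega -> set (R * borel U) -> \bar R.

(* Measures on [0, +oo[ x U are encoded as the measures on R x U that do not
   charge ]-oo, 0[ x U. *)
Definition time_random_measure m : Prop :=
  random_measure m /\
  \forall w \ae P, m w (`]-oo, 0%R[%classic `*` [set: U]) = 0.

Definition predictable_random_measure m : Prop :=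
  forall B : set (borel U), measurable B ->
    measurable_wrt ([set: Omega] `*` `[0%R, +oo[%classic)
      (predictable F `[0%R, +oo[%classic)
      (fun p : Omega * R => m p.1 (`[0%R, p.2]%classic `*` B)).

End random_measures.

Section cylindrical.
Context {d} {Omega : measurableType d} {R : realType} (P : probability Omega R).
Variables (F : R -> set_system Omega) (U : ptopologicalType).
Variable calA : set (set U).

Definition borel_ring : Prop :=
  setring calA /\ calA `<=` (measurable : set (set (borel U))).

(* Elements of L^0 are handled through representatives. *)
Definition sigma_finite_L2_measure (N : set U -> Omega -> R) : Prop :=
  [/\ forall A, calA A -> measurable_fun setT (N A) /\
        ('E_P[fun w => (`|N A w| ^+ 2)%R] < +oo)%E,
      forall A B, calA A -> calA B -> A `&` B = set0 ->
        \forall w \ae P, N (A `|` B) w = N A w + N B w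
    & exists Un : nat -> set (borel U),
      [/\ forall n, measurable (Un n),
          nondecreasing_seq Un /\ \bigcup_n Un n = setT,
          forall n (A : set (borel U)), measurable A -> A `<=` Un n -> calA A
        & [/\ forall n, (ereal_sup [set 'E_P[fun w => (`|N A w| ^+ 2)%R] | A in
              [set A : set (borel U) | measurable A /\ A `<=` Un n]] < +oo)%E,
            forall n (A : nat -> set (borel U)),
              (forall j, measurable (A j) /\ A j `<=` Un n) ->
              nonincreasing_seq A -> \bigcap_j A j = set0 ->
              ('E_P[fun w => (`|N (A j) w| ^+ 2)%R])%E @[j --> \oo] --> 0%E
          & forall A, calA A ->
              ('E_P[fun w => (`|N (A `&` Un n) w - N A w| ^+ 2)%R])%E
                @[n --> \oo] --> 0%E]]].

Variable X : normedModType R.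

(* L^0 carries the topology of convergence in probability. *)
Definition cylindrical_rv (Z : dual X -> Omega -> R) : Prop :=
  [/\ forall x, measurable_fun setT (Z x),
      forall a x y, \forall w \ae P, Z (a *: x + y) w = a * Z x w + Z y w
    & forall x e, 0 < e ->
        P [set w | e < `|Z y w - Z x w|] @[y --> x] --> 0%E].

Variable M : R -> set U -> dual X -> Omega -> R.

Definition cylindrical_orthogonal_martingale_valued_measure : Prop :=
  [/\ forall t A, 0 <= t -> calA A -> cylindrical_rv (M t A),
      forall A x, calA A -> \forall w \ae P, M 0 A x w = 0,
      forall A x, calA A ->
        square_integrable_martingale P F (fun t => M t A x) /\
        (forall t, 0 <= t -> ('E_P[M t A x] = 0)%E),
      forall t x, 0 < t -> sigma_finite_L2_measure (fun A => M t A x)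
    & forall A B x, calA A -> calA B -> A `&` B = set0 ->
        exists2 V, is_covariation P F (fun t => M t A x) (fun t => M t B x) V
          & forall t, 0 < t -> \forall w \ae P, V t w = 0].

Variable nu : dual X -> Omega -> set (R * borel U) -> \bar R.

Definition is_intensity : Prop :=
  forall x, [/\ time_random_measure P (nu x),
    predictable_random_measure F (nu x),
    \forall w \ae P, sigma_finite setT (nu x w)
  & forall A, calA A ->
      exists2 V, is_covariation P F (fun t => M t A x) (fun t => M t A x) V
        & forall t, 0 <= t ->
            \forall w \ae P, nu x w (`[0, t]%classic `*` A) = (V t w)%:E].

Definition dominates_intensity (zeta : Omega -> set (R * borel U) -> \bar R) :=
  forall x : dual X, `|x| = 1 -> rm_le P (nu x) zeta.

Definition is_quadratic_variation
    (eta : Omega -> set (R * borel U) -> \bar R) : Prop :=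
  [/\ time_random_measure P eta,
      forall t A, 0 <= t -> calA A ->
        \forall w \ae P, (eta w (`[0%R, t]%classic `*` A) < +oo)%E,
      dominates_intensity eta
    & forall zeta, time_random_measure P zeta -> dominates_intensity zeta ->
        rm_le P zeta eta -> rm_le P eta zeta].

Definition dense_in_unit_sphere (xs : nat -> dual X) : Prop :=
  (forall n, `|xs n| = 1) /\ [set x | `|x| = 1] `<=` closure (range xs).

Definition sequential_boundedness : Prop :=
  forall xs (x : dual X) t, dense_in_unit_sphere xs -> `|x| = 1 -> 0 < t ->
    exists Omegax : set Omega, [/\ measurable Omegax, P Omegax = 1%E
      & forall s A w, 0 <= s -> s < t -> calA A -> Omegax w ->
          (nu x w (`]s, t]%classic `*` A) <=
           ereal_sup [set nu (xs n) w (`]s, t]%classic `*` A) | n in setT])%E].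

Variable T : R.

Definition strip : set (R * borel U) := `[0, T]%classic `*` setT.

(* C belongs to B([0, T]) (x) B(U) *)
Definition borel_strip (C : set (R * borel U)) : Prop :=
  measurable C /\ C `<=` strip.

(* +oo - +oo = -oo in \bar R; [signed_intensities] excludes this case. *)
Definition polarized (x y : dual X) (w : Omega) (C : set (R * borel U)) :=
  ((4^-1)%:E * (nu (x + y)%R w C - nu (x - y)%R w C))%E.

Definition signed_intensities : Prop :=
  forall x y : dual X, \forall w \ae P,
    (forall C, borel_strip C -> (nu (x + y)%R w C +? - nu (x - y)%R w C)%E) /\
    is_signed_measure
      (fun C => polarized x y w (C `&` strip)).

Definition is_alpha (alpha : Omega -> set (R * borel U) -> bil (dual X)) :=
  [/\ forall C (x y : dual X), borel_strip C ->
        measurable_fun setT (fun w => alpha w C x y),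
      \forall w \ae P, forall C : nat -> set (R * borel U),
        (forall i, borel_strip (C i)) -> trivIset setT C ->
        (\sum_(0 <= i < n) alpha w (C i)) @[n --> \oo]
          --> alpha w (\bigcup_i C i)
    & forall x y : dual X, \forall w \ae P, forall C, borel_strip C ->
        (alpha w C x y)%:E = polarized x y w C].

Definition is_Gamma (alpha : Omega -> set (R * borel U) -> bil (dual X))
    (Gamma : Omega -> set (R * borel U) -> bop (dual X) (dual (dual X))) :=
  forall w C (x y : dual X), borel_strip C -> Gamma w C x y = alpha w C x y.

End cylindrical.

(* Main.v *)
(* Fix a countable dense subgroup (x_n) of X^* and mu = sum_n c_n nu_(x_n), with
   c_n > 0 making mu finite on [0, T] x U. Each nu_(x_n) has a predictable density
   p_n with respect to mu, uniformly in omega: take p_n to be the Radon-Nikodym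
   derivative of the associated Doleans measures on Omega x [0, T] x U; the
   pathwise identity nu_(x_n) = p_n mu then follows because two predictable kernels
   with the same Doleans measure coincide almost surely.
   Put s = sup_n p_n / |x_n|^2. The measure s mu dominates all the nu_x with
   |x| = 1, by density, and lies below the quadratic variation; by minimality of
   the latter, the quadratic variation is s mu on [0, T] x U.
   Polarizing x_n |-> p_n gives, mu-a.e., a positive symmetric biadditive form on
   the subgroup that is bounded by s |x| |y|. Divided by s, it extends to a bounded
   form Q on X^*, and the choice of s as a supremum gives it norm exactly 1. *)
Require Import Defs.
From HB Require Import structures.
From mathcomp Require Import all_boot all_order all_algebra.
From mathcomp Require Import all_classical all_reals all_analysis.
From mathcomp Require Import measurable_realfun.
From mathcomp Require Import ring lra.

Set Implicit Arguments.
Unset Strict Implicit.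
Unset Printing Implicit Defensive.

Import Order.TTheory GRing.Theory Num.Theory.
Import numFieldNormedType.Exports.

Local Open Scope classical_set_scope.
Local Open Scope ring_scope.

(** * Integrals against kernels and densities *)

(** Two obstacles shape the proof. The quadratic variation enters only as a minimal random measure,
    with no predictability in its definition, and derivatives taken path by path against it would
    carry no measurability in omega. The reference measure is therefore built from the intensities,
    whose predictability is given: one density on the predictable space then serves almost every
    path, and minimality is used only afterwards, to identify the quadratic variation. The other
    obstacle is that almost sure statements are available for one functional, or one pair, at a
    time, so everything pathwise has to be decided on a countable family. A subgroup is enough for
    this family: polarization uses only sums and differences, and a bounded additive map is
    automatically homogeneous over the reals. The intensities are not assumed to scale
    quadratically. This comes from the bounded form [alpha], whose diagonal is identified with the
    intensities by polarizing at x / 2. *)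

Section ge0_integral_functional.
Context {d} {Z : measurableType d} {R : realType}.
Local Open Scope ereal_scope.
Variables (M : {measure set Z -> \bar R}) (I : (Z -> \bar R) -> \bar R).
Hypothesis I_indic : forall E, measurable E -> I (EFin \o \1_E) = M E.
Hypothesis ID : forall f g : Z -> \bar R,
  measurable_fun setT f -> measurable_fun setT g ->
  (forall z, 0 <= f z) -> (forall z, 0 <= g z) ->
  I (fun z => f z + g z) = I f + I g.
Hypothesis IZ : forall (r : R) (f : Z -> \bar R), measurable_fun setT f ->
  (forall z, 0 <= f z) -> (0 <= r)%R -> I (fun z => r%:E * f z) = r%:E * I f.
Hypothesis I_lim : forall f_ : (Z -> \bar R)^nat,
  (forall n, measurable_fun setT (f_ n)) -> (forall n z, 0 <= f_ n z) ->
  (forall z, nondecreasing_seq (f_^~ z)) ->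
  I (fun z => limn (f_^~ z)) = limn (I \o f_).

Import HBNNSimple.

(** Indicators, simple functions, monotone limits: the hypotheses are what this passage consumes.
    The formulas below for restrictions, mixtures, densities and images all reduce to checking
    them. *)
Lemma ge0_integral_functional f :
  measurable_fun setT f -> (forall z, 0 <= f z) -> I f = \int[M]_z f z.
Proof.
move=> mf f0; pose f_ := nnsfun_approx measurableT mf.
have If_ n : I (EFin \o f_ n) = \int[M]_z (f_ n z)%:E.
  rewrite integralT_nnsfun sintegralE.
  have -> : EFin \o f_ n = fun z =>
      \sum_(r <- finmap.enum_fset (fset_set (range (f_ n))))
      (r%:E * (\1_(f_ n @^-1` [set r]) z)%:E).
    apply/funext => z /=; rewrite {1}(fimfunE (f_ n) z).
    rewrite fsbig_finite//= -sumEFin.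
    by apply: eq_bigr => r _; rewrite EFinM.
  rewrite fsbig_finite//=.
  have : all (fun r => 0 <= r)%R (finmap.enum_fset (fset_set (range (f_ n)))).
    by apply/allP => r; rewrite in_fset_set// => /set_mem[z _ <-].
  elim: (X in all _ X -> I (fun z => \sum_(_ <- X) _) = \sum_(_ <- X) _)
    => [_|r s ih /= /andP[r0 s0]].
    rewrite big_nil; under eq_fun do rewrite big_nil.
    (* The value of [I] at the zero function is not assumed; it is homogeneity with factor 0. *)
    have := @IZ 0%R (cst 0) (measurable_cst _) (fun=> lexx _) (lexx _).
    by rewrite mul0e; under eq_fun do rewrite mul0e.
  rewrite big_cons; under eq_fun do rewrite big_cons.
  have m1 (r' : R) : measurable_fun setT
      (EFin \o (\1_(f_ n @^-1` [set r']) : Z -> R)).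
    by apply/measurable_EFinP; exact: measurable_indic.
  rewrite ID.
  - congr (_ + _); last exact: ih.
    have m10 z : 0 <= (\1_(f_ n @^-1` [set r]) z : R)%:E by rewrite lee_fin.
    by rewrite (IZ (m1 r) m10 r0) I_indic.
  - by apply: measurable_funeM; exact: m1.
  - by apply: emeasurable_sum => r'; apply: measurable_funeM; exact: m1.
  - by move=> z; rewrite mule_ge0// lee_fin.
  - move=> z; rewrite big_seq; apply: sume_ge0 => r' r's.
    by rewrite mule_ge0// lee_fin//; exact: (allP s0).
have flim : f = fun z => limn (fun n => (f_ n z)%:E).
  by apply/funext => z; apply/esym/cvg_lim => //; exact: cvg_nnsfun_approx.
have mf_ n : measurable_fun setT (EFin \o f_ n) by exact/measurable_EFinP.
have nf_ z : nondecreasing_seq (fun n => (f_ n z)%:E).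
  by move=> a b ab; rewrite lee_fin; exact/lefP/nd_nnsfun_approx.
rewrite flim (I_lim (f_ := fun n => EFin \o f_ n))//;
  last by move=> n z; rewrite lee_fin.
rewrite monotone_convergence//; last by move=> n z _; rewrite lee_fin.
by congr (limn _); apply/funext => n /=; rewrite -If_.
Qed.

End ge0_integral_functional.

Lemma integral_mrestr {d} {T : measurableType d} {R : realType}
    (M : {measure set T -> \bar R}) (C : set T) (mC : measurable C)
    (f : T -> \bar R) : measurable_fun setT f -> (forall x, 0 <= f x)%E ->
  (\int[mrestr M mC]_x f x = \int[M]_(x in C) f x)%E.
Proof.
move=> mf f0; apply/esym.
apply: (@ge0_integral_functional _ _ _ (mrestr M mC)
  (fun f => \int[M]_(x in C) f x)%E) => //.
- by move=> E mE; rewrite integral_indic.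
- by move=> g h mg mh g0 h0; rewrite ge0_integralD//; exact: measurable_funTS.
- by move=> r g mg g0 r0; rewrite ge0_integralZl_EFin//; exact: measurable_funTS.
- move=> f_ mf_ f_0 nf_; rewrite monotone_convergence//.
  by move=> n; exact: measurable_funTS.
Qed.

Section mixture.
Context {d d'} {Y : measurableType d} {Z : measurableType d'} {R : realType}.
Local Open Scope ereal_scope.
Variables (l : {measure set Y -> \bar R}) (k : Y -> {measure set Z -> \bar R}).
Hypothesis mk : forall E, measurable E -> measurable_fun setT (k ^~ E).

(** With [l] the probability and [k w] the weighted image of a kernel under the graph of the path w,
    the mixture is a Doleans measure. *)
Lemma mixture_measure : exists M : {measure set Z -> \bar R},
  forall E, M E = \int[l]_y k y E.
Proof.
pose m (E : set Z) := \int[l]_y k y E.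
have m0 : m set0 = 0 by apply: integral0_eq => y _; rewrite measure0.
have mge0 E : 0 <= m E by exact: integral_ge0.
have madd : semi_sigma_additive m.
  move=> F mF tF mUF; rewrite [X in _ --> X](_ : _ =
      \sum_(n <oo) \int[l]_y k y (F n)); last first.
    rewrite -integral_nneseries//; last by move=> n; exact: mk.
    by apply: eq_integral => y _; rewrite measure_semi_bigcup.
  apply: is_cvg_ereal_nneg_natsum_cond => n _ _; exact: integral_ge0.
pose M : {measure set Z -> \bar R} :=
  HB.pack m (isMeasure.Build _ _ _ m m0 mge0 madd).
by exists M.
Qed.

Lemma ge0_integral_mixture (M : {measure set Z -> \bar R}) f :
  (forall E, measurable E -> M E = \int[l]_y k y E) ->
  measurable_fun setT f -> (forall z, 0 <= f z) ->
  \int[M]_z f z = \int[l]_y \int[k y]_z f z.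
Proof.
move=> ME mf f0; apply/esym.
have mI g : measurable_fun setT g -> (forall z, 0 <= g z) ->
    measurable_fun setT (fun y => \int[k y]_z g z).
  by move=> mg g0; exact: measurable_fun_integral_kernel.
apply: (@ge0_integral_functional _ _ _ M (fun f => \int[l]_y \int[k y]_z f z)) => //.
- move=> E mE; rewrite ME//; apply: eq_integral => y _.
  by rewrite integral_indic// setIT.
- move=> g h mg mh g0 h0; rewrite -ge0_integralD//.
  + by apply: eq_integral => y _; rewrite ge0_integralD.
  + by move=> y _; exact: integral_ge0.
  + exact: mI.
  + by move=> y _; exact: integral_ge0.
  + exact: mI.
- move=> r g mg g0 r0; rewrite -ge0_integralZl_EFin//.
  + by apply: eq_integral => y _; rewrite ge0_integralZl_EFin.
  + by move=> y _; exact: integral_ge0.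
  + exact: mI.
- move=> f_ mf_ f_0 nf_.
  transitivity (\int[l]_y limn (fun n => \int[k y]_z f_ n z)).
    by apply: eq_integral => y _; rewrite monotone_convergence.
  rewrite monotone_convergence//.
  + by move=> n; exact: mI.
  + by move=> n y _; exact: integral_ge0.
  + move=> y _ a b ab; apply: ge0_le_integral => //.
    by move=> z _; exact: nf_.
Qed.

End mixture.

(** At [s = +oo] multiplication is not continuous at 0, but a nondecreasing nonnegative sequence is
    either identically 0 or positive from some index on, and both cases are harmless. *)
Lemma ge0_nondecreasing_limeMr {R : realType} (u : (\bar R)^nat) (s : \bar R) :
  (forall n, 0 <= u n)%E -> nondecreasing_seq u -> (0 <= s)%E ->
  limn (fun n => u n * s)%E = (limn u * s)%E.
Proof.
move=> u0 nu s0.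
have cu := ereal_nondecreasing_is_cvgn nu.
case: s s0 => [s| |] // s0; first by apply/cvg_lim => //; apply: cvgeZr.
have [[n un]|h] := pselect (exists n, (0 < u n)%E).
  have lu : (0 < limn u)%E.
    have -> : limn u = ereal_sup (range u).
      by apply/cvg_lim => //; exact: ereal_nondecreasing_cvgn.
    by apply: (lt_le_trans un); apply: ereal_sup_ubound; exists n.
  rewrite gt0_muley//; apply/cvg_lim => //; apply: cvg_near_cst.
  exists n => // m /= nm; rewrite gt0_muley//.
  by apply: (lt_le_trans un); exact: nu.
have u_0 n : u n = 0%E.
  by apply/eqP; rewrite eq_le u0 andbT leNgt; apply/negP => un; apply: h; exists n.
have -> : u = cst 0%E by exact/funext.
under eq_fun do rewrite mul0e.
by rewrite !lim_cst// mul0e.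
Qed.

Section density.
Context {d} {T : measurableType d} {R : realType}.
Local Open Scope ereal_scope.
Implicit Types (mu nu M : {measure set T -> \bar R}) (f g s : T -> \bar R).

Lemma density_measure mu s :
  measurable_fun setT s -> (forall x, 0 <= s x) ->
  exists M : {measure set T -> \bar R}, forall E, M E = \int[mu]_(x in E) s x.
Proof.
move=> ms s0; pose m (E : set T) := \int[mu]_(x in E) s x.
have m0 : m set0 = 0 by exact: integral_set0.
have mge0 E : 0 <= m E by exact: integral_ge0.
have madd : semi_sigma_additive m.
  move=> F mF tF mUF; rewrite /m ge0_integral_bigcup//; last exact: measurable_funTS.
  apply: is_cvg_ereal_nneg_natsum_cond => n _ _; exact: integral_ge0.
pose M : {measure set T -> \bar R} :=
  HB.pack m (isMeasure.Build _ _ _ m m0 mge0 madd).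
by exists M.
Qed.

(** The density is prescribed only inside [C] because the quadratic variation will have one only on
    the strip; it may take the value +oo. *)
Lemma ge0_integral_density mu M s f C : measurable C ->
  measurable_fun setT s -> (forall x, 0 <= s x) ->
  (forall E, measurable E -> E `<=` C -> M E = \int[mu]_(x in E) s x) ->
  measurable_fun setT f -> (forall z, 0 <= f z) ->
  \int[M]_(x in C) f x = \int[mu]_(x in C) (f x * s x).
Proof.
move=> mC ms s0 ME mf f0.
have mfs g : measurable_fun setT g -> measurable_fun C (fun x => g x * s x).
  by move=> mg; apply: measurable_funTS; exact: emeasurable_funM.
rewrite -integral_mrestr//.
apply/esym.
apply: (@ge0_integral_functional _ _ _ (mrestr M mC)
  (fun f => \int[mu]_(x in C) (f x * s x))) => //.
- move=> E mE; transitivity (M (E `&` C)); last by [].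
  rewrite ME//; last exact: measurableI.
  rewrite setIC integral_mkcondr; apply: eq_integral => x xC.
  by rewrite patchE /= indicE; case: ifPn; rewrite ?mul1e ?mul0e.
- move=> g h mg mh g0 h0; rewrite -ge0_integralD//; first last.
  + exact: mfs.
  + by move=> y _; rewrite mule_ge0.
  + exact: mfs.
  + by move=> y _; rewrite mule_ge0.
  by apply: eq_integral => y _; rewrite ge0_muleDl.
- move=> r g mg g0 r0; rewrite -ge0_integralZl_EFin//.
  + by apply: eq_integral => y _; rewrite muleA.
  + by move=> y _; rewrite mule_ge0.
  + exact: mfs.
- move=> f_ mf_ f_0 nf_.
  rewrite -monotone_convergence//.
  + by apply: eq_integral => x _; rewrite ge0_nondecreasing_limeMr.
  + by move=> n; exact: mfs.
  + by move=> n y _; rewrite mule_ge0.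
  + by move=> y _ a b ab; rewrite lee_wpmul2r//; exact: nf_.
Qed.

End density.

Section finite_measure.
Context {d} {T : measurableType d} {R : realType}.
Variables (mu : {measure set T -> \bar R}) (muoo : (mu setT < +oo)%E).

Let m : set T -> \bar R := mu.

Let fin_m : fin_num_fun m.
Proof.
move=> E mE; rewrite ge0_fin_numE//; apply: le_lt_trans muoo.
by rewrite le_measure// inE.
Qed.

HB.instance Definition _ := Measure.on m.
HB.instance Definition _ := @Measure_isFinite.Build _ _ _ m fin_m.

(** Turns finiteness of the total mass, a proposition, into the structure on which Radon-Nikodym
    derivatives and product measures are defined. *)
Lemma finite_measureP :
  exists m : {finite_measure set T -> \bar R}, forall E, m E = mu E.
Proof. by exists m. Qed.

End finite_measure.

(** Domination forces the derivative to be at most 1 almost everywhere, so truncating it at 1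
    changes no integral and yields a real-valued version bounded at every point. *)
Lemma radon_nikodym_le {d} {T : measurableType d} {R : realType}
    (mu nu : {measure set T -> \bar R}) : (mu setT < +oo)%E ->
  (forall E, measurable E -> nu E <= mu E)%E ->
  exists p : T -> R, [/\ measurable_fun setT p, forall x, (0 <= p x <= 1)%R
    & forall E, measurable E -> nu E = \int[mu]_(x in E) (p x)%:E]%E.
Proof.
move=> muoo numu.
have nuoo : (nu setT < +oo)%E by apply: le_lt_trans muoo; exact: numu.
have [m mE] := finite_measureP muoo; have [n nE] := finite_measureP nuoo.
have nm : n `<< m.
  apply/null_content_dominatesP => A mA mA0.
  have muA : (mu A = 0)%E by rewrite -mE.
  suff : (n A = 0)%E by [].
  by apply/eqP; rewrite nE eq_le measure_ge0 andbT -muA numu.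
have [f [f0 fi fn]] := radon_nikodym_finite nm.
have mf := measurable_int _ fi.
pose p x := fine (mine (f x) 1%E).
have p_fin x : mine (f x) 1%E \is a fin_num.
  rewrite ge0_fin_numE; last by rewrite le_min f0 lee01.
  by rewrite gt_min ltry orbT.
have pE x : (p x)%:E = mine (f x) 1%E by rewrite fineK.
exists p; split.
- apply/measurable_EFinP; rewrite (_ : EFin \o p = fun x => mine (f x) 1%E).
    exact: measurable_mine.
  by apply/funext => x /=; rewrite pE.
- by move=> x; rewrite -!lee_fin pE le_min f0 lee01/= ge_min lexx orbT.
move=> E mE'.
have -> : nu E = (\int[mu]_(x in E) f x)%E.
  by rewrite -nE fn//; apply: eq_measure_integral => A _ _; rewrite -mE.
pose A := [set x | 1 < f x]%E.
have mA : measurable A by rewrite -[A]setTI; exact: emeasurable_fun_o_infty.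
have mmin : measurable_fun setT (fun x => (p x)%:E).
  under eq_fun do rewrite pE; exact: measurable_mine.
have p0 x : (0 <= (p x)%:E)%E by rewrite pE le_min f0 lee01.
rewrite -(setUIDK E A) !ge0_integral_setU//; last first.
- by apply/disj_setPS => x [[_ ?] [_]].
- exact: measurable_funTS.
- exact: measurableD.
- exact: measurableI.
- by apply/disj_setPS => x [[_ ?] [_]].
- exact: measurable_funTS.
- exact: measurableD.
- exact: measurableI.
congr (_ + _)%E; last first.
  apply: eq_integral => x /[!inE] -[_ /negP]; rewrite -leNgt pE => fx1.
  by rewrite min_l.
apply/eqP; rewrite eq_le; apply/andP; split; last first.
  apply: ge0_le_integral => //; first exact: measurableI.
  - exact: measurable_funTS.
  - exact: measurable_funTS.
  - by move=> x _; rewrite pE ge_min lexx.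
(* Where the derivative exceeds 1 the truncation integrates to the [mu]-mass, which is at least the
   [nu]-mass, that is, the integral of the derivative. *)
rewrite [leRHS](eq_integral (cst 1%E)); last first.
  by move=> x /[!inE] -[_ Ax]; rewrite pE min_r// ltW.
rewrite integral_cst; last exact: measurableI.
rewrite mul1e.
apply: le_trans (numu _ (measurableI _ _ mE' mA)).
rewrite -nE fn; last exact: measurableI.
by rewrite (eq_measure_integral mu)// => B _ _; rewrite -mE.
Qed.

(** Integration by parts as Fubini on the two halves of [S * S] cut by comparing times. Ties belong
    to one half only, hence one weak and one strict inequality. *)
Lemma mul_measures_time {d} {S : measurableType d} {R : realType}
    (a b : {measure set S -> \bar R}) (t : S -> R) :
  (a setT < +oo)%E -> (b setT < +oo)%E -> measurable_fun setT t ->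
  (a setT * b setT = \int[b]_y a [set x | (t x <= t y)%R] +
                     \int[a]_x b [set y | (t y < t x)%R])%E.
Proof.
move=> aoo boo mt.
have [a' aE] := finite_measureP aoo; have [b' bE] := finite_measureP boo.
pose E := [set p : S * S | t p.1 <= t p.2].
have mE : measurable E.
  rewrite -[E]setTI; apply: (measurable_fun_le (f := t \o fst) (g := t \o snd)) => //.
    exact: measurableT_comp.
  exact: measurableT_comp.
have -> : (a setT * b setT = (a' \x b') setT)%E.
  by rewrite -aE -bE -setXTT product_measure1E.
rewrite -(setvU E) measureU//; last 2 first.
  exact: measurableC.
  by rewrite setICl.
rewrite addeC; congr (_ + _)%E; last first.
  (* This half is sectioned at the second coordinate and the other at the first; the two orders of
     integration agree by uniqueness of the product measure. *)
  transitivity ((a' \x^ b') E)%E.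
    pose m : {measure set (S * S) -> \bar R} := (a' \x^ b')%E.
    apply: (@product_measure_unique _ _ _ _ _ a' b' m) => // A B mA mB.
    by rewrite /m/= product_measure2E.
  rewrite /product_measure2/= (eq_measure_integral b').
    apply: eq_integral => y _ /=; rewrite -aE; congr (a' _).
    by apply/seteqP; split => x; rewrite /ysection/= inE.
  by move=> A _ _; rewrite bE.
rewrite /product_measure1/= (eq_measure_integral a').
  apply: eq_integral => x _ /=; rewrite -bE; congr (b' _).
  apply/seteqP; split => y; rewrite /xsection/= inE /E /= ltNge.
    by move/negP.
  by move=> /negP.
by move=> A _ _; rewrite aE.
Qed.

Section product_generator.
Context {d1 d2} {T1 : measurableType d1} {T2 : measurableType d2}.
Variables (G1 : set_system T1) (G2 : set_system T2).
Hypotheses (mG1 : @measurable _ T1 = <<s G1 >>) (mG2 : @measurable _ T2 = <<s G2 >>).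
Variables (g1 : (set T1)^nat) (g2 : (set T2)^nat).
Hypotheses (Gg1 : forall n, G1 (g1 n)) (Gg2 : forall n, G2 (g2 n)).
Hypotheses (g1T : \bigcup_n g1 n = setT) (g2T : \bigcup_n g2 n = setT).

Let G := [set A `*` B | A in G1 & B in G2].

(** The countable covers by generators are what produces the cylinders [setT * B] and [A * setT],
    and hence complements inside one factor. *)
Lemma measurable_prod_generator : @measurable _ (T1 * T2)%type = <<s G >>.
Proof.
have sG := smallest_sigma_algebra setT G.
have setXC1 (A : set T1) (B : set T2) :
    (setT `\` A) `*` B = (setT `*` B) `\` (A `*` B).
  apply/seteqP; split => -[x y]/=; first by move=> [[_ nA] Bx]; split => // -[].
  by move=> [[_ By] nAB]; split => //; split => // Ax; apply: nAB.
have setXC2 (A : set T1) (B : set T2) :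
    A `*` (setT `\` B) = (A `*` setT) `\` (A `*` B).
  apply/seteqP; split => -[x y]/=; first by move=> [Ax [_ nB]]; split => // -[].
  by move=> [[Ax _] nAB]; split => //; split => // By; apply: nAB.
have GD (A B : set (T1 * T2)) : <<s G >> A -> <<s G >> B -> <<s G >> (A `\` B).
  move=> GA GB; rewrite setDE -[A]setCK -setCU; apply: sigma_algebraC.
  rewrite -bigcup2E; apply: sigma_algebra_bigcup => -[|[|n]] /=.
  - exact: sigma_algebraC.
  - exact: GB.
  - exact: sigma_algebra0.
have G1T B : G2 B -> <<s G >> (setT `*` B).
  move=> GB; rewrite -g1T setX_bigcupl.
  by apply: sigma_algebra_bigcup => n; apply: sub_sigma_algebra; exists (g1 n) => //; exists B.
have H1 A B : measurable A -> G2 B -> <<s G >> (A `*` B).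
  rewrite mG1 => mA GB; move: A mA; apply: smallest_sub.
    split.
    - by rewrite /= set0X; exact: sigma_algebra0.
    - by move=> A /= GA; rewrite setXC1; apply: GD => //; exact: G1T.
    - by move=> A GA /=; rewrite setX_bigcupl; exact: sigma_algebra_bigcup.
  by move=> A GA; apply: sub_sigma_algebra; exists A => //; exists B.
have H2 A B : measurable A -> measurable B -> <<s G >> (A `*` B).
  move=> mA; rewrite mG2 => mB; move: B mB; apply: smallest_sub.
    split.
    - by rewrite /= setX0; exact: sigma_algebra0.
    - move=> B /= GB; rewrite setXC2; apply: GD => //.
      rewrite -g2T setX_bigcupr.
      by apply: sigma_algebra_bigcup => n; exact: H1.
    - by move=> B GB /=; rewrite setX_bigcupr; exact: sigma_algebra_bigcup.
  by move=> B GB; exact: H1.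
rewrite measurable_prod_measurableType; apply/seteqP; split; apply: smallest_sub => //.
  by move=> _ [A mA [B mB <-]]; exact: H2.
move=> _ [A GA [B GB <-]]; apply: sub_sigma_algebra; exists A.
  by rewrite mG1; exact: sub_sigma_algebra.
by exists B => //; rewrite mG2; exact: sub_sigma_algebra.
Qed.

End product_generator.

Section finite_kernel.
Context {d d'} {X : measurableType d} {Y : measurableType d'} {R : realType}.
Local Open Scope ereal_scope.

Lemma measurable_kernel_dynkin (G : set_system Y) (k : X -> {measure set Y -> \bar R}) :
  @measurable _ Y = <<s G >> -> setI_closed G ->
  (forall x, k x setT < +oo) -> measurable_fun setT (k ^~ setT) ->
  (forall E, G E -> measurable_fun setT (k ^~ E)) ->
  forall E, measurable E -> measurable_fun setT (k ^~ E).
Proof.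
move=> mG GI koo kT kG E mE.
apply: (@dynkin_induction _ _ G (fun E => measurable_fun setT (k ^~ E)))
  => //; last by rewrite -mG.
- move=> S mS kS; rewrite (_ : k ^~ _ = fun x => k x setT - k x S).
    exact: emeasurable_funB.
  apply/funext => x; rewrite -setTD measureD ?setTI//; exact: koo.
- move=> S mS tS kS; rewrite (_ : k ^~ _ = fun x => \sum_(n <oo) k x (S n)).
    by apply: ge0_emeasurable_sum => // n _.
  apply/funext => x; rewrite measure_semi_bigcup//.
  exact: bigcupT_measurable.
Qed.

Variable k : X -> {measure set Y -> \bar R}.
Hypothesis mk : forall E, measurable E -> measurable_fun setT (k ^~ E).
Hypothesis koo : forall x, k x setT < +oo.

Lemma measurable_kernel_xsection (E : set (X * Y)) : measurable E ->
  measurable_fun setT (fun x => k x (xsection E x)).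
Proof.
move=> mE.
pose P := fun E : set (X * Y) => measurable_fun setT (fun x => k x (xsection E x)).
have PT : P setT.
  rewrite /P (_ : (fun x => _) = k ^~ setT); first exact: mk.
  by apply/funext => x; congr (k x _); apply/seteqP; split => // y _; rewrite /xsection/= inE.
apply: (@dynkin_induction _ _ [set A `*` B | A in measurable & B in measurable] P).
- exact: measurable_prod_measurableType.
- move=> _ _ [A mA [B mB <-]] [A' mA' [B' mB' <-]].
  exists (A `&` A'); first exact: measurableI.
  by exists (B `&` B'); [exact: measurableI|rewrite setXI].
- exact: PT.
- move=> _ [A mA [B mB <-]]; rewrite /P.
  rewrite (_ : (fun x => _) = (fun x => k x B * (\1_A x)%:E)).
    apply: emeasurable_funM; first exact: mk.
    by apply/measurable_EFinP; exact: measurable_indic.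
  apply/funext => x; rewrite indicE.
  have [xA|xA] := boolP (x \in A); first by rewrite mule1 in_xsectionX.
  by rewrite mule0 notin_xsectionX// measure0.
- move=> S mS PS; rewrite /P.
  rewrite (_ : (fun x => _) = fun x => k x setT - k x (xsection S x)).
    by apply: emeasurable_funB => //; exact: mk.
  apply/funext => x; have mSx : measurable (xsection S x) by exact: measurable_xsection.
  have -> : xsection (~` S) x = setT `\` xsection S x.
    apply/seteqP; split => y; rewrite /xsection/= !inE; first by move=> nS; split.
    by case.
  rewrite measureD ?setTI//; exact: koo.
- move=> S mS tS PS; rewrite /P.
  rewrite (_ : (fun x => _) = fun x => \sum_(n <oo) k x (xsection (S n) x)).
    by apply: ge0_emeasurable_sum => // n _; exact: PS.
  apply/funext => x; rewrite xsection_bigcup measure_semi_bigcup//.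
  + by move=> n; exact: measurable_xsection.
  + exact: trivIset_xsection.
  + by apply: bigcupT_measurable => n; exact: measurable_xsection.
- by rewrite -measurable_prod_measurableType.
Qed.

Import HBNNSimple.

Lemma measurable_fun_kernel_integral (f : X * Y -> \bar R) :
  measurable_fun setT f -> (forall z, 0 <= f z) ->
  measurable_fun setT (fun x => \int[k x]_y f (x, y)).
Proof.
move=> mf f0; pose f_ := nnsfun_approx measurableT mf.
apply: (@measurable_fun_xsection_integral _ _ _ _ _ f k f_).
- by move=> a b ab; exact/nd_nnsfun_approx.
- by move=> z; exact/cvg_nnsfun_approx.
- by move=> n r; apply: measurable_kernel_xsection.
Qed.

Lemma measurable_fun_kernel_integral_in (f : X * Y -> \bar R) (C : set Y) :
  measurable C -> measurable_fun setT f -> (forall z, 0 <= f z) ->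
  measurable_fun setT (fun x => \int[k x]_(y in C) f (x, y)).
Proof.
move=> mC mf f0.
under eq_fun do rewrite integral_mkcond.
have mTC : measurable ([set: X] `*` C) by exact: measurableX.
have := @measurable_fun_kernel_integral (f \_ ([set: X] `*` C)).
rewrite (_ : (fun x => \int[k x]_y (f \_ ([set: X] `*` C)) (x, y)) =
  (fun x => \int[k x]_y ((fun y => f (x, y)) \_ C) y)); last first.
  apply/funext => x; apply: eq_integral => y _; rewrite !patchE.
  suff -> : ((x, y) \in [set: X] `*` C) = (y \in C) by [].
  by apply/idP/idP; rewrite !inE => // -[].
apply.
  by apply/(measurable_restrictT _ mTC)/measurable_funTS.
by move=> z; rewrite patchE; case: ifPn.
Qed.

End finite_kernel.

Lemma image_measure {d d'} {X : measurableType d} {Y : measurableType d'}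
    {R : realType} (mu : {measure set X -> \bar R}) (phi : X -> Y) (c : R) :
  measurable_fun setT phi -> 0 <= c ->
  exists K : {measure set Y -> \bar R},
    (forall E, K E = c%:E * mu (phi @^-1` E))%E /\
    forall f : Y -> \bar R, measurable_fun setT f -> (forall y, 0 <= f y)%E ->
      (\int[K]_y f y = c%:E * \int[mu]_x f (phi x))%E.
Proof.
move=> mphi c0; pose m (E : set Y) := (c%:E * mu (phi @^-1` E))%E.
have mpre E : measurable E -> measurable (phi @^-1` E).
  by move=> mE; rewrite -[_ @^-1` _]setTI; exact: mphi.
have m0 : m set0 = 0%E by rewrite /m preimage_set0 measure0 mule0.
have mge0 E : (0 <= m E)%E by rewrite mule_ge0// lee_fin.
have madd : semi_sigma_additive m.
  move=> S mS tS mUS; rewrite [X in _ --> X](_ : _ = (\sum_(n <oo) m (S n))%E).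
    by apply: is_cvg_ereal_nneg_natsum_cond => n _ _; exact: mge0.
  rewrite /m preimage_bigcup measure_semi_bigcup//.
  - by rewrite nneseriesZl.
  - by move=> n; exact: mpre.
  - by move=> i j _ _ [x [Si Sj]]; apply: (tS i j) => //; exists (phi x).
  - by apply: bigcupT_measurable => n; exact: mpre.
pose M : {measure set Y -> \bar R} :=
  HB.pack m (isMeasure.Build _ _ _ m m0 mge0 madd).
exists M; split => // f mf f0; apply/esym.
have mfphi (g : Y -> \bar R) : measurable_fun setT g ->
  measurable_fun setT (fun x => g (phi x)) by move=> mg; exact: measurableT_comp.
apply: (@ge0_integral_functional _ _ _ M
    (fun f => c%:E * \int[mu]_x f (phi x))%E) => //.
- move=> E mE; transitivity (m E) => //; rewrite /m; congr (_ * _)%E.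
  rewrite -(setIT (phi @^-1` E)) -integral_indic//; last exact: mpre.
- move=> g h mg mh g0 h0; rewrite -ge0_muleDr; last 2 first.
  + exact: integral_ge0.
  + exact: integral_ge0.
  by rewrite ge0_integralD//; exact: mfphi.
- move=> r g mg g0 r0; rewrite ge0_integralZl_EFin//; last exact: mfphi.
  by rewrite muleCA.
- move=> f_ mf_ f_0 nf_; rewrite monotone_convergence//; last first.
    by move=> n; exact: mfphi.
  under [X in _ = limn X]eq_fun do rewrite /= muleC.
  rewrite ge0_nondecreasing_limeMr ?lee_fin//.
  + by rewrite muleC.
  + by move=> n; exact: integral_ge0.
  + move=> a b ab; apply: ge0_le_integral => //.
    * exact: mfphi.
    * exact: mfphi.
    * by move=> x _; exact: nf_.
Qed.

(** * The predictable sigma-algebra *)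

Lemma bigcup_itv_pinfty {R : realType} :
  \bigcup_n `](- n%:R), +oo[%classic = [set: R].
Proof.
apply/seteqP; split => // x _; exists (Num.bound `|x|) => //=.
rewrite in_itv/= andbT ltrNl; apply: le_lt_trans (archi_boundP (normr_ge0 x)).
by rewrite -normrN ler_norm.
Qed.

Section predictable_space.
Context {d} {Omega : measurableType d} {R : realType}.
Variable F : R -> set_system Omega.

(* Indexing the rectangles by all of R, with F extended by F 0 to the left
   of 0, makes them a pi-system; the trace on [0, T] of the sigma-algebra they
   generate is the predictable sigma-algebra. *)
Definition pred_rect : set_system (Omega * R) :=
  [set E | exists s A, F (Num.max s 0) A /\ E = A `*` `]s, +oo[%classic].

Local Notation PT := (g_sigma_algebraType pred_rect).

Hypothesis filF : filtration F.

Lemma filtration_max s A : F (Num.max s 0) A -> measurable A.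
Proof.
have [_ Fm _] := filF; move=> FA; apply: (Fm _ _ _ FA).
by rewrite le_max lexx orbT.
Qed.

Lemma filtrationT s : 0 <= s -> F s setT.
Proof.
have [sF _ _] := filF => /sF[F0 FC _].
by rewrite -(setD0 setT); exact: FC.
Qed.

Lemma measurable_rect s A : F (Num.max s 0) A ->
  measurable (A `*` `]s, +oo[%classic : set PT).
Proof. by move=> FA; apply: sub_sigma_algebra; exists s, A. Qed.

Lemma measurable_cylinder A : F 0 A -> measurable (A `*` setT : set PT).
Proof.
move=> FA; rewrite -bigcup_itv_pinfty.
rewrite setX_bigcupr; apply: bigcupT_measurable => n.
apply: measurable_rect; rewrite (_ : Num.max _ _ = 0)//.
by apply/max_idPr; rewrite oppr_le0.
Qed.

Lemma measurable_pred_fun {d'} {T : measurableType d'} (f : T -> PT) :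
  (forall s A, F (Num.max s 0) A ->
     measurable (f @^-1` (A `*` `]s, +oo[%classic))) ->
  measurable_fun setT f.
Proof.
move=> mf; apply: (@measurability _ _ _ PT setT f pred_rect) => // _ [_ [s [A [FA ->]]] <-].
by rewrite setTI; exact: mf.
Qed.

Lemma measurable_time : measurable_fun setT (fun z : PT => z.2).
Proof.
apply: (measurability _ (RGenOInfty.measurableE R)).
move=> _ [_ [s ->] <-]; rewrite setTI.
rewrite (_ : _ @^-1` _ = setT `*` `]s, +oo[%classic).
  by apply: measurable_rect; apply: filtrationT; rewrite le_max lexx orbT.
by apply/seteqP; split => -[w t] /=; [|case].
Qed.

Lemma measurable_path w : measurable_fun setT (fun t : R => (w, t) : PT).
Proof.
apply: measurable_pred_fun => s A _.
have [wA|wA] := pselect (A w).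
  rewrite (_ : _ @^-1` _ = `]s, +oo[%classic)//.
  by apply/seteqP; split => t /=; [case|].
rewrite (_ : _ @^-1` _ = set0)//.
by apply/seteqP; split => t //= [].
Qed.

Lemma measurable_pair_pred : measurable_fun setT (fun z : Omega * R => z : PT).
Proof.
apply: measurable_pred_fun => s A FA.
by apply: measurableX => //; exact: filtration_max FA.
Qed.

(* A time change that does not anticipate, i.e. [tau t <= t]. *)
Lemma measurable_time_change (tau : R -> R) :
  (forall s, tau @^-1` `]s, +oo[%classic = set0 \/
    exists2 s', s <= s' & tau @^-1` `]s, +oo[%classic = `]s', +oo[%classic) ->
  measurable_fun setT (fun z : PT => (z.1, tau z.2) : PT).
Proof.
move=> tauP; apply: measurable_pred_fun => s A FA.
have [_ _ mF] := filF.
have [tau0|[s' ss' taus]] := tauP s.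
  rewrite (_ : _ @^-1` _ = set0)//; apply/seteqP; split => -[w t] //= [_ taut].
  by have : (tau @^-1` `]s, +oo[%classic) t by []; rewrite tau0.
rewrite (_ : _ @^-1` _ = A `*` `]s', +oo[%classic).
  apply: measurable_rect; apply: mF FA; rewrite ?ge_max ?le_max ?lexx ?orbT ?ss'//.
apply/seteqP; split => -[w t] /= [Aw ts]; split => //.
  by have : (tau @^-1` `]s, +oo[%classic) t by []; rewrite taus.
by have : (`]s', +oo[%classic) t by []; rewrite -taus.
Qed.

Lemma measurable_stop c :
  measurable_fun setT (fun z : PT => (z.1, Num.min z.2 c) : PT).
Proof.
apply: (measurable_time_change (tau := Num.min^~ c)) => s.
have [sc|cs] := ltP s c; [right; exists s => //|left].
  by apply/seteqP; split => t /=; rewrite !in_itv/= !andbT lt_min sc andbT.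
by apply/seteqP; split => t //=; rewrite !in_itv/= !andbT lt_min [s < c]ltNge cs andbF.
Qed.

Lemma measurable_delay e : 0 <= e ->
  measurable_fun setT (fun z : PT => (z.1, z.2 - e) : PT).
Proof.
move=> e0; apply: (measurable_time_change (tau := fun t => t - e)) => s; right.
exists (s + e); first by rewrite lerDl.
by apply/seteqP; split => t /=; rewrite !in_itv/= !andbT ltrBrDr.
Qed.

Context {dV} {V : measurableType dV}.

Definition graph (w : Omega) (s : R * V) : PT * V := ((w, s.1), s.2).

Lemma measurable_graph w : measurable_fun setT (graph w).
Proof.
apply: measurable_fun_pair => //.
exact: measurableT_comp (measurable_path w) measurable_fst.
Qed.

Lemma measurable_graph_joint :
  measurable_fun setT (fun z : Omega * (R * V) => graph z.1 z.2).
Proof.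
apply: measurable_fun_pair => /=; last exact: measurableT_comp.
apply: (measurableT_comp measurable_pair_pred (g := fun z => (z.1, z.2.1))).
by apply: measurable_fun_pair => //; exact: measurableT_comp.
Qed.

(** The minimum is essential: [A] in [F s] is seen by the predictable sigma-algebra only after time
    s, and a stopped time exceeds s only if both times do. *)
Lemma measurable_graph_stop : measurable_fun setT
  (fun z : PT * (R * V) => graph z.1.1 (Num.min z.2.1 z.1.2, z.2.2)).
Proof.
apply: measurable_fun_pair => /=; last exact: measurableT_comp.
apply: measurable_pred_fun => s A FA.
rewrite (_ : _ @^-1` _ =
    (A `*` `]s, +oo[%classic) `*` (`]s, +oo[%classic `*` setT)).
  by apply: measurableX; [exact: measurable_rect|exact: measurableX].
apply/seteqP; split => -[[w t] [r u]] /=; rewrite !in_itv/= !andbT lt_min.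
  by move=> [? /andP[]].
by move=> [[? ->] [-> _]].
Qed.

Local Notation past t B := (`]-oo, t]%classic `*` B).

(** The conditions concern every path rather than almost every one; paths on which an intensity
    misbehaves are removed before such a kernel is formed. *)
Definition predictable_kernel (k : Omega -> {measure set (R * V) -> \bar R}) :=
  [/\ forall E, measurable E -> measurable_fun setT (k ^~ E),
      forall w, (k w setT < +oo)%E
    & forall B, measurable B ->
        measurable_fun setT (fun z : PT => k z.1 (past z.2 B))].

Variable k : Omega -> {measure set (R * V) -> \bar R}.
Hypothesis pk : predictable_kernel k.

Lemma measurable_past (t : R) (B : set V) : measurable B -> measurable (past t B).
Proof. by move=> mB; exact: measurableX. Qed.

Lemma predictable_kernel_fin w E : measurable E -> (k w E < +oo)%E.
Proof.
have [_ koo _] := pk; move=> mE; apply: le_lt_trans (koo w).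
by rewrite le_measure// inE.
Qed.

(** Makes the restriction of [k] to the past of t a measurable kernel over the predictable space, as
    integration up to time t requires. *)
Lemma measurable_past_kernel E : measurable E ->
  measurable_fun setT (fun z : PT => k z.1 (past z.2 setT `&` E)).
Proof.
have [mk koo kp] := pk.
pose G := [set A `*` B | A in @RGenOInfty.G R & B in @measurable _ V].
have mpast (z : PT) : measurable (past z.2 [set: V]) by exact: measurable_past.
pose K (z : PT) : {measure set (R * V) -> \bar R} := mrestr (k z.1) (mpast z).
have KE z E' : K z E' = k z.1 (past z.2 setT `&` E') by rewrite setIC.
move=> mE; rewrite (_ : (fun z => _) = K ^~ E); last first.
  by apply/funext => z; rewrite KE.
apply: (@measurable_kernel_dynkin _ _ _ _ _ G K) => //.
- apply: (@measurable_prod_generator _ _ _ _ (@RGenOInfty.G R) measurable _ _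
    (fun n => `](- n%:R), +oo[%classic) (fun=> setT)) => //.
  + exact: RGenOInfty.measurableE.
  + by rewrite sigma_algebra_id//; exact: sigma_algebra_measurable.
  + by move=> n; exists (- n%:R).
  + exact: bigcup_itv_pinfty.
  + by rewrite bigcup_const.
- move=> _ _ [_ [s ->] [A mA <-]] [_ [t ->] [B mB <-]].
  exists (`]Num.max s t, +oo[%classic); first by exists (Num.max s t).
  exists (A `&` B); first exact: measurableI.
  rewrite -setXI; congr (_ `*` _); apply/seteqP; split => x /=;
    by rewrite !in_itv/= !andbT gt_max => /andP.
- by move=> z; rewrite KE setIT; exact: predictable_kernel_fin.
- rewrite (_ : K ^~ setT = fun z : PT => k z.1 (past z.2 setT)); first exact: kp.
  by apply/funext => z; rewrite KE setIT.
move=> _ [_ [s ->] [B mB <-]].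
(* The mass of []s, t]] times [B] is an increment of the distribution function, and its lower end is
   that function stopped at s. For t below s the two terms cancel. *)
rewrite (_ : (fun z => _) = fun z : PT => (k z.1 (past z.2 B) -
    k z.1 (past (Num.min z.2 s) B))%E).
  apply: emeasurable_funB; first exact: kp.
  exact: measurableT_comp (kp B mB) (measurable_stop s).
apply/funext => -[w t]; rewrite KE/=.
transitivity (k w (past t B `\` past (Num.min t s) B)).
  congr (k w _); apply/seteqP; split => -[r u] /=; rewrite !in_itv/= ?andbT.
    by move=> [[rt _] [sr Bu]]; split => // -[]; rewrite le_min => /andP[_]; rewrite leNgt sr.
  move=> [[rt Bu]] H; split => //; split => //; rewrite ltNge; apply/negP => rs.
  by apply: H; split => //; rewrite le_min rt.
rewrite measureD; last 3 first.
  exact: measurable_past.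
  exact: measurable_past.
  by apply: predictable_kernel_fin; exact: measurable_past.
congr (_ - k w _)%E; apply/setIidr => -[r u] /= [+ Bu].
by rewrite !in_itv/= le_min => /andP[].
Qed.

(** On the past of t a time r equals the minimum of r and t, so the integrand may be replaced by its
    stopped version, which is jointly measurable in the end point and the integration variable. *)
Lemma measurable_past_integral (f : PT * V -> \bar R) (B : set V) :
  measurable B -> measurable_fun setT f -> (forall z, 0 <= f z)%E ->
  measurable_fun setT (fun z : PT =>
    (\int[k z.1]_(s in past z.2 B) f (graph z.1 s))%E).
Proof.
have [mk koo kp] := pk.
move=> mB mf f0.
have mpast (z : PT) : measurable (past z.2 [set: V]) by exact: measurable_past.
pose K (z : PT) : {measure set (R * V) -> \bar R} := mrestr (k z.1) (mpast z).
have KE z E' : K z E' = k z.1 (past z.2 setT `&` E') by rewrite setIC.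
have mTB : measurable ([set: PT] `*` B) by exact: measurableX.
pose h := f \_ ([set: PT] `*` B).
have mh : measurable_fun setT h by apply/(measurable_restrictT _ mTB)/measurable_funTS.
have h0 z : (0 <= h z)%E by rewrite /h patchE; case: ifPn.
pose g (z : PT * (R * V)) := h (graph z.1.1 (Num.min z.2.1 z.1.2, z.2.2)).
have mg : measurable_fun setT g by apply: measurableT_comp => //; exact: measurable_graph_stop.
rewrite (_ : (fun z => _) = fun z : PT => (\int[K z]_s g (z, s))%E).
  apply: measurable_fun_kernel_integral => //; last by move=> z; exact: h0.
    move=> E mE; rewrite (_ : K ^~ E = fun z : PT => k z.1 (past z.2 setT `&` E)).
      exact: measurable_past_kernel.
    by apply/funext => z; rewrite KE.
  by move=> z; rewrite KE setIT; exact: predictable_kernel_fin.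
apply/funext => -[w t] /=.
rewrite integral_mrestr; last 2 first.
  exact: measurableT_comp mg (measurable_fun_pair _ _).
  by move=> s; exact: h0.
rewrite (_ : past t B = past t setT `&` (setT `*` B)); last first.
  by rewrite -setXI setIT setTI.
rewrite integral_mkcondr; apply: eq_integral => -[r u]; rewrite inE/= in_itv/= => -[rt _].
rewrite /g /h /= !patchE /graph/= min_l//.
Qed.

(** The mass strictly before t is the increasing limit of the masses up to t - 1 / (n + 1), and a
    delay does not anticipate. *)
Lemma measurable_strict_past (B : set V) : measurable B ->
  measurable_fun setT (fun z : PT => k z.1 (`]-oo, z.2[%classic `*` B)).
Proof.
have [mk koo kp] := pk; move=> mB.
apply: (@emeasurable_fun_cvg _ _ _ _
    (fun n (z : PT) => k z.1 (past (z.2 - n.+1%:R^-1) B))) => //.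
  move=> n; apply: (measurableT_comp (kp B mB) (g := fun z : PT => (z.1, z.2 - n.+1%:R^-1) : PT)).
  exact: measurable_delay.
move=> [w t] _ /=.
have -> : `]-oo, t[%classic `*` B = \bigcup_n past (t - n.+1%:R^-1) B.
  apply/seteqP; split => -[r u]/=.
    rewrite in_itv/= => -[rt Bu].
    exists (Num.truncn (t - r)^-1) => //=; split => //; rewrite in_itv/=.
    rewrite lerBrDr -lerBrDl invf_ple ?posrE ?subr_gt0//.
    by rewrite ltW// truncnS_gt.
  move=> [n _ []/=]; rewrite in_itv/= => rt Bu; split => //; rewrite in_itv/=.
  by rewrite (le_lt_trans rt)// ltrBlDr ltrDl invr_gt0.
apply: nondecreasing_cvg_mu.
- by move=> n; exact: measurable_past.
- by apply: bigcupT_measurable => n; exact: measurable_past.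
- move=> m n mn; apply/subsetPset => -[r u] /= []; rewrite !in_itv/= => rt Bu; split => //.
  by apply: (le_trans rt); rewrite lerB// lef_pV2 ?posrE// ler_nat.
Qed.

Lemma predictable_kernel_restr (t0 : R) (B0 : set V) : measurable B0 ->
  exists2 a, predictable_kernel a & forall w E, a w E = k w (E `&` past t0 B0).
Proof.
have [mk koo kp] := pk; move=> mB0.
have mC := measurable_past t0 mB0.
exists (fun w => mrestr (k w) mC) => //; split.
- by move=> E mE; apply: mk; exact: measurableI.
- by move=> w; apply: predictable_kernel_fin; exact: measurableI.
move=> B mB; rewrite (_ : (fun z => _) =
    fun z : PT => k z.1 (past (Num.min z.2 t0) (B `&` B0))).
  exact: measurableT_comp (kp _ (measurableI _ _ mB mB0)) (measurable_stop t0).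
apply/funext => z; transitivity (k z.1 (past z.2 B `&` past t0 B0)) => //.
rewrite -setXI; congr (k _ (_ `*` _)).
by apply/seteqP; split => r /=; rewrite !in_itv/= le_min => /andP.
Qed.

Lemma measurable_graph_integral (f : PT * V -> \bar R) (C : set (R * V)) :
  measurable C -> measurable_fun setT f -> (forall z, 0 <= f z)%E ->
  measurable_fun setT (fun w => (\int[k w]_(s in C) f (graph w s))%E).
Proof.
have [mk koo kp] := pk; move=> mC mf f0.
apply: (@measurable_fun_kernel_integral_in _ _ _ _ _ k mk koo
  (fun z : Omega * (R * V) => f (graph z.1 z.2))) => //.
exact: measurableT_comp measurable_graph_joint.
Qed.

Lemma predictable_kernel_density (p : PT * V -> R) :
  measurable_fun setT p -> (forall z, 0 <= p z <= 1) ->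
  exists2 b, predictable_kernel b &
    forall w E, b w E = (\int[k w]_(s in E) (p (graph w s))%:E)%E.
Proof.
have [mk koo kp] := pk; move=> mp p01.
have p0 z : (0 <= (p z)%:E)%E by rewrite lee_fin; case/andP: (p01 z).
have mEp : measurable_fun setT (EFin \o p) by exact/measurable_EFinP.
have mpw w : measurable_fun setT (fun s => (p (graph w s))%:E).
  by apply: (measurableT_comp mEp); exact: measurable_graph.
have /choice[b bE] : forall w, exists m : {measure set (R * V) -> \bar R},
    forall E, m E = (\int[k w]_(s in E) (p (graph w s))%:E)%E.
  by move=> w; exact: density_measure.
exists b => //; split.
- move=> E mE; rewrite (_ : b ^~ E = fun w => (\int[k w]_(s in E) (p (graph w s))%:E)%E).
    exact: (@measurable_graph_integral (EFin \o p)).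
  by apply/funext => w; rewrite bE.
- move=> w; rewrite bE (le_lt_trans _ (koo w))//.
  rewrite -[leRHS]mul1e -integral_cst//; apply: ge0_le_integral => //.
  by move=> s _; rewrite lee_fin; case/andP: (p01 (graph w s)).
- move=> B mB; rewrite (_ : (fun z => _) = fun z : PT =>
      (\int[k z.1]_(s in past z.2 B) (p (graph z.1 s))%:E)%E).
    exact: (@measurable_past_integral (EFin \o p)).
  by apply/funext => z; rewrite bE.
Qed.

End predictable_space.

(** * Predictable densities *)

Section doleans.
Context {d} {Omega : measurableType d} {R : realType} (P : probability Omega R).
Context {dV} {V : measurableType dV}.
Variable F : R -> set_system Omega.
Hypothesis filF : filtration F.

Local Notation PT := (g_sigma_algebraType (pred_rect F)).
Local Notation gr := (@graph _ _ _ F _ V).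
Local Notation past t B := (`]-oo, t]%classic `*` B).
Local Open Scope ereal_scope.

(* In the application a = nu and b = p mu, where p is the density of the Doleans
   measure of nu with respect to that of mu, so that the Doleans measures of a
   and b agree. As the distribution functions of a and b are themselves
   predictable, they can be integrated against both, and integration by parts
   gives E[c (a - b)^2] = 0. *)
Lemma doleans_unique (c : Omega -> R) (a b : Omega -> {measure set (R * V) -> \bar R}) :
  measurable_fun setT c -> (forall w, 0 < c w)%R ->
  predictable_kernel F a -> predictable_kernel F b ->
  (forall w, (c w)%:E * (a w setT * a w setT) <= 1) ->
  (forall w, (c w)%:E * (b w setT * b w setT) <= 1) ->
  (forall H : PT * V -> \bar R, measurable_fun setT H -> (forall z, 0 <= H z) ->
     \int[P]_w ((c w)%:E * \int[a w]_s H (gr w s)) =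
     \int[P]_w ((c w)%:E * \int[b w]_s H (gr w s))) ->
  \forall w \ae P, a w setT = b w setT.
Proof.
move=> mc c0 pa pb ca1 cb1 ab.
have cE0 w : 0 <= (c w)%:E by rewrite lee_fin ltW.
have mcE : measurable_fun setT (fun w => (c w)%:E) by exact/measurable_EFinP.
(* Distribution functions up to the time and strictly before it, made into predictable integrands
   that ignore the mark. *)
pose le_ (k : Omega -> {measure set (R * V) -> \bar R}) (z : PT * V) :=
  k z.1.1 (past z.1.2 setT).
pose lt_ (k : Omega -> {measure set (R * V) -> \bar R}) (z : PT * V) :=
  k z.1.1 (`]-oo, z.1.2[%classic `*` setT).
have mle k : predictable_kernel F k -> measurable_fun setT (le_ k).
  by move=> [_ _ /(_ _ measurableT) kp]; exact: (measurableT_comp kp measurable_fst).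
have mlt k : predictable_kernel F k -> measurable_fun setT (lt_ k).
  by move=> pk; exact: (measurableT_comp (measurable_strict_past filF pk measurableT) measurable_fst).
have le0 k z : 0 <= le_ k z by [].
have lt0 k z : 0 <= lt_ k z by [].
pose J k f := \int[P]_w ((c w)%:E * \int[k w]_s f (gr w s)) : \bar R.
pose E (k l : Omega -> {measure set (R * V) -> \bar R}) :=
  \int[P]_w ((c w)%:E * (k w setT * l w setT)).
have mJ k (f : PT * V -> \bar R) : predictable_kernel F k -> measurable_fun setT f ->
    (forall z, 0 <= f z) ->
    measurable_fun setT (fun w => (c w)%:E * \int[k w]_s f (gr w s)).
  move=> pk mf f0; apply: emeasurable_funM => //.
  exact: (measurable_graph_integral filF pk measurableT mf f0).
have EJ k l : predictable_kernel F k -> predictable_kernel F l ->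
    E k l = J l (le_ k) + J k (lt_ l).
  move=> pk pl; rewrite /J -ge0_integralD//; first last.
  - by apply: mJ => //; exact: mlt.
  - by move=> w _; rewrite mule_ge0// integral_ge0.
  - by apply: mJ => //; exact: mle.
  - by move=> w _; rewrite mule_ge0// integral_ge0.
  apply: eq_integral => w _; rewrite -ge0_muleDr ?integral_ge0//; congr (_ * _).
  have [_ koo _] := pk; have [_ loo _] := pl.
  rewrite (mul_measures_time (koo w) (loo w) (t := fst))//.
  congr (_ + _); apply: eq_integral => -[r u] _; [congr (k w _)|congr (l w _)].
    by apply/seteqP; split => -[r' u'] /=; rewrite in_itv//= => -[].
  by apply/seteqP; split => -[r' u'] /=; rewrite in_itv//= => -[].
have Jab f : measurable_fun setT f -> (forall z, 0 <= f z) -> J a f = J b f.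
  exact: ab.
(* After integration by parts each product is a distribution function integrated against [a] or [b].
   As these two integrators are interchangeable, the squares and the mixed products consist of the
   same four terms. *)
have Esum : E a a + E b b = E a b + E b a.
  have Jle k pk := Jab _ (mle k pk) (le0 k).
  have Jlt k pk := Jab _ (mlt k pk) (lt0 k).
  clearbody J E le_ lt_.
  rewrite (EJ a a)// (EJ b b)// (EJ a b)// (EJ b a)//.
  rewrite (Jle a)// (Jlt b)// -(Jle b)// -(Jlt a)//.
  by rewrite addeACA [RHS]addeACA; congr (_ + _); rewrite addeC.
have fin (k : Omega -> {measure set (R * V) -> \bar R}) : predictable_kernel F k -> forall w, k w setT \is a fin_num.
  by move=> [_ koo _] w; rewrite ge0_fin_numE.
have mk (k : Omega -> {measure set (R * V) -> \bar R}) : predictable_kernel F k -> measurable_fun setT (fun w => k w setT).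
  by move=> [mk _ _]; exact: mk.
have mkl (k l : Omega -> {measure set (R * V) -> \bar R}) : predictable_kernel F k -> predictable_kernel F l ->
    measurable_fun setT (fun w => (c w)%:E * (k w setT * l w setT)).
  by move=> pk pl; apply: emeasurable_funM => //; apply: emeasurable_funM => //; exact: mk.
(* The weight [c] serves this bound: the two square terms are finite, so they can be cancelled from
   the expansion of the squared difference. *)
have E1 k : predictable_kernel F k ->
    (forall w, (c w)%:E * (k w setT * k w setT) <= 1) -> E k k <= 1.
  move=> pk ck; apply: (@le_trans _ _ (\int[P]_w cst 1 w)); last first.
    by rewrite integral_cst// mul1e; exact: probability_le1.
  apply: ge0_le_integral => //; first by move=> w _; rewrite !mule_ge0.
  exact: mkl.
have Efin : E a a + E b b \is a fin_num.
  rewrite ge0_fin_numE; last first.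
    by rewrite adde_ge0// integral_ge0// => w _; rewrite !mule_ge0.
  by rewrite (le_lt_trans (leeD (E1 _ pa ca1) (E1 _ pb cb1)))// -EFinD ltry.
pose g w := (c w * (fine (a w setT) - fine (b w setT)) ^+ 2)%R.
have mg : measurable_fun setT (EFin \o g).
  apply/measurable_EFinP; apply: measurable_funM => //.
  apply: measurable_funX; apply: measurable_funB;
    by apply: measurableT_comp => //; exact: mk.
have g0 w : 0 <= (g w)%:E by rewrite lee_fin mulr_ge0 ?sqr_ge0// ltW.
have : E a a + E b b = E a b + E b a + \int[P]_w (g w)%:E.
  rewrite /E -!ge0_integralD//; first last.
  - exact: mkl.
  - by move=> w _; rewrite !mule_ge0.
  - exact: mkl.
  - by move=> w _; rewrite !mule_ge0.
  - exact: mkl.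
  - by move=> w _; rewrite !mule_ge0.
  - exact: mkl.
  - by move=> w _; rewrite !mule_ge0.
  - by apply: emeasurable_funD; exact: mkl.
  - by move=> w _; rewrite adde_ge0// !mule_ge0.
  apply: eq_integral => w _.
  rewrite -(fineK (fin _ pa w)) -(fineK (fin _ pb w)) /g/= -!EFinM -!EFinD.
  by congr (_%:E); ring.
rewrite -Esum => /eqP; rewrite eq_sym addeC -[X in _ == X]add0e.
move/eqP => /(congr1 (fun x => x - (E a a + E b b))).
rewrite !addeK// => gint.
have : \int[P]_w `|(g w)%:E| = 0.
  by rewrite -[RHS]gint; apply: eq_integral => w _; rewrite gee0_abs.
move/(ae_eq_integral_abs P measurableT mg).
apply: filterS => w /(_ I) /= [] /eqP.
rewrite mulf_eq0 gt_eqF//= sqrf_eq0 subr_eq0 => /eqP.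
by rewrite -{2}(fineK (fin _ pa w)) -{2}(fineK (fin _ pb w)) => ->.
Qed.

End doleans.

(** Inversion agrees with the real power of exponent -1 on nonnegative reals, including 0, where
    both give 0. *)
Lemma measurable_funV_ge0 {d} {T : measurableType d} {R : realType} (f : T -> R) :
  measurable_fun setT f -> (forall x, 0 <= f x) ->
  measurable_fun setT (fun x => (f x)^-1).
Proof.
move=> mf f0; rewrite (_ : (fun x => _) = fun x => f x `^ (-1)).
  by apply: (measurableT_comp (measurable_powR _)).
by apply/funext => x; rewrite powR_inv1.
Qed.

Definition rat_seq (R : realType) (n : nat) : R := ratr (odflt 0 (@unpickle rat n)).
Arguments rat_seq R n : clear implicits.

Lemma rat_seqP (R : realType) (q : rat) : exists n, rat_seq R n = ratr q.
Proof. by exists (pickle q); rewrite /rat_seq pickleK. Qed.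

(** Countability of this generator is the point: an almost sure equality can be imposed on all its
    members at once. *)
Lemma measurable_rat_ray (R : realType) :
  @measurable _ R = <<s range (fun n => `]-oo, rat_seq R n]%classic) >>.
Proof.
apply/seteqP; split; last first.
  by apply: smallest_sub => //; [exact: sigma_algebra_measurable|move=> _ [n _ <-]].
have -> : @measurable _ R = <<s @RGenInftyO.G R >> by exact: RGenInftyO.measurableE.
apply: smallest_sub.
  exact: smallest_sigma_algebra.
move=> _ [x ->].
rewrite (_ : `]-oo, x[%classic = \bigcup_n
    (if rat_seq R n < x then `]-oo, rat_seq R n]%classic else set0)).
  apply: sigma_algebra_bigcup => n; case: ifPn => _; last exact: sigma_algebra0.
  by apply: sub_sigma_algebra; exists n.
apply/seteqP; split => y /=; rewrite in_itv/=.
  move=> /rat_in_itvoo[q]; rewrite in_itv/= => /andP[yq qx].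
  have [n nq] := rat_seqP R q; exists n => //=; rewrite nq qx /=.
  by rewrite in_itv/= ltW.
move=> [n _]; case: ifPn => //= nx; rewrite in_itv/= => yn.
exact: le_lt_trans yn nx.
Qed.

Section predictable_density.
Context {d} {Omega : measurableType d} {R : realType} (P : probability Omega R).
Context {dV} {V : measurableType dV}.
Variable F : R -> set_system Omega.
Hypothesis filF : filtration F.
Variable D : (set V)^nat.
Hypotheses (mD : @measurable _ V = <<s range D >>) (DI : setI_closed (range D))
  (DT : D 0%N = setT).

Local Notation PT := (g_sigma_algebraType (pred_rect F)).
Local Notation gr := (@graph _ _ _ F _ V).
Local Notation past t B := (`]-oo, t]%classic `*` B).
Local Open Scope ereal_scope.

Let mDn n : measurable (D n).
Proof. by rewrite mD; apply: sub_sigma_algebra; exists n. Qed.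

(** Rational times and the countable pi-system [range D] give countably many rectangles, closed
    under intersection, that determine a finite measure; one null set covers them all. *)
Lemma ae_eq_past_measures (a b : Omega -> {measure set (R * V) -> \bar R}) :
  (forall w, a w setT < +oo) ->
  (forall t n, \forall w \ae P, a w (past t (D n)) = b w (past t (D n))) ->
  \forall w \ae P, forall E, measurable E -> a w E = b w E.
Proof.
move=> aoo ab.
have : \forall w \ae P, forall i j,
    a w (past (rat_seq R i) (D j)) = b w (past (rat_seq R i) (D j)).
  by apply: ae_foralln => i; apply: ae_foralln => j; exact: ab.
apply: filterS => w abw.
pose G1 := range (fun n => `]-oo, rat_seq R n]%classic).
pose G := [set A `*` B | A in G1 & B in range D].
have natq n : exists i, rat_seq R i = n%:R%R.
  by have [i iE] := rat_seqP R n%:R; exists i; rewrite iE ratr_nat.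
pose g n : set (R * V) := past n%:R (D 0%N).
have Gg n : G (g n).
  have [i iE] := natq n.
  exists `]-oo, rat_seq R i]%classic; first by exists i.
  by exists (D 0%N) => //; rewrite iE.
have cover1 : \bigcup_n `]-oo, n%:R]%classic = [set: R].
  apply/seteqP; split => // x _; exists (Num.bound `|x|%R) => //=.
  rewrite in_itv/= ltW//; apply: le_lt_trans (archi_boundP (normr_ge0 x)).
  exact: ler_norm.
have mG : @measurable _ (R * V)%type = <<s G >>.
  apply: (@measurable_prod_generator _ _ _ _ G1 (range D) _ _
    (fun n => `]-oo, n%:R]%classic) (fun=> D 0%N)) => //.
  - exact: measurable_rat_ray.
  - by move=> n; have [i iE] := natq n; exists i => //; rewrite iE.
  - by rewrite bigcup_const.
move=> E mE.
apply: (@g_sigma_algebra_measure_unique _ _ _ G _ g) => //.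
- by move=> A GA; rewrite mG; exact: sub_sigma_algebra.
- by rewrite -setX_bigcupl cover1 DT setXTT.
- move=> _ _ [_ [i _ <-] [B DB <-]] [_ [j _ <-] [B' DB' <-]].
  exists (`]-oo, Num.min (rat_seq R i) (rat_seq R j)]%classic).
    rewrite /G1/=; have [_|_] := leP (rat_seq R i) (rat_seq R j);
      by [exists i|exists j].
  exists (B `&` B'); first exact: DI.
  rewrite -setXI; congr (_ `*` _); apply/seteqP; split => x /=;
    by rewrite !in_itv/= le_min => /andP.
- by move=> _ [_ [i _ <-] [_ [j _ <-] <-]]; exact: abw.
- move=> n; apply: (le_lt_trans _ (aoo w)).
  by rewrite le_measure// inE//; apply: measurableX.
- by rewrite -mG.
Qed.

Lemma predictable_density (mu nu : Omega -> {measure set (R * V) -> \bar R}) :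
  predictable_kernel F mu -> predictable_kernel F nu ->
  (forall w E, measurable E -> nu w E <= mu w E) ->
  exists p : PT * V -> R, [/\ measurable_fun setT p, forall z, (0 <= p z <= 1)%R &
    \forall w \ae P, forall E, measurable E ->
      nu w E = \int[mu w]_(s in E) (p (gr w s))%:E].
Proof.
move=> pmu pnu numu.
have [mmu muoo _] := pmu.
pose m w := fine (mu w setT).
have mE w : (m w)%:E = mu w setT by rewrite fineK// ge0_fin_numE.
have m0 w : (0 <= m w)%R by rewrite fine_ge0.
(* The square bounds both [c] times the mass, so that the Doleans measures are finite, and [c] times
   the squared mass, the moment condition of [doleans_unique]. *)
pose c w := ((1 + m w) ^+ 2)^-1%R.
have m1 w : (0 < 1 + m w)%R by rewrite ltr_pwDl.
have c0 w : (0 < c w)%R by rewrite invr_gt0 exprn_gt0.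
have cE0 w : 0 <= (c w)%:E by rewrite lee_fin ltW.
have mc : measurable_fun setT c.
  apply: measurable_funV_ge0; last by move=> w; rewrite exprn_ge0// ltW.
  apply: measurable_funX; apply: measurable_funD => //.
  by apply: measurableT_comp => //; exact: mmu.
have cm1 w : (c w)%:E * mu w setT <= 1.
  rewrite -mE -EFinM lee_fin mulrC ler_pdivrMr ?exprn_gt0// mul1r.
  by have := m0 w; nra.
have cmm1 w : (c w)%:E * (mu w setT * mu w setT) <= 1.
  rewrite -mE -!EFinM lee_fin mulrC ler_pdivrMr ?exprn_gt0// mul1r.
  by have := m0 w; nra.
have mc_int k (f : PT * V -> \bar R) : predictable_kernel F k ->
    measurable_fun setT f -> (forall z, 0 <= f z) ->
    measurable_fun setT (fun w => (c w)%:E * \int[k w]_s f (gr w s)).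
  move=> pk mf f0; apply: emeasurable_funM; first exact/measurable_EFinP.
  exact: (measurable_graph_integral filF pk measurableT mf f0).
(* The Doleans measure of [k]: each weighted [k w] is transported to the predictable space along its
   path, and the images are averaged over w. *)
have doleans k : predictable_kernel F k ->
    exists M : {measure set (PT * V) -> \bar R},
      (forall E, measurable E ->
        M E = \int[P]_w ((c w)%:E * k w (gr w @^-1` E))) /\
      forall f : PT * V -> \bar R, measurable_fun setT f -> (forall z, 0 <= f z) ->
        \int[M]_z f z = \int[P]_w ((c w)%:E * \int[k w]_s f (gr w s)).
  move=> pk.
  have /choice[K KP] : forall w, exists K : {measure set (PT * V) -> \bar R},
      (forall E, K E = (c w)%:E * k w (gr w @^-1` E)) /\
      forall f : PT * V -> \bar R, measurable_fun setT f -> (forall z, 0 <= f z) ->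
        \int[K]_z f z = (c w)%:E * \int[k w]_s f (gr w s).
    move=> w; apply: image_measure; last exact: ltW.
    exact: measurable_graph.
  have mK E : measurable E -> measurable_fun setT (K ^~ E).
    move=> mE'; rewrite (_ : K ^~ E = fun w =>
        (c w)%:E * \int[k w]_s (EFin \o \1_E) (gr w s)).
      apply: mc_int => //; last by move=> z; rewrite lee_fin.
      by apply/measurable_EFinP; exact: measurable_indic.
    apply/funext => w; have [-> _] := KP w; congr (_ * _).
    rewrite -(setIT (gr w @^-1` E)) -integral_indic//.
    by rewrite -[X in measurable X]setTI; exact: measurable_graph.
  have [M ME] := mixture_measure P mK.
  exists M; split.
    by move=> E _; rewrite ME; apply: eq_integral => w _; have [-> _] := KP w.
  move=> f mf f0; rewrite (ge0_integral_mixture mK (fun E _ => ME E) mf f0).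
  by apply: eq_integral => w _; have [_ ->] := KP w.
have [Mmu [MmuE Mmu_int]] := doleans _ pmu.
have [Mnu [MnuE Mnu_int]] := doleans _ pnu.
have mgr w E : measurable E -> measurable (gr w @^-1` E).
  by move=> mE'; rewrite -[X in measurable X]setTI; exact: measurable_graph.
have mME k M E : predictable_kernel F k -> measurable E ->
    (forall E, measurable E -> M E = \int[P]_w ((c w)%:E * k w (gr w @^-1` E))) ->
    measurable_fun setT (fun w => (c w)%:E * k w (gr w @^-1` E)).
  move=> pk mE' _; rewrite (_ : (fun w => _) = fun w =>
      (c w)%:E * \int[k w]_s (EFin \o \1_E) (gr w s)).
    apply: mc_int => //; last by move=> z; rewrite lee_fin.
    by apply/measurable_EFinP; exact: measurable_indic.
  apply/funext => w; congr (_ * _).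
  by rewrite -(setIT (gr w @^-1` E)) -integral_indic//; exact: mgr.
have Mmuoo : Mmu setT < +oo.
  rewrite MmuE// (@le_lt_trans _ _ (\int[P]_w cst 1 w))//.
    apply: ge0_le_integral => //; first by move=> w _; rewrite mule_ge0.
    exact: (mME _ Mmu).
  rewrite integral_cst// mul1e (le_lt_trans (probability_le1 _ _))// ltry.
  by [].
have Mnumu E : measurable E -> Mnu E <= Mmu E.
  move=> mE'; rewrite MnuE// MmuE//; apply: ge0_le_integral => //.
  - by move=> w _; rewrite mule_ge0.
  - exact: (mME _ Mnu).
  - exact: (mME _ Mmu).
  - by move=> w _; rewrite lee_wpmul2l// numu//; exact: mgr.
have [p [mp p01 pE]] := radon_nikodym_le Mmuoo Mnumu.
exists p; split => //.
have mEp : measurable_fun setT (EFin \o p) by exact/measurable_EFinP.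
have p0 z : 0 <= (p z)%:E by rewrite lee_fin; case/andP: (p01 z).
have [b0 pb0 b0E] := predictable_kernel_density filF pmu mp p01.
have b0mu w E : measurable E -> b0 w E <= mu w E.
  move=> mE'; rewrite b0E -[leRHS]mul1e -integral_cst//; apply: ge0_le_integral => //.
    by apply/measurable_funTS; apply: (measurableT_comp mEp); exact: measurable_graph.
  by move=> s _; rewrite lee_fin; case/andP: (p01 (gr w s)).
have : \forall w \ae P, forall E, measurable E -> nu w E = b0 w E.
  apply: ae_eq_past_measures; first by case: pnu.
  move=> t n.
  pose C : set (R * V) := past t (D n).
  have mC : measurable C by exact: measurableX.
  (* The set [C] seen in the predictable space: it does not depend on omega, so its preimage along
     every path is [C]. *)
  pose C' : set (PT * V) := [set z | (z.1.2 <= t)%R /\ D n z.2].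
  have mC' : measurable C'.
    rewrite (_ : C' = (fun z : PT => z.2) @^-1` `]-oo, t]%classic `*` D n).
      apply: measurableX => //; rewrite -[X in measurable X]setTI.
      exact: (measurable_time filF).
    by apply/seteqP; split => -[[w r] u] /=; rewrite in_itv.
  (* Restricting both kernels to [C] turns the comparison of their masses at [C] into one of total
     masses, which is the form of [doleans_unique]. *)
  have [a pa aE] := predictable_kernel_restr filF pnu t (mDn n).
  have [b pb bE] := predictable_kernel_restr filF pb0 t (mDn n).
  have int_restr (k k' : Omega -> {measure set (R * V) -> \bar R}) (H : PT * V -> \bar R) w :
      (forall w E, k' w E = k w (E `&` C)) -> measurable_fun setT H ->
      (forall z, 0 <= H z) ->
      \int[k' w]_s H (gr w s) = \int[k w]_s (H \_ C') (gr w s).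
    move=> k'E mH H0.
    rewrite (eq_measure_integral (mrestr (k w) mC)); last by move=> A _ _; rewrite k'E.
    rewrite integral_mrestr//; last first.
      by apply: (measurableT_comp mH); exact: measurable_graph.
    rewrite integral_mkcond; apply: eq_integral => -[r u] _; rewrite !patchE.
    suff -> : ((r, u) \in C) = (gr w (r, u) \in C') by [].
    by apply/idP/idP; rewrite !inE /C /C' /graph /= ?in_itv.
  have : \forall w \ae P, a w setT = b w setT.
    apply: (doleans_unique filF mc c0 pa pb).
    - move=> w; apply: le_trans (cmm1 w); rewrite lee_wpmul2l//.
      rewrite aE setTI; have h : nu w C <= mu w setT.
        by apply: (le_trans (numu _ _ mC)); rewrite le_measure// inE.
      exact: lee_pmul.
    - move=> w; apply: le_trans (cmm1 w); rewrite lee_wpmul2l//.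
      rewrite bE setTI; have h : b0 w C <= mu w setT.
        by apply: (le_trans (b0mu _ _ mC)); rewrite le_measure// inE.
      exact: lee_pmul.
    - move=> H mH H0.
      have mHC : measurable_fun setT (H \_ C').
        by apply/(measurable_restrictT _ mC')/measurable_funTS.
      have HC0 z : 0 <= (H \_ C') z by rewrite patchE; case: ifPn.
      (* The weighted integrals against [a] form an integral of [H] cut off outside [C'] against
         [Mnu]. The density [p] moves it to [Mmu], and it is disintegrated again along the paths
         into integrals against [b]. *)
      under eq_integral do rewrite (int_restr nu a)//.
      rewrite -Mnu_int//.
      rewrite (ge0_integral_density measurableT mEp p0 (fun E mE' _ => pE E mE'))//.
      rewrite Mmu_int//; last by move=> z; exact: mule_ge0 (HC0 z) (p0 z).
      apply: eq_integral => w _; congr (_ * _).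
      rewrite (int_restr b0 b)//.
      have mpw : measurable_fun setT (fun s => (p (gr w s))%:E).
        by apply: (measurableT_comp mEp); exact: measurable_graph.
      rewrite (ge0_integral_density measurableT mpw _ (fun E _ _ => b0E w E))//.
        by apply: (measurableT_comp mHC); exact: measurable_graph.
      exact: emeasurable_funM mHC mEp.
  by apply: filterS => w; rewrite aE bE !setTI.
by apply: filterS => w h E mE'; rewrite h// b0E.
Qed.

End predictable_density.

(** * Extending bilinear forms from a dense subgroup *)

Lemma ler_addinv_all {R : realType} (a b K : R) :
  (forall n : nat, a <= b + K * n.+1%:R^-1) -> a <= b.
Proof.
move=> ab; rewrite leNgt; apply/negP => ba.
have d0 : 0 < a - b by rewrite subr_gt0.
have K0 : 0 < K by have := ab 0%N; rewrite invr1 mulr1; lra.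
have := ab (Num.bound (K / (a - b))).
have := archi_boundP (ltW (divr_gt0 K0 d0)).
set N := Num.bound _ => KN.
have N1 : (0 : R) < N.+1%:R by [].
rewrite ltr_pdivrMr// in KN.
rewrite -lerBlDl leNgt ltr_pdivrMr// => /negP; apply.
rewrite mulrC (lt_trans KN)// ltr_pM2r// ltr_nat//.
Qed.

Lemma eq_addinv_all {R : realType} (a b K : R) :
  (forall n : nat, `|a - b| <= K * n.+1%:R^-1) -> a = b.
Proof.
move=> ab; apply/eqP; rewrite -subr_eq0 -normr_le0.
by apply: (@ler_addinv_all _ _ _ K) => n; rewrite add0r.
Qed.

(** Write N a = k + r with k natural and r in [0, 1]. Additivity treats N and k exactly, so N times
    the defect is f (r x) - r f (x), of size at most 2 K |x|; dividing by N makes it vanish. *)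
Lemma additive_bounded_scale {R : realType} {H : normedModType R} (f : H -> R) (K : R) :
  (forall x y, f (x + y) = f x + f y) -> (forall x, `|f x| <= K * `|x|) ->
  forall a x, f (a *: x) = a * f x.
Proof.
move=> fD fK.
have f0 : f 0 = 0 by have := fD 0 0; rewrite addr0 => /eqP; rewrite -subr_eq subrr eq_sym => /eqP.
have fN x : f (- x) = - f x by apply/eqP; rewrite -addr_eq0 -fD addNr f0.
have fn x n : f (x *+ n) = f x *+ n.
  by elim: n => [|n ih]; rewrite ?mulr0n// !mulrS fD ih.
suff pos a x : 0 <= a -> f (a *: x) = a * f x.
  move=> a x; have [/pos//|/ltW a0] := leP 0 a.
  by rewrite -[a in LHS]opprK scaleNr fN pos ?oppr_ge0// mulNr opprK.
move=> a0; apply: (@eq_addinv_all _ _ _ (2 * K * `|x|)) => n.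
set N : R := n.+1%:R; have N0 : 0 < N by rewrite /N.
pose k := Num.truncn (N * a).
have Na0 : 0 <= N * a by rewrite mulr_ge0// ltW.
pose r := N * a - k%:R.
have r0 : 0 <= r by rewrite subr_ge0 truncn_le.
have r1 : r <= 1.
  by rewrite lerBlDl natr1 ltW// truncnS_gt.
have fN' : N * f (a *: x) = k%:R * f x + f (r *: x).
  have -> : N * f (a *: x) = f ((N * a) *: x).
    by rewrite -scalerA scaler_nat fn mulr_natl.
  have -> : N * a = k%:R + r by rewrite /r addrC subrK.
  by rewrite scalerDl fD scaler_nat fn mulr_natl.
have E : N * (f (a *: x) - a * f x) = f (r *: x) - r * f x.
  by rewrite mulrBr fN' /r; ring.
rewrite ler_pdivlMr// mulrC -{1}(gtr0_norm N0) -normrM E.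
rewrite (le_trans (ler_normB _ _))// normrM (ger0_norm r0).
have K0 : 0 <= K * `|x| by apply: le_trans (fK x).
have h1 : `|f (r *: x)| <= K * `|x|.
  apply: (le_trans (fK _)); rewrite normrZ (ger0_norm r0) mulrCA.
  by rewrite -[leRHS]mul1r ler_wpM2r.
have h2 : r * `|f x| <= K * `|x|.
  by rewrite -[leRHS]mul1r ler_pM.
by move: h1 h2; lra.
Qed.

(* The discriminant inequality when the quadratic form is only tested on pairs
   of natural numbers: [n / m] is chosen near its minimum. *)
Lemma ler_nat_quadratic {R : realType} (A B c : R) : 0 <= A -> 0 <= B ->
  (forall n m : nat, 2 * (n * m)%:R * c <= n%:R ^+ 2 * A ^+ 2 + m%:R ^+ 2 * B ^+ 2) ->
  c <= A * B.
Proof.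
move=> A0 B0 H; rewrite leNgt; apply/negP => ABc.
have [A' [B' [A'0 B'0 AA' BB' A'B'c]]] : exists A' B' : R,
    [/\ 0 < A', 0 < B', A <= A', B <= B' & A' * B' < c].
  (* As e is at most 1, (A + e) (B + e) is at most A B + e (A + B + 1), and the second bound on e
     makes this increase at most half of c - A B. Passing to positive [A'] and [B'] allows the
     divisions below. *)
  pose e := Num.min 1 ((c - A * B) / (2 * (A + B + 1))).
  have S0 : 0 < 2 * (A + B + 1) by lra.
  have e0 : 0 < e by rewrite lt_min ltr01 divr_gt0// subr_gt0.
  have e1 : e <= 1 by rewrite ge_min lexx.
  have e2 : e * (2 * (A + B + 1)) <= c - A * B.
    by rewrite -ler_pdivlMr// ge_min lexx orbT.
  exists (A + e), (B + e); split; rewrite ?ltr_wpDl ?lerDl ?(ltW e0)//.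
  nra.
(* For t strictly between [lo] and [up], t^2 A'^2 < t (2 c - A' B') and B'^2 < t A' B'; their sum
   contradicts the hypothesis at t = n / m. The choice of [m] makes m (up - lo) exceed 1, so some
   integer [n] fits. *)
pose lo := B' / A'; pose up := (2 * c - A' * B') / A' ^+ 2.
have lo0 : 0 < lo by rewrite divr_gt0.
have loup : lo < up.
  rewrite /up ltr_pdivlMr ?exprn_gt0// /lo expr2 mulrA divfK ?gt_eqF//.
  by rewrite mulrC; lra.
have upA : up * A' ^+ 2 = 2 * c - A' * B' by rewrite divfK// gt_eqF// exprn_gt0.
have loA : lo * A' = B' by rewrite divfK// gt_eqF.
pose m := (Num.bound (up - lo)^-1).+1; pose M : R := m%:R.
have M0 : 0 < M by rewrite /M.
have M1 : 1 < M * (up - lo).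
  rewrite -ltr_pdivrMr ?subr_gt0// div1r.
  apply: lt_trans (archi_boundP _) _; first by rewrite invr_ge0 subr_ge0 ltW.
  by rewrite /M ltr_nat.
pose n := (Num.truncn (M * lo)).+1; pose N : R := n%:R.
have Mlo0 : 0 <= M * lo by rewrite mulr_ge0 ?ltW.
have N1 : M * lo < N by rewrite /N truncnS_gt.
have N2 : N < M * up.
  apply: (@le_lt_trans _ _ (M * lo + 1)).
    by rewrite /N /n -[_.+1%:R]natr1 lerD2r truncn_le.
  by move: M1; rewrite mulrBr ltrBrDl.
have N0 : 0 < N by apply: le_lt_trans N1.
have := H n m; rewrite natrM -/N -/M => H'.
have {H'} : 2 * (N * M) * c <= N ^+ 2 * A' ^+ 2 + M ^+ 2 * B' ^+ 2.
  apply: (le_trans H'); apply: lerD; apply: ler_wpM2l; rewrite ?sqr_ge0//;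
    by rewrite ler_pXn2r// nnegrE// ltW.
apply/negP; rewrite -ltNge.
have h1 : N ^+ 2 * A' ^+ 2 < N * M * (2 * c - A' * B').
  rewrite -upA.
  have -> : N * M * (up * A' ^+ 2) = N * (M * up) * A' ^+ 2 by ring.
  by rewrite [N ^+ 2]expr2 ltr_pM2r ?exprn_gt0// ltr_pM2l.
have h2 : M ^+ 2 * B' ^+ 2 < N * M * (A' * B').
  have MB : M * B' < N * A' by rewrite -loA mulrA ltr_pM2r.
  have -> : M ^+ 2 * B' ^+ 2 = (M * B') * (M * B') by ring.
  have -> : N * M * (A' * B') = (N * A') * (M * B') by ring.
  by rewrite ltr_pM2r// mulr_gt0.
have -> : 2 * (N * M) * c = N * M * (2 * c - A' * B') + N * M * (A' * B') by ring.
exact: ltrD.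
Qed.

Section bilinear_extension.
Context {R : realType} {H : normedModType R}.
Variables (D : set H) (q : H -> H -> R).
Hypotheses (D0 : D 0) (DD : forall x y, D x -> D y -> D (x + y))
  (DN : forall x, D x -> D (- x)).
Hypothesis qD : forall x y z, D x -> D y -> D z -> q (x + y) z = q x z + q y z.
Hypothesis qC : forall x y, D x -> D y -> q x y = q y x.
Hypothesis q0 : forall x, D x -> 0 <= q x x <= `|x| ^+ 2.

Let qDr x y z : D x -> D y -> D z -> q z (x + y) = q z x + q z y.
Proof. by move=> Dx Dy Dz; rewrite qC ?qD ?(qC _ Dz)//; exact: DD. Qed.

Let q0l z : D z -> q 0 z = 0.
Proof.
by move=> Dz; have := qD D0 D0 Dz; rewrite addr0 => /eqP; rewrite -subr_eq subrr eq_sym => /eqP.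
Qed.

Let qN x z : D x -> D z -> q (- x) z = - q x z.
Proof.
by move=> Dx Dz; apply/eqP; rewrite -addr_eq0 -qD ?addNr ?q0l//; exact: DN.
Qed.

Let Dn x n : D x -> D (x *+ n).
Proof. by move=> Dx; elim: n => [|n ih]; rewrite ?mulr0n// mulrS; exact: DD. Qed.

Let qn x z n : D x -> D z -> q (x *+ n) z = q x z *+ n.
Proof.
move=> Dx Dz; elim: n => [|n ih]; first by rewrite !mulr0n q0l.
by rewrite !mulrS qD ?ih//; exact: Dn.
Qed.

(** Cauchy-Schwarz from positivity at n u + m v, natural multiples being available in a subgroup.
    The diagonal bound replaces [q u u] and [q v v] by squared norms, and changing the sign of x
    gives the other inequality. *)
Lemma biadditive_bound x y : D x -> D y -> `|q x y| <= `|x| * `|y|.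
Proof.
have H0 u v : D u -> D v -> - q u v <= `|u| * `|v|.
  move=> Du Dv; apply: ler_nat_quadratic => // n m.
  have Dnu := Dn n Du; have Dmv := Dn m Dv.
  have /andP[+ _] := q0 (DD Dnu Dmv).
  have /andP[_] := q0 Dnu; have /andP[_] := q0 Dmv.
  rewrite qD ?qDr//; last exact: DD.
  have quv : q (u *+ n) (v *+ m) = (n * m)%:R * q u v.
    by rewrite qn// (qC Du Dmv) qn// (qC Dv Du) -mulrnA mulr_natl mulnC.
  have norm2 (z : H) k : `|z *+ k| ^+ 2 = k%:R ^+ 2 * `|z| ^+ 2.
    by rewrite normrMn -[_ *+ k]mulr_natl exprMn.
  rewrite (qC Dmv Dnu) quv !norm2.
  move: (q (u *+ n) _) (q (v *+ m) _) (_ * `|v| ^+ 2) (_ * `|u| ^+ 2) => a b c d.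
  move: (_%:R) (q u v) => e f; lra.
move=> Dx Dy; rewrite ler_norml; apply/andP; split.
  by rewrite lerNl; exact: H0.
by have := H0 _ _ (DN Dx) Dy; rewrite qN// opprK normrN.
Qed.

Hypothesis D_dense : forall x e, 0 < e -> exists2 y, D y & `|x - y| < e.

Lemma dense_approx (x : H) : exists u : nat -> H,
  forall n, D (u n) /\ `|x - u n| <= n.+1%:R^-1.
Proof.
have /choice[u uP] : forall n : nat, exists y, D y /\ `|x - y| <= n.+1%:R^-1.
  move=> n; have [|y Dy xy] := @D_dense x n.+1%:R^-1; first by rewrite invr_gt0.
  by exists y; split => //; exact: ltW.
by exists u.
Qed.

Let q_close a b a' b' : D a -> D b -> D a' -> D b' ->
  `|q a b - q a' b'| <= `|a - a'| * `|b| + `|a'| * `|b - b'|.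
Proof.
move=> Da Db Da' Db'.
have -> : q a b - q a' b' = q (a - a') b + q a' (b - b').
  rewrite qD ?qN ?qDr//; try exact: DN.
  by rewrite (qC Da' (DN Db')) qN// (qC Db' Da'); ring.
rewrite (le_trans (ler_normD _ _))//; apply: lerD; apply: biadditive_bound => //;
  exact: DD (DN _).
Qed.

(** The limit is the supremum of the lower bounds f n - C / (n + 1), each of which lies below every
    f m + C / (m + 1); the rate comes with it. *)
Let cauchy_rate (f : nat -> R) (C : R) :
  (forall n m, `|f n - f m| <= C * (n.+1%:R^-1 + m.+1%:R^-1)) ->
  exists L, forall n, `|L - f n| <= C * n.+1%:R^-1.
Proof.
move=> fC; pose A := range (fun n => f n - C * n.+1%:R^-1).
have fA n m : f n - C * n.+1%:R^-1 <= f m + C * m.+1%:R^-1.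
  have := le_trans (ler_norm _) (fC n m); rewrite mulrDr.
  by move: (C * _) (C * _) => i j; lra.
have ubA m : ubound A (f m + C * m.+1%:R^-1) by move=> _ [n _ <-]; exact: fA.
have supA : has_sup A.
  by split; [exists (f 0%N - C * 1%:R^-1), 0%N|exists (f 0%N + C * 1%:R^-1); exact: ubA].
exists (sup A) => n; rewrite ler_norml; apply/andP; split.
  rewrite lerBrDl; apply: sup_upper_bound => //; by exists n.
by rewrite lerBlDl; apply: ge_sup; [case: supA|exact: ubA].
Qed.

(** Values of [q] on approximations converge at rate 1 / (n + 1), so identities and bounds pass to
    the limit as errors of that order. Only additivity has to be transferred; homogeneity then
    follows from the bound. *)
Lemma bilinear_extension : exists Q : bop H (dual H),
  [/\ forall x y, D x -> D y -> Q x y = q x y, forall x y, Q x y = Q y x,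
      forall x, 0 <= Q x x & forall x y, `|Q x y| <= `|x| * `|y|].
Proof.
have /choice[u uP] := dense_approx.
have Du x n : D (u x n) by have [] := uP x n.
have xu x n : `|x - u x n| <= n.+1%:R^-1 by have [] := uP x n.
have inv0 n : 0 <= n.+1%:R^-1 :> R by rewrite invr_ge0.
have inv1 n : n.+1%:R^-1 <= 1 :> R by rewrite invf_le1// ler1n.
have un x n : `|u x n| <= `|x| + n.+1%:R^-1.
  by rewrite -lerBlDl (le_trans (lerB_dist _ _))// distrC.
have un1 x n : `|u x n| <= `|x| + 1 by rewrite (le_trans (un x n))// lerD2l.
have uu x n m : `|u x n - u x m| <= n.+1%:R^-1 + m.+1%:R^-1.
  have -> : u x n - u x m = (x - u x m) - (x - u x n) by rewrite opprB [RHS]addrC addrA subrK.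
  by rewrite (le_trans (ler_normB _ _))// addrC lerD.
(* Approximants have norm at most |x| + 1 and |y| + 1, the factors in front of the two errors; the
   constant is their sum. *)
pose C (x y : H) : R := `|x| + `|y| + 2.
have C0 x y : 0 <= C x y by rewrite /C addr_ge0// addr_ge0.
have fC x y n m : `|q (u x n) (u y n) - q (u x m) (u y m)| <=
    C x y * (n.+1%:R^-1 + m.+1%:R^-1).
  apply: (le_trans (q_close (Du _ _) (Du _ _) (Du _ _) (Du _ _))).
  apply: (@le_trans _ _ ((n.+1%:R^-1 + m.+1%:R^-1) * (`|y| + 1) +
      (`|x| + 1) * (n.+1%:R^-1 + m.+1%:R^-1))).
    by apply: lerD; apply: ler_pM.
  by rewrite [(_ + _) * (`|y| + 1)]mulrC -mulrDl /C ler_wpM2r ?addr_ge0//; lra.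
have /choice[Q0 Q0P] : forall p : H * H, exists L, forall n,
    `|L - q (u p.1 n) (u p.2 n)| <= C p.1 p.2 * n.+1%:R^-1.
  by move=> [x y]; apply: cauchy_rate; exact: fC.
pose Q x y := Q0 (x, y).
have QP x y n : `|Q x y - q (u x n) (u y n)| <= C x y * n.+1%:R^-1 := Q0P (x, y) n.
have QE x y : D x -> D y -> Q x y = q x y.
  move=> Dx Dy; apply: (@eq_addinv_all _ _ _ (C x y + C x y)) => n.
  rewrite -(subrKA (q (u x n) (u y n))) (le_trans (ler_normD _ _))// mulrDl lerD//.
  apply: (le_trans (q_close (Du _ _) (Du _ _) Dx Dy)).
  rewrite distrC [`|u y n - y|]distrC.
  apply: (@le_trans _ _ (n.+1%:R^-1 * (`|y| + 1) + `|x| * n.+1%:R^-1)).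
    by apply: lerD; [exact: ler_pM|exact: ler_wpM2l].
  by rewrite [n.+1%:R^-1 * _]mulrC -mulrDl ler_wpM2r// /C; lra.
have QC x y : Q x y = Q y x.
  apply: (@eq_addinv_all _ _ _ (C x y + C y x)) => n.
  rewrite -(subrKA (q (u x n) (u y n))) (le_trans (ler_normD _ _))// mulrDl lerD//.
  by rewrite qC// distrC.
have Qpos x : 0 <= Q x x.
  apply: (@ler_addinv_all _ _ _ (C x x)) => n.
  have /andP[q_ge0 _] := q0 (Du x n).
  have := QP x x n; rewrite ler_norml => /andP[+ _].
  by move: (C x x * _) (q _ _) q_ge0 => c b b0; lra.
have Qle x y : `|Q x y| <= `|x| * `|y|.
  apply: (@ler_addinv_all _ _ _ (C x y + C x y)) => n.
  have hQ := le_trans (lerB_dist _ _) (QP x y n).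
  have hq : `|q (u x n) (u y n)| <= `|x| * `|y| + C x y * n.+1%:R^-1.
    apply: (le_trans (biadditive_bound _ _)) => //.
    apply: (le_trans (ler_pM _ _ (un x n) (un y n))) => //.
    have -> : (`|x| + n.+1%:R^-1) * (`|y| + n.+1%:R^-1) =
      `|x| * `|y| + (`|x| + `|y| + n.+1%:R^-1) * n.+1%:R^-1 by ring.
    by rewrite lerD2l ler_wpM2r// /C lerD2l (le_trans (inv1 n))// ler1n.
  rewrite lerBlDr in hQ; rewrite (le_trans hQ)// [(C x y + C x y) * _]mulrDl [leRHS]addrCA.
  by rewrite lerD2l.
have QD x y z : Q (x + y) z = Q x z + Q y z.
  apply: (@eq_addinv_all _ _ _ (C (x + y) z + (C x z + C y z + 3 * (`|z| + 1)))) => n.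
  set f := q (u (x + y) n) (u z n); set g := q (u x n) (u z n); set h := q (u y n) (u z n).
  have e1 : `|Q (x + y) z - f| <= C (x + y) z * n.+1%:R^-1 by exact: QP.
  have e2 : `|Q x z - g| <= C x z * n.+1%:R^-1 by exact: QP.
  have e3 : `|Q y z - h| <= C y z * n.+1%:R^-1 by exact: QP.
  (* The approximant chosen for x + y is not the sum of those of x and y, but differs from it by at
     most 3 / (n + 1). *)
  have e4 : `|f - (g + h)| <= 3 * (`|z| + 1) * n.+1%:R^-1.
    rewrite /f /g /h -qD// -qN//; last exact: DD.
    rewrite -qD//; [|exact: DN (DD _ _)].
    apply: (le_trans (biadditive_bound _ _)) => //; first exact: DD (DN (DD _ _)).
    rewrite -mulrA [_ * n.+1%:R^-1]mulrC mulrA; apply: ler_pM => //.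
    have -> : u (x + y) n - (u x n + u y n) =
        ((x - u x n) + (y - u y n)) - ((x + y) - u (x + y) n).
      rewrite [X in _ = X - _]addrACA -opprD.
      by rewrite [in RHS]opprB [RHS]addrC addrA subrK.
    rewrite (le_trans (ler_normB _ _))//.
    rewrite (_ : 3 * _ = n.+1%:R^-1 + n.+1%:R^-1 + n.+1%:R^-1); last by ring.
    by rewrite lerD// (le_trans (ler_normD _ _))// lerD.
  have -> : Q (x + y) z - (Q x z + Q y z) =
    (Q (x + y) z - f) - (Q x z - g) - (Q y z - h) + (f - (g + h)) by ring.
  have -> : (C (x + y) z + (C x z + C y z + 3 * (`|z| + 1))) * n.+1%:R^-1 =
    C (x + y) z * n.+1%:R^-1 + C x z * n.+1%:R^-1 + C y z * n.+1%:R^-1 +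
    3 * (`|z| + 1) * n.+1%:R^-1 by ring.
  rewrite (le_trans (ler_normD _ _))// lerD//.
  rewrite (le_trans (ler_normB _ _))// lerD//.
  by rewrite (le_trans (ler_normB _ _))// lerD.
have QZ a x z : Q (a *: x) z = a * Q x z.
  apply: (@additive_bounded_scale _ _ (Q^~ z) `|z|) => [y y'|y]; first exact: QD.
  by rewrite mulrC.
have QDr x y z : Q z (x + y) = Q z x + Q z y by rewrite QC QD !(QC z).
have QZr a x z : Q z (a *: x) = a * Q z x by rewrite QC QZ QC.
have Qbl x : (Q x : H -> R) \in @bounded_linear R H R.
  apply/asboolP; split; first by move=> a y z; rewrite QDr QZr.
  by exists `|x|.
pose Q1 x : dual H := Bop (Qbl x).
have Q1le x : `|Q1 x| <= `|x|.
  rewrite bop_normE; apply: sup_norm_le.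
    by exists 0; rewrite /= normr0.
  by move=> y /= y1; rewrite (le_trans (Qle x y))// ler_piMr.
have Q1bl : (Q1 : H -> dual H) \in @bounded_linear R H (dual H).
  apply/asboolP; split; last by exists 1 => x; rewrite mul1r.
  by move=> a x y; apply/val_inj/funext => z /=; rewrite QD QZ.
by exists (Bop Q1bl).
Qed.

End bilinear_extension.

(** * Predictable sets and Lusin spaces *)

(** The sets whose trace on [D] lies in the target form a sigma-algebra. *)
Lemma trace_sigma_algebra {T : Type} (D : set T) (G : set_system T) (H : set_system T) :
  (forall A, H A -> <<s D, G >> (D `&` A)) ->
  forall A, <<s H >> A -> <<s D, G >> (D `&` A).
Proof.
move=> HG; have [G0 GC GU] := smallest_sigma_algebra D G.
apply: smallest_sub => //; split => /=.
- by rewrite setI0.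
- move=> A GA; rewrite (_ : D `&` (setT `\` A) = D `\` (D `&` A)); first exact: GC.
  by rewrite setTD setDIr setDv set0U -setDE.
- by move=> A GA; rewrite setI_bigcupr; exact: GU.
Qed.

Lemma sub_g_sigma_algebra_measurable {d} {T : measurableType d} (D : set T)
    (G : set_system T) : measurable D -> G `<=` measurable ->
  <<s D, G >> `<=` measurable.
Proof.
move=> mD mG; apply: smallest_sub => //; split => //.
  by move=> A mA; exact: measurableD.
by move=> A mA; exact: bigcupT_measurable.
Qed.

Section predictable_conversion.
Context {d} {Omega : measurableType d} {R : realType}.
Variable F : R -> set_system Omega.
Hypothesis filF : filtration F.

Local Notation PT := (g_sigma_algebraType (pred_rect F)).

Lemma predictable_measurable (A : set (Omega * R)) :
  predictable F `[0, +oo[%classic A -> measurable (A : set PT).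
Proof.
have mt (I : set R) : measurable I -> measurable ([set: Omega] `*` I : set PT).
  move=> mI; rewrite (_ : _ `*` _ = (fun z : PT => z.2) @^-1` I).
    by rewrite -[X in measurable X]setTI; exact: (measurable_time filF).
  by apply/seteqP; split => -[w t] //= [].
apply: (@sub_g_sigma_algebra_measurable _ PT); first exact: mt.
move=> _ [[B FB <-]|[s [t [B [/andP[s0 st] It FB ->]]]]].
  rewrite (_ : _ `*` _ = (B `*` setT) `&` (setT `*` [set 0])).
    by apply: measurableI; [exact: measurable_cylinder|exact: mt].
  by rewrite -setXI setIT setTI.
rewrite (_ : _ `*` _ = (B `*` `]s, +oo[%classic) `&` (setT `*` `]s, t]%classic)).
  apply: measurableI; last exact: mt.
  by apply: measurable_rect; rewrite (max_idPl s0).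
rewrite -setXI setIT; congr (_ `*` _); apply/seteqP; split => x /=.
  by rewrite !in_itv/= => /andP[-> ->].
by move=> [].
Qed.

(** A generating ray cut at [0, T] is empty, or a half-open rectangle, or, for s < 0, the slice at
    time 0 together with []0, T]]; in the last case its base lies in [F 0]. *)
Lemma measurable_predictable (T : R) (A : set PT) : 0 < T -> measurable A ->
  predictable F `[0, T]%classic (([set: Omega] `*` `[0, T]%classic) `&` A).
Proof.
move=> T0; have [_ _ mF] := filF.
apply: trace_sigma_algebra => _ [s [B [FB ->]]].
have [G0 _ GU] := smallest_sigma_algebra ([set: Omega] `*` `[0, T]%classic)
  ([set A `*` [set 0] | A in F 0] `|`
    [set E | exists s t A, [/\ 0 <= s < t, `[0, T]%classic t, F s A
                             & E = A `*` `]s, t]%classic]]).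
rewrite -setXI setTI; have [s0|s0] := ltP s 0; last first.
  have [Ts|sT] := leP T s.
    have -> : B `*` (`[0, T]%classic `&` `]s, +oo[%classic) = set0.
      apply/seteqP; split => -[w t] //= [_ []].
      by rewrite !in_itv/= andbT => /andP[_ tT] /lt_le_trans/(_ tT); rewrite ltNge Ts.
    exact: G0.
  apply: sub_sigma_algebra; right; exists s, T, B; split => //.
  - by rewrite s0.
  - by rewrite /= in_itv/= lexx ltW.
  - by move: FB; rewrite (max_idPl s0).
  - congr (_ `*` _); apply/seteqP; split => t /=; rewrite !in_itv/= ?andbT.
      by move=> [/andP[_ ->] ->].
    by move=> /andP[st ->]; rewrite st (le_trans s0)// ltW.
rewrite (max_idPr (ltW s0)) in FB.
have -> : B `*` (`[0, T]%classic `&` `]s, +oo[%classic) =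
    \bigcup_i bigcup2 (B `*` [set 0]) (B `*` `]0, T]%classic) i; last first.
  apply: GU => -[|[|n]] /=; last exact: G0.
    by apply: sub_sigma_algebra; left; exists B.
  apply: sub_sigma_algebra; right; exists 0, T, B; split => //; first by rewrite lexx.
  by rewrite /= in_itv/= lexx ltW.
rewrite bigcup2E; apply/seteqP; split => -[w t] /=.
  move=> [Bw []]; rewrite !in_itv/= => /andP[+ tT] _; rewrite le_eqVlt => /predU1P[<-|t0].
    by left.
  by right; split => //; rewrite t0.
move=> [[Bw ->]|[Bw]]; rewrite !in_itv/= ?lexx ?andbT.
  by split => //; split; rewrite ?ltW.
by move=> /andP[t0 tT]; split => //; rewrite ltW//; split => //; exact: lt_trans t0.
Qed.

Context {dV} {V : measurableType dV}.

Lemma measurable_prod_predictable (T : R) {d'} {W : measurableType d'}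
    (f : PT * V -> W) : 0 < T -> measurable_fun setT f ->
  measurable_wrt (([set: Omega] `*` `[0, T]%classic) `*` [set: V])
    (prod_sigma_algebra ([set: Omega] `*` `[0, T]%classic)
      (predictable F `[0, T]%classic) [set: V] measurable) f.
Proof.
move=> T0 mf Y mY.
have : measurable (f @^-1` Y) by rewrite -[X in measurable X]setTI; exact: mf.
rewrite measurable_prod_measurableType; apply: trace_sigma_algebra.
move=> _ [A mA [B mB <-]]; rewrite -setXI setTI.
apply: sub_sigma_algebra; exists (([set: Omega] `*` `[0, T]%classic) `&` A).
  exact: measurable_predictable.
by exists B.
Qed.

End predictable_conversion.

(** The embedding is a homeomorphism onto its range, so open sets are preimages of open sets of
    reals and pulled-back rational rays generate. Rays form a chain, hence the closure under
    intersection. *)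
Lemma lusin_generator (R : realType) (U : ptopologicalType) : lusin_space R U ->
  exists D : (set (borel U))^nat, [/\ @measurable _ (borel U) = <<s range D >>,
    setI_closed (range D) & D 0%N = setT].
Proof.
move=> [_ [f [f_inj mf cf f_open]]].
pose D n : set (borel U) :=
  if n is n'.+1 then f @^-1` `]-oo, rat_seq R n']%classic else setT.
exists D; split => //; last first.
  move=> _ _ [m _ <-] [n _ <-].
  case: m n => [|m] [|n]; rewrite /= ?setTI ?setIT; [by exists 0%N|by exists n.+1|
    by exists m.+1|].
  rewrite -preimage_setI.
  have [mn|nm] := leP (rat_seq R m) (rat_seq R n).
    exists m.+1 => //=; congr (f @^-1` _); apply/esym/setIidl => x /=.
    by rewrite !in_itv/= => /le_trans; apply.
  exists n.+1 => //=; congr (f @^-1` _); apply/esym/setIidr => x /=.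
  by rewrite !in_itv/= => /le_trans; apply; exact: ltW.
have sD := smallest_sigma_algebra setT (range D).
apply/seteqP; split; apply: smallest_sub => //.
- move=> O /f_open[W oW fO].
  have -> : O = f @^-1` W.
    apply/seteqP; split => x.
      move=> Ox; have : (f @` O) (f x) by exists x.
      by rewrite fO => -[].
    move=> Wfx; have : (W `&` range f) (f x) by split => //; exists x.
    by rewrite -fO => -[y Oy /f_inj <-].
  have : measurable W by exact: open_measurable.
  rewrite measurable_rat_ray.
  move: (W); apply: smallest_sub.
    split => /=.
    + by rewrite preimage_set0; exact: sigma_algebra0.
    + move=> A /= DA; rewrite setTD preimage_setC.
      by have [_ DC _] := sD; rewrite -setTD; exact: DC.
    + by move=> A DA /=; rewrite preimage_bigcup; exact: sigma_algebra_bigcup.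
  by move=> _ [n _ <-] /=; apply: sub_sigma_algebra; exists n.+1.
- exact: sigma_algebra_measurable.
- move=> _ [[|n] _ <-] /=; first exact: measurableT.
  rewrite -[X in measurable X]setCK; apply: measurableC.
  apply: sub_sigma_algebra; rewrite preimage_setC setCitvl.
  by move/continuousP : cf; apply; exact: interval_open.
Qed.

(** * Intensity measures *)

Section bil_theory.
Context {R : realType} {H : normedModType R}.
Implicit Types (b : bil H) (x y z : H).

Lemma bilP b : [/\ forall y, linear (b^~ y : H -> R^o),
  forall x, linear (b x : H -> R^o)
  & exists k, forall x y, `|b x y| <= k * `|x| * `|y|].
Proof. by case: b => b' /= /asboolP. Qed.

Lemma bilDl b x y z : b (x + y) z = b x z + b y z.
Proof. by have [h _ _] := bilP b; have := h z 1 x y; rewrite !scale1r. Qed.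

Lemma bilDr b x y z : b z (x + y) = b z x + b z y.
Proof. by have [_ h _] := bilP b; have := h z 1 x y; rewrite !scale1r. Qed.

Lemma bil0l b z : b 0 z = 0.
Proof. by have := bilDl b 0 0 z; rewrite addr0 => /eqP; rewrite -subr_eq subrr eq_sym => /eqP. Qed.

Lemma bil0r b z : b z 0 = 0.
Proof. by have := bilDr b 0 0 z; rewrite addr0 => /eqP; rewrite -subr_eq subrr eq_sym => /eqP. Qed.

Lemma bilZl b a x z : b (a *: x) z = a * b x z.
Proof. by have [h _ _] := bilP b; have := h z a x 0; rewrite !addr0 bil0l addr0. Qed.

Lemma bilZr b a x z : b z (a *: x) = a * b z x.
Proof. by have [_ h _] := bilP b; have := h z a x 0; rewrite !addr0 bil0r addr0. Qed.

Lemma bilNl b x z : b (- x) z = - b x z.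
Proof. by rewrite -scaleN1r bilZl mulN1r. Qed.

Lemma bilNr b x z : b z (- x) = - b z x.
Proof. by rewrite -scaleN1r bilZr mulN1r. Qed.

Lemma bil_polarization b x y :
  b (x + y) (x + y) - b (x - y) (x - y) = 2 * (b x y + b y x).
Proof. by rewrite !bilDl !bilDr !bilNl !bilNr; ring. Qed.

End bil_theory.

Lemma is_measure_le {d} {S : measurableType d} {R : realType} (m : set S -> \bar R) A B :
  is_measure m -> measurable A -> measurable B -> A `<=` B -> (m A <= m B)%E.
Proof. by move=> [mu E] mA mB AB; rewrite !E// le_measure// inE. Qed.

Section intensities.
Context {R : realType} {d} {Omega : measurableType d} (P : probability Omega R).
Context (F : R -> set_system Omega) (U : ptopologicalType) (calA : set (set U)).
Context (X : completeNormedModType R) (M : R -> set U -> dual X -> Omega -> R).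
Context (nu : dual X -> Omega -> set (R * borel U) -> \bar R).
Context (eta : Omega -> set (R * borel U) -> \bar R) (T : R).
Context (alpha : Omega -> set (R * borel U) -> bil (dual X)).
Hypotheses (filF : filtration F)
  (cM : cylindrical_orthogonal_martingale_valued_measure P F calA M)
  (iM : is_intensity P F calA M nu) (T0 : 0 < T).

Lemma measurable_strip : measurable (strip T : set (R * borel U)).
Proof. by rewrite /strip; apply: measurableX. Qed.

(** The exhaustion in the definition may depend on the time and the functional; the one at time 1
    and functional 0 is taken, as only its membership in [calA] is used later. *)
Lemma calA_exhaustion : exists Un : nat -> set (borel U),
  [/\ forall n, measurable (Un n), nondecreasing_seq Un,
      \bigcup_n Un n = setT & forall n, calA (Un n)].
Proof.
have [_ _ _ sM _] := cM.
have [_ _ [Un [mUn [nUn UnT] UnA _]]] := sM 1 0 ltr01.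
by exists Un; split => // n; exact: (UnA n _ (mUn n) (@subset_refl _ _)).
Qed.

(* M(0) = 0 a.s. by linearity, so minus its bracket is a martingale null at 0,
   while the bracket is nonnegative. *)
Lemma intensity0_strip : \forall w \ae P, nu 0 w (strip T) = 0%E.
Proof.
have [Un [mUn nUn UnT UnA]] := calA_exhaustion.
have [cyl M0 mart _ _] := cM.
have [[rm0 _] _ _ cov] := iM 0.
have [_ nu_ge0 nu_meas] := rm0.
have nuUn n : \forall w \ae P, nu 0 w (`[0, T]%classic `*` Un n) = 0%E.
  have [V [_ V0 [_ Yint Ycond]] nuV] := cov _ (UnA n).
  pose Y t w := M t (Un n) 0 w * M t (Un n) 0 w - V t w.
  have [_ _ YE] := Ycond 0 T (lexx 0) (ltW T0).
  have {}YE := YE setT (filtrationT filF (lexx 0)).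
  have Y0 : (\int[P]_w (Y 0 w)%:E = 0)%E.
    rewrite -[RHS](integral0 P setT); apply: ae_eq_integral => //.
      exact: measurable_int (Yint 0 (lexx 0)).
    have := M0 _ 0 (UnA n); have := V0; apply: filterS2 => w Vw Mw _.
    by rewrite /Y Vw Mw mulr0 subr0.
  have MT : \forall w \ae P, M T (Un n) 0 w = 0.
    have [_ lin _] := cyl T _ (ltW T0) (UnA n).
    have := lin 1 0 0; apply: filterS => w; rewrite scale1r addr0 mul1r => /eqP.
    by rewrite -subr_eq subrr eq_sym => /eqP.
  have YT : \forall w \ae P, ((Y T w)%:E = - nu 0%R w (`[0%R, T]%classic `*` Un n))%E.
    have := nuV T (ltW T0); have := MT; apply: filterS2 => w Mw ->.
    by rewrite /Y Mw mulr0 sub0r.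
  have YTint : P.-integrable setT (EFin \o Y T) := Yint T (ltW T0).
  have mYT := measurable_int _ YTint.
  have : ae_eq P setT (EFin \o Y T) (cst 0%E).
    apply/(ae_eq_integral_abs P measurableT mYT).
    transitivity (\int[P]_w (- (Y T w)%:E))%E.
      apply: ae_eq_integral => //.
      - exact: measurableT_comp.
      - exact: measurableT_comp.
      move: YT; apply: filterS => w YTw _; rewrite [(EFin \o _) w]YTw YTw oppeK abseN gee0_abs//.
      by apply: nu_ge0; apply: measurableX.
    rewrite integralN; last by apply: integrable_add_def.
    by rewrite -[X in (- X)%E]YE -[X in (- X)%E]/(\int[P]_w (Y 0 w)%:E)%E Y0 oppe0.
  have := YT; apply: filterS2 => w YTw /(_ I); rewrite [(EFin \o _) w]YTw => /eqP.
  by rewrite oppe_eq0 => /eqP.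
have : \forall w \ae P, forall n, nu 0 w (`[0, T]%classic `*` Un n) = 0%E.
  exact: ae_foralln.
move: nu_meas; apply: filterS2 => w [mu muE] nu0.
rewrite muE; last exact: measurable_strip.
have -> : strip T = \bigcup_n (`[0, T]%classic `*` Un n) :> set (R * borel U).
  by rewrite -setX_bigcupr UnT.
apply: measure_negligible.
  by apply: bigcupT_measurable => n; apply: measurableX.
apply: negligible_bigcup => n; apply/negligibleP; first exact: measurableX.
by have := nu0 n; rewrite muE//; exact: measurableX.
Qed.

Hypothesis aM : is_alpha P nu T alpha.

(** Polarizing at the pair (x / 2, x / 2) gives (nu x - nu 0) / 4 on one side and alpha x x / 4 on
    the other, and nu 0 vanishes on the strip. Finiteness of nu x on the strip is a by-product. *)
Lemma intensity_alpha (x : dual X) : \forall w \ae P,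
  forall C, borel_strip T C -> nu x w C = (alpha w C x x)%:E.
Proof.
have [_ _ aE] := aM.
have [[rm0 _] _ _ _] := iM 0; have [_ nu_ge0 nu_meas] := rm0.
pose y := 2^-1 *: x.
have := aE y y; have := intensity0_strip; move: nu_meas.
apply: filterS3 => w mw nu0 aw C sC.
have nuC0 : nu 0 w C = 0%E.
  have [mC CT] := sC.
  apply/eqP; rewrite eq_le nu_ge0// andbT -nu0.
  by apply: is_measure_le => //; exact: measurable_strip.
have yx : y + y = x by rewrite -scalerDl -[RHS]scale1r; congr (_ *: _); field.
have := aw C sC; rewrite /polarized yx subrr nuC0 sube0 bilZl bilZr.
case: (nu x w C) => [r| |].
- by rewrite -EFinM => -[] h; congr (_%:E); lra.
- by rewrite gt0_muley// lte_fin.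
- by rewrite gt0_muleNy// lte_fin.
Qed.

(** With intensities read as diagonal values, the polarized expression is the mean of alpha x y and
    alpha y x, so alpha x y equals that mean. *)
Lemma alphaC (x y : dual X) : \forall w \ae P,
  forall C, borel_strip T C -> alpha w C x y = alpha w C y x.
Proof.
have [_ _ aE] := aM.
have := intensity_alpha (x + y); have := intensity_alpha (x - y); have := aE x y.
apply: filterS3 => w aw am ap C sC; have := aw C sC.
rewrite /polarized ap// am// -EFinB bil_polarization -EFinM => -[]; lra.
Qed.

Hypothesis etaM : is_quadratic_variation P calA nu eta.

(** Domination is given on the unit sphere; the quadratic scaling inherited from [alpha] carries it
    to every functional. *)
Lemma intensity_le (x : dual X) : \forall w \ae P,
  forall C, borel_strip T C -> (nu x w C <= (`|x| ^+ 2)%:E * eta w C)%E.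
Proof.
have [[[_ eta_ge0 _] _] _ dom _] := etaM.
have [->|x0] := eqVneq x 0.
  have := intensity_alpha 0; apply: filterS => w h C sC.
  by rewrite h// bil0l normr0 expr0n/= mul0e.
have nx0 : `|x| != 0 by rewrite normr_eq0.
pose e := `|x|^-1 *: x.
have e1 : `|e| = 1 by rewrite normrZ normfV normr_id mulVf.
have := intensity_alpha x; have := intensity_alpha e; have := dom e e1.
apply: filterS3 => w le_e ae ax C sC.
rewrite ax//; have [mC _] := sC.
have -> : (alpha w C x x)%:E = ((`|x| ^+ 2)%:E * nu e w C)%E.
  rewrite ae// -EFinM; congr (_%:E); rewrite /e bilZl bilZr; field.
  exact: nx0.
by rewrite lee_wpmul2l// ?lee_fin ?sqr_ge0// le_e.
Qed.

Hypothesis eta_bounded : \forall w \ae P,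
  (ereal_sup [set eta w (`[0%R, T]%classic `*` A) | A in calA] < +oo)%E.

(** [calA] may fail to contain the whole of [U], so the strip is reached along the exhaustion, with
    the supremum as a common bound. *)
Lemma quadratic_variation_fin : \forall w \ae P, (eta w (strip T) < +oo)%E.
Proof.
have [[[_ eta_ge0 eta_meas] _] _ _ _] := etaM.
have [Un [mUn nUn UnT UnA]] := calA_exhaustion.
move: eta_meas eta_bounded; apply: filterS2 => w [mu muE].
apply: le_lt_trans; rewrite muE; last exact: measurable_strip.
have -> : strip T = \bigcup_n (`[0, T]%classic `*` Un n) :> set (R * borel U).
  by rewrite -setX_bigcupr UnT.
have mn n : measurable (`[0, T]%classic `*` Un n : set (R * borel U)).
  exact: measurableX.
have cmu : mu (`[0, T]%classic `*` Un n) @[n --> \oo] -->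
    mu (\bigcup_n (`[0, T]%classic `*` Un n)).
  apply: nondecreasing_cvg_mu => //; first exact: bigcupT_measurable.
  move=> m n mn'; apply/subsetPset => -[r u] [/= ? Uu]; split => //=.
  by have /subsetPset := nUn _ _ mn'; exact.
rewrite -(cvg_lim _ cmu)//; apply: lime_le; first by apply/cvg_ex; eexists; exact: cmu.
apply: nearW => n; apply: ereal_sup_ubound; exists (Un n) => //.
by rewrite muE.
Qed.

End intensities.

(** The subgroup generated by a countable dense set, its elements coded by words of signed indices;
    the sums and differences of polarization stay in the family. *)
Lemma countable_dense_subgroup {R : realType} (H : normedModType R) :
  separable_space H -> exists d_ : nat -> H,
    [/\ range d_ 0, forall x y, range d_ x -> range d_ y -> range d_ (x + y),
      forall x, range d_ x -> range d_ (- x)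
    & forall x e, 0 < e -> exists2 y, range d_ y & `|x - y| < e].
Proof.
move=> [S [cS dS]]; have /countable_injP[f finj] := cS.
(* An index that codes no element of [S] yields 0 and contributes nothing to a sum. *)
pose s n := xget (0 : H) [set x | S x /\ f x = n].
have sf x : S x -> s (f x) = x.
  move=> Sx; rewrite /s; case: xgetP => [y -> [Sy fy]|/(_ x)]; last by case.
  by apply: finj => //; exact: mem_set.
pose g (p : bool * nat) := if p.1 then - s p.2 else s p.2.
pose e (l : seq (bool * nat)) := \sum_(p <- l) g p.
pose d_ n := e (odflt [::] (unpickle n)).
have de l : range d_ (e l) by exists (pickle l) => //; rewrite /d_ pickleK.
exists d_; split.
- by have := de [::]; rewrite /e big_nil.
- move=> _ _ [m _ <-] [n _ <-]; rewrite /d_.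
  by have := de (odflt [::] (unpickle m) ++ odflt [::] (unpickle n)); rewrite /e big_cat.
- move=> _ [n _ <-]; rewrite /d_ /e -sumrN.
  have := de [seq (~~ p.1, p.2) | p <- odflt [::] (unpickle n)].
  rewrite /e big_map (eq_bigr (fun p => - g p))// => -[[|] m] _ //=.
  by rewrite /g/= opprK.
- move=> x eps eps0.
  have xB : ball x eps !=set0 by exists x; exact: ballxx.
  have [y [xy Sy]] := dS _ xB (ball_open x eps).
  exists y; last by rewrite -ball_normE in xy.
  by have := de [:: (false, f y)]; rewrite /e big_seq1 /g/= sf.
Qed.

Section countable_density.
Context {d} {Omega : measurableType d} {R : realType} (P : probability Omega R).
Context {dV} {V : measurableType dV}.
Variable F : R -> set_system Omega.
Hypothesis filF : filtration F.
Variable D : (set V)^nat.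
Hypotheses (mD : @measurable _ V = <<s range D >>) (DI : setI_closed (range D))
  (DT : D 0%N = setT).

Local Notation PT := (g_sigma_algebraType (pred_rect F)).
Local Notation gr := (@graph _ _ _ F _ V).
Local Open Scope ereal_scope.

Lemma countable_density (k : nat -> Omega -> {measure set (R * V) -> \bar R})
    (c : nat -> R) :
  (forall n, predictable_kernel F (k n)) -> (forall n, 0 < c n)%R ->
  (forall w, \sum_(n <oo) (c n)%:E * k n w setT < +oo) ->
  exists (mu : Omega -> {measure set (R * V) -> \bar R}) (p : nat -> PT * V -> R),
  [/\ predictable_kernel F mu,
      forall n, measurable_fun setT (p n),
      forall n z, (0 <= p n z <= (c n)^-1)%R
    & \forall w \ae P, forall n E, measurable E ->
        k n w E = \int[mu w]_(s in E) (p n (gr w s))%:E].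
Proof.
(* [mu = \sum_n c_n k_n] dominates every [c_n k_n]. *)
move=> pk c0 fin.
pose cn n : {nonneg R} := NngNum (ltW (c0 n)).
pose nu n w : {measure set (R * V) -> \bar R} := mscale (cn n) (k n w).
pose mu w : {measure set (R * V) -> \bar R} := mseries (nu ^~ w) 0.
have nuE n w E : nu n w E = (c n)%:E * k n w E by [].
have muE w E : mu w E = \sum_(n <oo) (c n)%:E * k n w E by [].
have pmu : predictable_kernel F mu.
  split.
  - move=> E mE; rewrite (_ : mu ^~ E = fun w => \sum_(n <oo) (c n)%:E * k n w E)//.
    apply: ge0_emeasurable_sum; first by move=> n w _ _; rewrite mule_ge0// lee_fin ltW.
    by move=> n _; apply: measurable_funeM; have [mk _ _] := pk n; exact: mk.
  - by move=> w; rewrite muE.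
  - move=> B mB.
    rewrite (_ : (fun z => _) = fun z : PT =>
      \sum_(n <oo) (c n)%:E * k n z.1 (`]-oo, z.2]%classic `*` B))//.
    apply: ge0_emeasurable_sum; first by move=> n z _ _; rewrite mule_ge0// lee_fin ltW.
    by move=> n _; apply: measurable_funeM; have [_ _ kp] := pk n; exact: kp.
have numu n w E : measurable E -> nu n w E <= mu w E.
  move=> mE; rewrite nuE muE (nneseriesD1 (n := n))//; last first.
    by move=> m _; rewrite mule_ge0// lee_fin ltW.
  by rewrite leeDl// nneseries_ge0// => m _ _; rewrite mule_ge0// lee_fin ltW.
have pnu n : predictable_kernel F (nu n).
  have [mk koo kp] := pk n; split.
  - by move=> E mE; apply: measurable_funeM; exact: mk.
  - move=> w; apply: le_lt_trans (fin w); exact: numu.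
  - by move=> B mB; apply: measurable_funeM; exact: kp.
have /choice[p' p'P] n := predictable_density P filF mD DI DT pmu (pnu n) (numu n).
exists mu, (fun n z => p' n z / c n)%R; split => //.
- by move=> n; have [mp _ _] := p'P n; apply: measurable_funM.
- move=> n z; have [_ /(_ z)/andP[p0 p1] _] := p'P n.
  apply/andP; split; first by rewrite divr_ge0// ltW.
  by rewrite -[leRHS]mul1r ler_wpM2r// invr_ge0 ltW.
apply: ae_foralln => n; have [mp p01] := p'P n; apply: filterS => w kE E mE.
have p0 z : 0 <= (p' n z)%:E by rewrite lee_fin; case/andP: (p01 z).
under eq_integral do rewrite EFinM muleC.
rewrite ge0_integralZl_EFin//; last 2 first.
- apply/measurable_funTS; apply: (measurableT_comp (f := EFin \o p' n)).
    exact/measurable_EFinP.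
  exact: measurable_graph.
- by rewrite invr_ge0 ltW.
rewrite -kE// nuE muleA -EFinM mulVf ?mul1e// gt_eqF//.
Qed.

End countable_density.

Section intensity_kernel.
Context {R : realType} {d} {Omega : measurableType d} (P : probability Omega R).
Context (F : R -> set_system Omega) (U : ptopologicalType).
Context (nu : Omega -> set (R * borel U) -> \bar R) (T : R) (N : set Omega).
Hypotheses (filF : filtration F) (ucF : usual_conditions P F) (T0 : 0 < T).
Hypotheses (mN : measurable N) (PN : P N = 0%E).
Hypotheses (rm_nu : random_measure P nu) (pr_nu : predictable_random_measure F nu).
Hypothesis nu_meas : forall w, ~ N w -> is_measure (nu w).
Hypothesis nu_fin : forall w, ~ N w -> (nu w (strip T) < +oo)%E.

Local Notation PT := (g_sigma_algebraType (pred_rect F)).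

(** The intensity is cut to the strip and set to 0 on the null set [N]. The usual conditions put [N]
    in [F 0], so this modification preserves predictability. *)
Lemma intensity_kernel :
  exists2 k : Omega -> {measure set (R * borel U) -> \bar R},
    predictable_kernel F k &
    forall w C, measurable C ->
      (~ N w -> k w C = nu w (C `&` strip T)) /\ (N w -> k w C = 0%E).
Proof.
have mst : measurable (strip T : set (R * borel U)) by rewrite /strip; exact: measurableX.
have /choice[k kE] : forall w, exists m : {measure set (R * borel U) -> \bar R},
    forall C, measurable C ->
      (~ N w -> m C = nu w (C `&` strip T)) /\ (N w -> m C = 0%E).
  move=> w; have [Nw|Nw] := pselect (N w); first by exists mzero => C mC; split.
  have [m mE] := nu_meas Nw.
  exists (mrestr m mst) => C mC; split => // _.
  by rewrite mE//; exact: measurableI.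
exists k => //; split.
- move=> E mE; rewrite (_ : k ^~ E = (nu ^~ (E `&` strip T)) \_ (~` N)).
    apply/(measurable_restrictT _ (measurableC mN))/measurable_funTS.
    have [mnu _ _] := rm_nu; apply: mnu; exact: measurableI.
  apply/funext => w; rewrite patchE; case: ifPn => [/set_mem Nw|].
    by have [->] := kE w E mE.
  by rewrite notin_setE => /contrapT Nw; have [_ ->] := kE w E mE.
- move=> w; have [Nw|Nw] := pselect (N w).
    by have [_ ->] := kE w setT measurableT.
  by have [-> // _] := kE w setT measurableT; rewrite setTI nu_fin.
move=> B mB.
pose h (z : PT) := nu z.1 (`[0, z.2]%classic `*` B).
pose good : set PT := ~` N `*` `[0, +oo[%classic.
have FN : F 0 (~` N).
  have [sF _ _] := filF; have [_ FC _] := sF 0 (lexx 0).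
  by rewrite -setTD; apply: FC; have [_ FN] := ucF; exact: FN.
have mpos : measurable ([set: Omega] `*` `[0, +oo[%classic : set PT).
  rewrite (_ : _ `*` _ = (fun z : PT => z.2) @^-1` `[0, +oo[%classic).
    by rewrite -[X in measurable X]setTI; exact: (measurable_time filF).
  by apply/seteqP; split => -[w t] //= [].
have mgood : measurable good.
  rewrite /good (_ : _ `*` _ = (~` N `*` setT) `&` (setT `*` `[0, +oo[%classic)).
    by apply: measurableI => //; exact: measurable_cylinder.
  by rewrite -setXI setIT setTI.
have mh : measurable_fun good h.
  apply: (@measurable_funS _ _ PT _ ([set: Omega] `*` `[0, +oo[%classic)) => //.
    by move=> [w t] [].
  move=> _ Y mY; apply: (predictable_measurable filF); exact: (pr_nu mB mY).
have mh' : measurable_fun setT (h \_ good) by exact/(measurable_restrictT _ mgood).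
(* For t nonnegative and a good path the mass of the past is the distribution function of [nu]
   stopped at T. Before time 0 and on [N] both sides are 0. *)
rewrite (_ : (fun z => _) = fun z : PT => (h \_ good) (z.1, Num.min z.2 T)).
  exact: measurableT_comp mh' (measurable_stop filF T).
apply/funext => -[w t] /=; rewrite patchE.
have mpast : measurable (`]-oo, t]%classic `*` B) by exact: measurableX.
case: ifPn => [|].
  rewrite inE => -[/= Nw]; rewrite in_itv/= andbT => t0.
  have [-> // _] := kE w _ mpast; rewrite /h/=; congr (nu w _).
  apply/seteqP; split => -[r u]; rewrite /strip/= !in_itv/= le_min.
    by move=> [[rt Bu] [/andP[r0 rT] _]]; rewrite r0 rT rt.
  by move=> [/and3P[r0 rt rT] Bu]; rewrite r0 rT rt.
rewrite notin_setE => Ng; have [Nw|Nw] := pselect (N w).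
  by have [_ ->] := kE w _ mpast.
have t0 : t < 0.
  rewrite ltNge; apply/negP => t0; apply: Ng; split => //=.
  by rewrite in_itv/= andbT le_min t0 ltW.
have [-> // _] := kE w _ mpast; rewrite (_ : _ `&` _ = set0).
  by have [m ->] := nu_meas Nw; rewrite ?measure0.
apply/seteqP; split => -[r u] //; rewrite /strip/= !in_itv/= => -[[rt _] [/andP[r0 _] _]].
by have := le_lt_trans (le_trans r0 rt) t0; rewrite ltxx.
Qed.

End intensity_kernel.

Section sup_density.
Context {d} {S : measurableType d} {R : realType}.
Variables (m e : {measure set S -> \bar R}) (g : nat -> S -> R) (A : set S).
Hypotheses (mA : measurable A) (mg : forall n, measurable_fun setT (g n))
  (g0 : forall n x, 0 <= g n x).
Local Open Scope ereal_scope.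
Hypothesis ge : forall n E, measurable E -> E `<=` A ->
  \int[m]_(x in E) (g n x)%:E <= e E.

Fixpoint running_max n x : R :=
  if n is n'.+1 then Num.max (running_max n' x) (g n' x) else 0%R.

Let rm0 n x : (0 <= running_max n x)%R.
Proof. by elim: n => //= n ih; rewrite le_max ih. Qed.

Let mrm n : measurable_fun setT (running_max n).
Proof. by elim: n => [|n ih] //=; exact: measurable_maxr. Qed.

(** A maximum of two densities equals one of them on each part of [E] cut along the comparison set,
    and [e] is additive over the parts. Starting [running_max] at 0 is harmless, the densities being
    nonnegative. *)
Let rm_le n E : measurable E -> E `<=` A ->
  \int[m]_(x in E) (running_max n x)%:E <= e E.
Proof.
elim: n E => [|n ih] E mE EA; first by rewrite /= integral0.
pose B := [set x | (g n x <= running_max n x)%R].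
have mB : measurable B.
  by rewrite -[B]setTI; exact: measurable_fun_le.
have meas : measurable_fun setT (EFin \o running_max n.+1).
  by apply/measurable_EFinP; exact: mrm.
rewrite -(setUIDK E B) ge0_integral_setU//; first last.
- by apply/disj_setPS => x [[_ ?] [_]].
- by move=> x _; rewrite lee_fin; exact: (rm0 n.+1).
- exact: measurable_funTS.
- exact: measurableD.
- exact: measurableI.
rewrite measureU; last 3 first.
- exact: measurableI.
- exact: measurableD.
- by apply/seteqP; split => // x [[_ ?] [_]].
apply: leeD.
  rewrite (eq_integral (fun x => (running_max n x)%:E)); last first.
    by move=> x; rewrite inE => -[_ Bx] /=; rewrite max_l.
  by apply: ih; [exact: measurableI|move=> x [/EA]].
rewrite (eq_integral (fun x => (g n x)%:E)); last first.
  by move=> x; rewrite inE => -[_ /negP]; rewrite -ltNge /= => h; rewrite max_r// ltW.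
by apply: ge; [exact: measurableD|move=> x [/EA]].
Qed.

Lemma sup_density_le E : measurable E -> E `<=` A ->
  \int[m]_(x in E) (ereal_sup (range (fun n => (g n x)%:E))) <= e E.
Proof.
move=> mE EA.
have nd x : nondecreasing_seq (fun n => (running_max n x)%:E).
  by apply/nondecreasing_seqP => n; rewrite lee_fin /= le_max lexx.
have supE x : ereal_sup (range (fun n => (g n x)%:E)) =
    limn (fun n => (running_max n x)%:E).
  have -> : limn (fun n => (running_max n x)%:E) =
      ereal_sup (range (fun n => (running_max n x)%:E)).
    by apply/cvg_lim => //; exact: ereal_nondecreasing_cvgn.
  apply/eqP; rewrite eq_le; apply/andP; split.
    apply: ge_ereal_sup => _ [n _ <-].
    apply: le_trans (ereal_sup_ubound _); last by exists n.+1 => //.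
    by rewrite lee_fin /= le_max lexx orbT.
  apply: ge_ereal_sup => _ [n _ <-].
  elim: n => [|n ih] /=.
    apply: le_trans (ereal_sup_ubound _); last by exists 0%N => //.
    by rewrite lee_fin.
  rewrite EFin_max ge_max ih/=; apply: ereal_sup_ubound; by exists n.
under eq_integral do rewrite supE.
rewrite monotone_convergence//.
- apply: lime_le; last by apply: nearW => n; exact: rm_le.
  apply: ereal_nondecreasing_is_cvgn => a b ab.
  apply: ge0_le_integral => //.
  + by move=> x _; rewrite lee_fin.
  + by apply/measurable_funTS/measurable_EFinP.
  + by apply/measurable_funTS/measurable_EFinP.
  + by move=> x _; exact: nd.
- by move=> n; apply/measurable_funTS/measurable_EFinP.
- by move=> n x _; rewrite lee_fin.
Qed.

End sup_density.

Section intensity_density.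
Context {R : realType} {d} {Omega : measurableType d} (P : probability Omega R).
Context (F : R -> set_system Omega) (U : ptopologicalType) (calA : set (set U)).
Context (X : completeNormedModType R) (M : R -> set U -> dual X -> Omega -> R).
Context (nu : dual X -> Omega -> set (R * borel U) -> \bar R).
Context (eta : Omega -> set (R * borel U) -> \bar R) (T : R).
Context (alpha : Omega -> set (R * borel U) -> bil (dual X)).
Hypotheses (filF : filtration F) (ucF : usual_conditions P F) (lusU : lusin_space R U)
  (cM : cylindrical_orthogonal_martingale_valued_measure P F calA M)
  (iM : is_intensity P F calA M nu) (T0 : 0 < T) (aM : is_alpha P nu T alpha)
  (etaM : is_quadratic_variation P calA nu eta)
  (eta_bounded : \forall w \ae P,
    (ereal_sup [set eta w (`[0%R, T]%classic `*` A) | A in calA] < +oo)%E).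

Local Notation PT := (g_sigma_algebraType (pred_rect F)).
Local Notation gr := (@graph _ _ _ F _ (borel U)).

Lemma intensity_density (d_ : nat -> dual X) :
  exists (mu : Omega -> {measure set (R * borel U) -> \bar R})
    (p : dual X -> PT * borel U -> R),
  [/\ predictable_kernel F mu,
      forall x, measurable_fun setT (p x),
      forall x z, 0 <= p x z
    & \forall w \ae P, forall x C, range d_ x -> borel_strip T C ->
        (\int[mu w]_(s in C) (p x (gr w s))%:E = (alpha w C x x)%:E)%E].
Proof.
pose good w := [/\ forall n, is_measure (nu (d_ n) w),
  forall n C, borel_strip T C -> nu (d_ n) w C = (alpha w C (d_ n) (d_ n))%:E,
  forall n C, borel_strip T C ->
    (nu (d_ n) w C <= (`|d_ n| ^+ 2)%:E * eta w C)%E,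
  (eta w (strip T) < +oo)%E & (0 <= eta w (strip T))%E].
have mst : measurable (strip T : set (R * borel U)) by rewrite /strip; apply: measurableX.
have sst : borel_strip T (strip T : set (R * borel U)) by split.
have [[[meta eta_ge0 eta_meas] _] _ _ _] := etaM.
have [N [mN PN goodN]] : \forall w \ae P, good w.
  have h1 : \forall w \ae P, forall n, is_measure (nu (d_ n) w).
    by apply: ae_foralln => n; have [[[_ _ ?] _] _ _ _] := iM (d_ n).
  have h2 : \forall w \ae P, forall n C, borel_strip T C ->
      nu (d_ n) w C = (alpha w C (d_ n) (d_ n))%:E.
    by apply: ae_foralln => n; exact: (intensity_alpha filF cM iM T0 aM).
  have h3 : \forall w \ae P, forall n C, borel_strip T C ->
      (nu (d_ n) w C <= (`|d_ n| ^+ 2)%:E * eta w C)%E.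
    by apply: ae_foralln => n; exact: (intensity_le filF cM iM T0 aM etaM).
  have h4 := quadratic_variation_fin cM etaM eta_bounded.
  have h12 : \forall w \ae P, (forall n, is_measure (nu (d_ n) w)) /\
    forall n C, borel_strip T C -> nu (d_ n) w C = (alpha w C (d_ n) (d_ n))%:E.
    by move: h1 h2; apply: filterS2.
  by move: h12 h3 h4; apply: filterS3 => w [? ?] ? ?; split => //; exact: eta_ge0.
have goodP w : ~ N w -> good w by move=> Nw; apply: contrapT => /goodN.
have /choice[k kP] n : exists k : Omega -> {measure set (R * borel U) -> \bar R},
    predictable_kernel F k /\
    forall w C, measurable C ->
      (~ N w -> k w C = nu (d_ n) w (C `&` strip T)) /\ (N w -> k w C = 0%E).
  have [[rn _] prn _ _] := iM (d_ n).
  have [||k pk kE] := intensity_kernel filF ucF T0 mN PN rn prn.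
  - by move=> w /goodP[].
  - by move=> w /goodP[_ nuE _ _ _]; rewrite nuE// ltry.
  by exists k.
(* The n-th intensity has mass at most |d_n|^2 times that of [eta] on the strip. The second factor
   absorbs |d_n|^2, with 1 added to avoid dividing by 0, and the powers of 2 make the series
   converge. *)
pose c n : R := (2 ^ n.+1)%:R^-1 / (1 + `|d_ n| ^+ 2).
have dpos n : 0 < 1 + `|d_ n| ^+ 2 by rewrite ltr_pwDl// sqr_ge0.
have c0 n : 0 < c n.
  by rewrite /c divr_gt0// invr_gt0 ltr0n expn_gt0.
have [D [mD DI DT]] := lusin_generator lusU.
have fin w : (\sum_(0 <= n <oo) ((c n)%:E * k n w setT) < +oo)%E.
  have [Nw|/goodP[_ _ le_nu fin ge0]] := pselect (N w).
    rewrite eseries0// => n _ _; have [_ /(_ w setT measurableT)[_ ->]] := kP n => //.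
    by rewrite mule0.
  pose e := fine (eta w (strip T)).
  have etaE : eta w (strip T) = e%:E by rewrite fineK// ge0_fin_numE.
  have e0 : 0 <= e by rewrite fine_ge0.
  apply: le_lt_trans (ltry e).
  apply: le_trans (epsilon_trick0 xpredT e0).
  apply: lee_nneseries => [n _ _|n _].
    by rewrite mule_ge0// lee_fin ltW.
  have kle : (k n w setT <= (`|d_ n| ^+ 2 * e)%:E)%E.
    have [Nw|Nw] := pselect (N w).
      have [_ /(_ w setT measurableT)[_ ->]] := kP n => //.
      by rewrite lee_fin mulr_ge0// sqr_ge0.
    have [_ /(_ w setT measurableT)[-> // _]] := kP n.
    by rewrite setTI EFinM -etaE le_nu.
  apply: le_trans (lee_wpmul2l _ kle) _; first by rewrite lee_fin ltW.
  rewrite -EFinM lee_fin /c.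
  have -> : (2 ^ n.+1)%:R^-1 / (1 + `|d_ n| ^+ 2) * (`|d_ n| ^+ 2 * e) =
    e / (2 ^ n.+1)%:R * (`|d_ n| ^+ 2 / (1 + `|d_ n| ^+ 2)) :> R by ring.
  rewrite ler_piMr//; first by rewrite divr_ge0.
  by rewrite ler_pdivrMr// mul1r lerDr.
have pk n : predictable_kernel F (k n) by have [] := kP n.
have [mu [p [pmu mp p01 kE]]] := countable_density P filF mD DI DT pk c0 fin.
(* Polarization needs densities indexed by functionals, while the enumeration may repeat; one index
   is fixed for each element. Outside the range the value is arbitrary. *)
pose idx x := xget 0%N [set n | d_ n = x].
have idxP x : range d_ x -> d_ (idx x) = x.
  by move=> [n _ <-]; rewrite /idx; case: xgetP => [m _ //|/(_ n)]; case.
exists mu, (fun x => p (idx x)); split => //.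
  by move=> x z; have /andP[] := p01 (idx x) z.
have aN : \forall w \ae P, ~ N w.
  by exists N; split => // w /contrapT.
move: kE aN; apply: filterS2 => w kE Nw.
have [_ nuE _ _ _] := goodP w Nw.
move=> x C Dx sC; have [mC CT] := sC.
rewrite -kE//; have [_ /(_ w C mC)[-> // _]] := kP (idx x).
by move/setIidPl: CT => ->; rewrite nuE// idxP.
Qed.

End intensity_density.

(** * The density of the quadratic variation *)

Lemma is_measure_setID {d} {S : measurableType d} {R : realType} (m : set S -> \bar R) A B :
  is_measure m -> measurable A -> measurable B -> m A = (m (A `&` B) + m (A `\` B))%E.
Proof.
move=> [mu mE] mA mB.
have mI : measurable (A `&` B) by exact: measurableI.
have mD : measurable (A `\` B) by exact: measurableD.
rewrite !mE// -measureU// ?setUIDK//.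
by apply/seteqP; split => // s [[_ ?] [_]].
Qed.

(** The homogeneous form of the bound lets arbitrary approximants of a unit vector be used, without
    normalizing them inside the subgroup. *)
Lemma bil_le_dense {R : realType} {H : normedModType R} (b : bil H) (D : set H) (c : R) :
  (forall (x : H) e, 0 < e -> exists2 y, D y & `|x - y| < e) ->
  0 <= c -> (forall x, D x -> b x x <= c * `|x| ^+ 2) ->
  forall x, b x x <= c * `|x| ^+ 2.
Proof.
move=> Dd c0 bD x; have [u uP] := dense_approx Dd x.
have [_ _ [k bk]] := bilP b.
apply: (@ler_addinv_all _ _ _ ((`|k| + c) * (2 * `|x| + 1))) => n.
have [Du un] := uP n; set e := n.+1%:R^-1 in un *.
have e1 : e <= 1 by rewrite invf_le1// ler1n.
have xu : `|x - u n| <= e by [].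
have nu : `|u n| <= `|x| + e.
  have -> : u n = x - (x - u n) by rewrite opprB addrC subrK.
  by rewrite (le_trans (ler_normB _ _))// lerD2l.
have bk' y z : b y z <= `|k| * `|y| * `|z|.
  apply: le_trans (ler_norm _) (le_trans (bk y z) _).
  by rewrite -!mulrA ler_wpM2r ?mulr_ge0// ler_norm.
have -> : b x x = b (u n) (u n) + (b (x - u n) x + b (u n) (x - u n)).
  by rewrite !(bilDl, bilDr, bilNl, bilNr); ring.
have h1 : b (u n) (u n) <= c * (`|x| ^+ 2 + e * (2 * `|x| + 1)).
  apply: le_trans (bD _ Du) _; apply: ler_wpM2l => //.
  apply: (@le_trans _ _ ((`|x| + e) ^+ 2)); first by rewrite lerXn2r ?nnegrE ?addr_ge0 ?invr_ge0.
  rewrite sqrrD -addrA lerD2l mulrDr mulr1 -mulr_natl mulrA (mulrC _ e) lerD2l expr2.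
  by rewrite ler_piMr ?invr_ge0.
have xe : `|k| * `|x - u n| <= `|k| * e by rewrite ler_wpM2l.
have h2 : b (x - u n) x <= `|k| * e * `|x|.
  by apply: le_trans (bk' _ _) _; rewrite ler_wpM2r.
have h3 : b (u n) (x - u n) <= `|k| * e * (`|x| + 1).
  apply: le_trans (bk' _ _) _; rewrite -mulrA (mulrC `|u n|) mulrA.
  apply: ler_pM => //; rewrite ?mulr_ge0//.
  by apply: le_trans nu _; rewrite lerD2l.
apply: le_trans (lerD h1 (lerD h2 h3)) _.
by rewrite le_eqVlt; apply/orP; left; apply/eqP; ring.
Qed.

Section sup_intensity_density.
Context {R : realType} {H : normedModType R} {Z : Type}.
Variables (d_ : nat -> H) (p : H -> Z -> R).

(* At [d_ n = 0] the term is [x / 0 = 0]. *)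
Definition sup_intensity_density (z : Z) : \bar R :=
  ereal_sup (range (fun n => (p (d_ n) z / `|d_ n| ^+ 2)%:E)).

Local Notation sd := sup_intensity_density.

Lemma sup_intensity_density_ge0 : (forall x z, 0 <= p x z) -> forall z, (0 <= sd z)%E.
Proof.
move=> p0 z; apply: le_trans (ereal_sup_ubound _); last by exists 0%N.
by rewrite lee_fin divr_ge0// sqr_ge0.
Qed.

(** The alternative [x = 0] remains because nothing yet makes [p 0 z] vanish. *)
Lemma intensity_density_le x z : range d_ x -> ((p x z)%:E <= (`|x| ^+ 2)%:E * sd z)%E \/ x = 0.
Proof.
move=> [n _ <-]; have [->|x0] := eqVneq (d_ n) 0; [by right|left].
have x20 : 0 < `|d_ n| ^+ 2 by rewrite exprn_gt0// normr_gt0.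
rewrite muleC -lee_pdivrMr// -EFinM.
by apply: ereal_sup_ubound; exists n.
Qed.

End sup_intensity_density.

Lemma measurable_sup_intensity_density {R : realType} {H : normedModType R} {d}
    {Z : measurableType d} (d_ : nat -> H) (p : H -> Z -> R) :
  (forall x, measurable_fun setT (p x)) ->
  measurable_fun setT (sup_intensity_density d_ p).
Proof.
move=> mp; rewrite (_ : sup_intensity_density d_ p =
    fun z => esups (fun n => (p (d_ n) z / `|d_ n| ^+ 2)%:E) 0%N).
  apply: (@measurable_fun_esups _ _ _ setT
    (fun n z => (p (d_ n) z / `|d_ n| ^+ 2)%:E)) => n.
  by apply/measurable_EFinP; exact: measurable_funM.
apply/funext => z; rewrite /esups /sdrop; congr (ereal_sup _).
by apply/seteqP; split => _ [n _ <-]; exists n.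
Qed.

Section quadratic_variation_density.
Context {R : realType} {d} {Omega : measurableType d} (P : probability Omega R).
Context (F : R -> set_system Omega) (U : ptopologicalType) (calA : set (set U)).
Context (X : completeNormedModType R) (M : R -> set U -> dual X -> Omega -> R).
Context (nu : dual X -> Omega -> set (R * borel U) -> \bar R).
Context (eta : Omega -> set (R * borel U) -> \bar R) (T : R).
Context (alpha : Omega -> set (R * borel U) -> bil (dual X)).
Hypotheses (filF : filtration F)
  (cM : cylindrical_orthogonal_martingale_valued_measure P F calA M)
  (iM : is_intensity P F calA M nu) (T0 : 0 < T) (aM : is_alpha P nu T alpha)
  (etaM : is_quadratic_variation P calA nu eta).

Local Notation PT := (g_sigma_algebraType (pred_rect F)).
Local Notation gr := (@graph _ _ _ F _ (borel U)).

Variables (d_ : nat -> dual X) (mu : Omega -> {measure set (R * borel U) -> \bar R})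
  (p : dual X -> PT * borel U -> R).
Hypotheses (pmu : predictable_kernel F mu)
  (mp : forall x, measurable_fun setT (p x)) (p0 : forall x z, 0 <= p x z).
Hypothesis pE : \forall w \ae P, forall x C, range d_ x -> borel_strip T C ->
  (\int[mu w]_(s in C) (p x (gr w s))%:E = (alpha w C x x)%:E)%E.
Hypothesis d_dense : forall (x : dual X) e, 0 < e -> exists2 y, range d_ y & `|x - y| < e.

Local Notation sd := (sup_intensity_density d_ p).

Let msd w : measurable_fun setT (sd \o gr w).
Proof. by apply: measurableT_comp (measurable_graph w); exact: measurable_sup_intensity_density mp. Qed.

Lemma quadratic_variation_density : \forall w \ae P, forall C, borel_strip T C ->
  eta w C = (\int[mu w]_(s in C) sd (gr w s))%E.
Proof.
have mst : measurable (strip T : set (R * borel U)) by rewrite /strip; apply: measurableX.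
have mstC := measurableC mst.
have [[[meta eta_ge0 eta_meas] eta_neg] _ eta_dom eta_min] := etaM.
(* Minimality of [eta] is applied to the random measure with density [sd] on
   the strip that agrees with [eta] off the strip. *)
pose zeta w C : \bar R := (\int[mu w]_(s in C `&` strip T) sd (gr w s) + eta w (C `\` strip T))%E.
have zeta_time : time_random_measure P zeta.
  split; first split.
  - move=> E mE; apply: emeasurable_funD.
      apply: (measurable_graph_integral filF pmu).
      + exact: measurableI.
      + exact: measurable_sup_intensity_density.
      + exact: sup_intensity_density_ge0.
    by apply: meta; exact: measurableD.
  - move=> w E mE; apply: adde_ge0; last by apply: eta_ge0; exact: measurableD.
    by apply: integral_ge0 => x _; exact: sup_intensity_density_ge0.
  - move: eta_meas; apply: filterS => w [m mE].
    have [m1 m1E] := density_measure (mu w) (msd w) (fun s => sup_intensity_density_ge0 d_ p0 (gr w s)).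
    exists (measure_add (mrestr m1 mst) (mrestr m mstC)) => E mE'.
    transitivity (mrestr m1 mst E + mrestr m mstC E)%E.
      rewrite /zeta mE; last exact: measurableD.
      by rewrite /mrestr m1E.
    exact: esym (measure_addE _ _ _).
  - move: eta_neg; apply: filterS => w eta0.
    rewrite /zeta (_ : _ `&` _ = set0) ?integral_set0 ?add0e; last first.
      by apply/seteqP; split => -[r u]; rewrite /strip//= !in_itv/= => -[[r0 _] [/andP[/le_lt_trans/(_ r0)]]]; rewrite ltxx.
    rewrite (_ : _ `\` _ = `]-oo, 0%R[%classic `*` setT)//.
    apply/seteqP; split => -[r u]; rewrite /strip/= !in_itv/=; first by case.
    by move=> [r0 _]; split => // -[/andP[/le_lt_trans/(_ r0)]]; rewrite ltxx.
have zeta_dom : dominates_intensity P nu zeta.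
  move=> x x1; have [[[_ _ nu_meas] _] _ _ _] := iM x.
  have hx := intensity_alpha filF cM iM T0 aM x.
  have : \forall w \ae P, is_measure (nu x w) /\
      forall C, borel_strip T C -> nu x w C = (alpha w C x x)%:E.
    by move: nu_meas hx; apply: filterS2.
  move: (eta_dom x x1) pE; apply: filterS3 => w le_eta pw [mx nuE] C mC.
  have mCs : measurable (C `&` strip T) by exact: measurableI.
  have mCd : measurable (C `\` strip T) by exact: measurableD.
  rewrite (is_measure_setID mx mC mst); apply: leeD; last exact: le_eta.
  have sC : borel_strip T (C `&` strip T) by split => // s [].
  rewrite nuE//; set I := (\int[mu w]_(s in _) _)%E.
  have I0 : (0 <= I)%E by apply: integral_ge0 => s _; exact: sup_intensity_density_ge0.
  have [Ioo|Ifin] := eqVneq I +oo%E; first by rewrite Ioo leey.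
  have IE : I = (fine I)%:E by rewrite fineK// ge0_fin_numE// ltey.
  rewrite IE lee_fin.
  (* Written with |x|^2, the bound makes sense on the whole dual and can be checked on the subgroup,
     where [alpha] is the integral of [p]. *)
  suff : alpha w (C `&` strip T) x x <= fine I * `|x| ^+ 2 by rewrite x1 expr1n mulr1.
  apply: (bil_le_dense d_dense); first exact: fine_ge0.
  move=> y Dy; rewrite -lee_fin EFinM -IE -pw// muleC.
  have [y0|y0] := eqVneq y 0.
    rewrite y0 in Dy *.
    rewrite normr0 expr0n/= mul0e pw//.
    by rewrite bil0l.
  rewrite /I -ge0_integralZl_EFin//; last 2 first.
  - by move=> s _; exact: sup_intensity_density_ge0.
  - by apply/measurable_funTS; exact: msd.
  apply: ge0_le_integral => //.
  - by move=> s _; rewrite lee_fin.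
  - apply/measurable_funTS/measurable_EFinP; exact: (measurableT_comp (mp y) (measurable_graph w)).
  - by apply/measurable_funTS/measurable_funeM; exact: msd.
  - move=> s _; have [//|y0'] := intensity_density_le p (gr w s) Dy.
    by rewrite y0' eqxx in y0.
have etaE : \forall w \ae P, exists m : {measure set (R * borel U) -> \bar R},
  forall E, measurable E -> eta w E = m E by exact: eta_meas.
have zeta_le : rm_le P zeta eta.
  have : \forall w \ae P, forall n C, borel_strip T C ->
      nu (d_ n) w C = (alpha w C (d_ n) (d_ n))%:E /\
      (nu (d_ n) w C <= (`|d_ n| ^+ 2)%:E * eta w C)%E.
    apply: ae_foralln => n.
    have := intensity_alpha filF cM iM T0 aM (d_ n).
    have := intensity_le filF cM iM T0 aM etaM (d_ n).
    by apply: filterS2 => w h1 h2 C sC; split; [exact: h2|exact: h1].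
  move: etaE pE; apply: filterS3 => w [m mE] pw nuw C mC.
  have mCs : measurable (C `&` strip T) by exact: measurableI.
  have mCd : measurable (C `\` strip T) by exact: measurableD.
  rewrite /zeta [leRHS](@is_measure_setID _ _ _ _ _ (strip T))//; last by exists m.
  apply: leeD => //; rewrite mE//.
  (* Each normalized density integrates below the quadratic variation by scaled domination; hence so
     does their supremum. *)
  apply: (@sup_density_le _ _ _ (mu w) m
    (fun n s => p (d_ n) (gr w s) / `|d_ n| ^+ 2) (strip T)) => //.
  - by move=> n; apply: measurable_funM => //; exact: (measurableT_comp (mp _) (measurable_graph w)).
  - by move=> n s; rewrite divr_ge0// sqr_ge0.
  - move=> n E mE' Es.
    have sE : borel_strip T E by split.
    under eq_integral do rewrite mulrC EFinM.
    rewrite ge0_integralZl_EFin//; last 2 first.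
    + by move=> s _; rewrite lee_fin.
    + by apply/measurable_funTS/measurable_EFinP; exact: (measurableT_comp (mp _) (measurable_graph w)).
    rewrite pw//.
    have [<- le_nu] := nuw n E sE.
    have [d0|d0] := eqVneq (d_ n) 0.
      by rewrite d0 normr0 expr0n/= invr0 mul0e.
    have x20 : 0 < `|d_ n| ^+ 2 by rewrite exprn_gt0// normr_gt0.
    by rewrite muleC lee_pdivrMr// muleC -mE.
have := eta_min _ zeta_time zeta_dom zeta_le; move: zeta_le etaE.
apply: filterS3 => w h1 [m mE] h2 C [mC CT].
have zE : zeta w C = (\int[mu w]_(s in C) sd (gr w s))%E.
  have CD : C `\` strip T = set0 by rewrite setD_eq0.
  by rewrite /zeta CD; move/setIidPl: CT => ->; rewrite mE// measure0 adde0.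
by apply/eqP; rewrite -zE eq_le h1// h2.
Qed.

End quadratic_variation_density.

Section eq_integral_set_function.
Import HBNNSimple.

(** [eta w] is a bare set function agreeing with a measure only on measurable sets; the integral
    sees no other values, since simple functions have measurable level sets. *)
Lemma eq_integral_set_function {d} {S : measurableType d} {R : realType}
    (m1 m2 : set S -> \bar R) (D : set S) (f : S -> \bar R) :
  (forall E, measurable E -> m1 E = m2 E) ->
  (\int[m1]_(x in D) f x = \int[m2]_(x in D) f x)%E.
Proof.
move=> mE.
have sE (h : S -> R) : measurable_fun setT h -> sintegral m1 h = sintegral m2 h.
  move=> mh; apply: eq_fsbigr => r _; rewrite mE//.
  by rewrite -[X in measurable X]setTI; exact: mh.
by rewrite /integral; congr (ereal_sup _ - ereal_sup _)%E; apply: eq_imagel => h _; apply: sE; exact: measurable_funPT.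
Qed.

End eq_integral_set_function.

Lemma bop_le {R : realType} (V W : normedModType R) (f : bop V W) x :
  `|f x| <= `|f| * `|x|.
Proof.
have [->|x0] := eqVneq x 0; first by rewrite linear0 !normr0 mulr0.
have nx : 0 < `|x| by rewrite normr_gt0.
have [k fk] : exists k, forall y : V, [set y | `|y| <= 1] y -> `|f y| <= k.
  case: (f) => g /= /asboolP[_ [k gk]]; exists `|k| => y y1.
  by rewrite (le_trans (gk y))// (le_trans (ler_wpM2r _ (ler_norm k)))// ler_piMr.
rewrite -ler_pdivrMr// mulrC -{1}(gtr0_norm nx) -normfV -normrZ -linearZ.
apply: (sup_norm_ub fk) => /=.
by rewrite normrZ normfV normr_id mulVf ?normr_eq0.
Qed.

Lemma op_norm_le {R : realType} (V W : normedModType R) (f : bop V W) (k : R) :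
  0 <= k -> (forall x, `|f x| <= k * `|x|) -> `|f| <= k.
Proof.
move=> k0 fk; apply: sup_norm_le => [|x /= x1]; first by exists 0; rewrite /= normr0.
by apply: le_trans (fk x) _; rewrite ler_piMr.
Qed.

(** The form is a bare function so that the operators [Q z] and the forms [alpha C] are both
    covered. *)
Lemma bilinear_cvg {R : realType} {H : normedModType R} (b : H -> H -> R) (k : R)
    (x y : H) (u v : nat -> H) :
  (forall x y z, b (x - y) z = b x z - b y z) ->
  (forall x y z, b z (x - y) = b z x - b z y) ->
  (forall x y, `|b x y| <= k * `|x| * `|y|) ->
  (forall n, `|x - u n| <= n.+1%:R^-1) -> (forall n, `|y - v n| <= n.+1%:R^-1) ->
  b (u n) (v n) @[n --> \oo] --> b x y.
Proof.
move=> bl br bk ux vy.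
have e0 : (n.+1%:R^-1 : R) @[n --> \oo] --> (0 : R) by exact: cvg_harmonic.
apply/cvgrPdist_le => e ep; pose K := `|k| * (`|x| + `|y| + 1).
have K0 : 0 <= K by rewrite mulr_ge0// addr_ge0// addr_ge0.
have /cvgrPdist_le/(_ _ ep) : (K * n.+1%:R^-1) @[n --> \oo] --> (0 : R).
  by rewrite -(mulr0 K); apply: cvgMr e0.
apply: filterS => n; rewrite sub0r normrN ger0_norm; last by rewrite mulr_ge0// invr_ge0.
apply: le_trans.
have un : `|u n| <= `|x| + 1.
  rewrite -[u n](subKr x) (le_trans (ler_normB _ _))// lerD2l (le_trans (ux n))//.
  by rewrite invf_le1// ler1n.
have -> : b x y - b (u n) (v n) = b (x - u n) y + b (u n) (y - v n).
  by rewrite bl br addrA subrK.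
have bk' z t : `|b z t| <= `|k| * `|z| * `|t|.
  by apply: le_trans (bk z t) _; rewrite !ler_wpM2r// ler_norm.
apply: le_trans (ler_normD _ _) _.
have h1 : `|b (x - u n) y| <= `|k| * n.+1%:R^-1 * `|y|.
  by apply: le_trans (bk' _ _) _; rewrite ler_wpM2r// ler_wpM2l.
have h2 : `|b (u n) (y - v n)| <= `|k| * (`|x| + 1) * n.+1%:R^-1.
  by apply: le_trans (bk' _ _) _; rewrite ler_pM// ?mulr_ge0// ler_wpM2l.
apply: le_trans (lerD h1 h2) _.
by rewrite le_eqVlt; apply/orP; left; apply/eqP; rewrite /K; ring.
Qed.

(** * The covariance operator *)

Section quadratic_point.
Context {R : realType} {H : normedModType R} (d_ : nat -> H).

(** Linear relations between diagonal values, with multiplicities in the lists as coefficients.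
    Testing against all bounded forms avoids listing the relations needed. *)
Definition quadratic_identity (l l' : seq nat) : Prop := forall b : bil H,
  \sum_(i <- l) b (d_ i) (d_ i) = \sum_(i <- l') b (d_ i) (d_ i).

Context {Z : Type} (p : H -> Z -> R).

(* [p ^~ z] satisfies all the linear relations that hold for quadratic forms;
   these are countably many closed conditions on [z]. *)
Definition quadratic_at (z : Z) : Prop := forall l l', quadratic_identity l l' ->
  \sum_(i <- l) p (d_ i) z = \sum_(i <- l') p (d_ i) z.

Lemma quadratic_atP (z : Z) (l l' : seq H) : quadratic_at z ->
  (forall x, x \in l ++ l' -> range d_ x) ->
  (forall b : bil H, \sum_(x <- l) b x x = \sum_(x <- l') b x x) ->
  \sum_(x <- l) p x z = \sum_(x <- l') p x z.
Proof.
have lift (s : seq H) : (forall x, x \in s -> range d_ x) -> exists k, s = map d_ k.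
  elim: s => [|x s ih] Ds; first by exists [::].
  have [|k ->] := ih; first by move=> y ys; apply: Ds; rewrite inE ys orbT.
  have [n _ <-] : range d_ x by apply: Ds; rewrite inE eqxx.
  by exists (n :: k).
move=> qz Dl; have [|k ->] := lift l; first by move=> x xl; apply: Dl; rewrite mem_cat xl.
have [|k' ->] := lift l'; first by move=> x xl; apply: Dl; rewrite mem_cat xl orbT.
move=> kk'; rewrite !big_map; apply: qz => b.
by have := kk' b; rewrite !big_map.
Qed.

Hypotheses (D0 : range d_ 0)
  (DD : forall x y, range d_ x -> range d_ y -> range d_ (x + y))
  (DN : forall x, range d_ x -> range d_ (- x))
  (d_dense : forall (x : H) e, 0 < e -> exists2 y, range d_ y & `|x - y| < e).
Hypothesis p0 : forall x z, 0 <= p x z.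

Definition polar_density x y z := 4^-1 * (p (x + y) z - p (x - y) z).

Local Notation q := polar_density.
Local Notation sd := (sup_intensity_density d_ p).

Lemma polar_density_diag z x : quadratic_at z -> range d_ x -> q x x z = p x z.
Proof.
move=> qz Dx.
have e1 : \sum_(y <- [:: x + x]) p y z = \sum_(y <- [:: x; x; x; x]) p y z.
  apply: quadratic_atP => // [y|b].
    by rewrite !inE => /or4P[/eqP->|/eqP->|/eqP->|/orP[]/eqP->]//; exact: DD.
  by rewrite !big_cons !big_nil !(bilDl, bilDr); ring.
have e2 : \sum_(y <- [:: 0 : H]) p y z = \sum_(y <- [::]) p y z.
  apply: quadratic_atP => // [y|b]; first by rewrite !inE => /eqP->.
  by rewrite !big_cons !big_nil bil0l addr0.
move: e1 e2; rewrite !big_cons !big_nil !addr0 /q subrr => -> ->; lra.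
Qed.

Lemma polar_densityC z x y : quadratic_at z -> range d_ x -> range d_ y ->
  q x y z = q y x z.
Proof.
move=> qz Dx Dy.
have e1 : \sum_(t <- [:: x - y]) p t z = \sum_(t <- [:: y - x]) p t z.
  apply: quadratic_atP => // [t|b].
    by rewrite !inE => /orP[]/eqP->; apply: DD => //; exact: DN.
  by rewrite !big_cons !big_nil !(bilDl, bilDr, bilNl, bilNr); ring.
by move: e1; rewrite !big_cons !big_nil !addr0 /q (addrC y x) => ->.
Qed.

(** Additivity, multiplied by 4 and with negative terms moved across, is a relation between six
    diagonal values satisfied by every bilinear form. *)
Lemma polar_densityD z x y t : quadratic_at z ->
  range d_ x -> range d_ y -> range d_ t -> q (x + y) t z = q x t z + q y t z.
Proof.
move=> qz Dx Dy Dt.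
have e1 : \sum_(u <- [:: x + y + t; x - t; y - t]) p u z =
    \sum_(u <- [:: x + y - t; x + t; y + t]) p u z.
  apply: quadratic_atP => // [u|b].
    have DNt := DN Dt.
    by rewrite !inE => /or4P[/eqP->|/eqP->|/eqP->|/or3P[]/eqP->]; do ?apply: DD.
  by rewrite !big_cons !big_nil !(bilDl, bilDr, bilNl, bilNr); ring.
by move: e1; rewrite !big_cons !big_nil !addr0 /q => e1; lra.
Qed.

Lemma normalized_quadratic_form z : quadratic_at z -> (0 < sd z < +oo)%E ->
  exists Q : bop H (dual H),
  [/\ forall x y, range d_ x -> range d_ y -> Q x y = q x y z / fine (sd z),
      symmetric_op Q, positive_op Q,
      forall x y, `|Q x y| <= `|x| * `|y| & `|Q| = 1].
Proof.
move=> qz /andP[s0 soo].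
have sE : sd z = (fine (sd z))%:E by rewrite fineK// ge0_fin_numE// ltW.
have s_gt0 : 0 < fine (sd z) by rewrite -lte_fin -sE.
have p_le x : range d_ x -> p x z <= `|x| ^+ 2 * fine (sd z).
  move=> Dx; have [|x0] := intensity_density_le p z Dx.
    by rewrite sE -EFinM lee_fin.
  rewrite x0 in Dx *; rewrite -(polar_density_diag qz Dx) /q addr0 subr0 subrr mulr0.
  by rewrite mulr_ge0// ?sqr_ge0// ltW.
have [|||Q [QE QC Q0 Qle]] := @bilinear_extension _ _ (range d_)
    (fun x y => q x y z / fine (sd z)) D0 DD DN _ _ _ d_dense.
- by move=> x y t Dx Dy Dt; rewrite polar_densityD// mulrDl.
- by move=> x y Dx Dy; rewrite polar_densityC.
- move=> x Dx; rewrite polar_density_diag//; apply/andP; split.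
    by rewrite divr_ge0// ltW.
  by rewrite ler_pdivrMr// p_le.
exists Q; split => //; apply/eqP; rewrite eq_le; apply/andP; split.
  apply: op_norm_le => // x; rewrite mul1r; apply: op_norm_le => // y; exact: Qle.
(* Since p (d_n) = s Q (d_n) (d_n), every term of the supremum defining s is at most s |Q|; hence s
   is at most s |Q|. *)
rewrite -(ler_pM2l s_gt0) mulr1 -lee_fin -sE; apply: ge_ereal_sup => _ [n _ <-].
rewrite lee_fin; have [->|dn0] := eqVneq (d_ n) 0.
  by rewrite normr0 expr0n/= invr0 mulr0 mulr_ge0// ltW.
rewrite ler_pdivrMr ?exprn_gt0 ?normr_gt0//.
have Dn : range d_ (d_ n) by exists n.
rewrite -(polar_density_diag qz Dn) -[q _ _ z](@divfK _ (fine (sd z))) ?gt_eqF//.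
rewrite -QE// mulrC -mulrA ler_wpM2l ?(ltW s_gt0)//.
apply: le_trans (ler_norm _) _; apply: le_trans (bop_le (Q (d_ n)) _) _.
by rewrite expr2 mulrA ler_wpM2r// bop_le.
Qed.

(** By density of the family these conditions leave one choice of [Q]. The value 0 at bad points
    keeps measurability and the bound, which is thus available everywhere for dominated
    convergence. *)
Definition covariance_operator (z : Z) (Q : bop H (dual H)) : Prop :=
  [/\ (quadratic_at z -> (0 < sd z < +oo)%E ->
        [/\ forall x y, range d_ x -> range d_ y -> Q x y = q x y z / fine (sd z),
          symmetric_op Q, positive_op Q & `|Q| = 1]),
      ~ (quadratic_at z /\ (0 < sd z < +oo)%E) -> Q = 0
    & forall x y, `|Q x y| <= `|x| * `|y|].

Lemma covariance_operator_exists z : exists Q, covariance_operator z Q.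
Proof.
have [[qz sz]|bad] := pselect (quadratic_at z /\ (0 < sd z < +oo)%E).
  have [Q [? ? ? ? ?]] := normalized_quadratic_form qz sz.
  by exists Q; split => // -[]; split.
exists 0; split => // [qz sz|x y]; first by case: bad.
by rewrite [X in X y]/0/= normr0.
Qed.

End quadratic_point.

Section covariance_measurability.
Context {R : realType} {H : normedModType R} {d} {Z : measurableType d}.
Variables (d_ : nat -> H) (p : H -> Z -> R).
Hypothesis d_dense : forall (x : H) e, 0 < e -> exists2 y, range d_ y & `|x - y| < e.
Hypotheses (p0 : forall x z, 0 <= p x z) (mp : forall x, measurable_fun setT (p x)).

Local Notation sd := (sup_intensity_density d_ p).

Lemma measurable_quadratic_at : measurable [set z | quadratic_at d_ p z].
Proof.
pose E n := if unpickle n is Some (l, l') then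
  [set z | quadratic_identity d_ l l' ->
    \sum_(i <- l) p (d_ i) z = \sum_(i <- l') p (d_ i) z] else setT.
have -> : [set z | quadratic_at d_ p z] = \bigcap_n E n.
  apply/seteqP; split => [z qz n _|z zE l l'].
    by rewrite /E; case: unpickle => // -[l l']; exact: qz.
  by have := zE (pickle (l, l')) I; rewrite /E pickleK.
apply: bigcapT_measurable => n; rewrite /E.
case: (@unpickle (seq nat * seq nat)%type n) => [[l l']|]; last exact: measurableT.
have [ll'|ll'] := pselect (quadratic_identity d_ l l'); last first.
  by rewrite (_ : mkset _ = setT)//; apply/seteqP; split => z // _ /ll'.
have ms (k : seq nat) : measurable_fun setT (fun z => \sum_(i <- k) p (d_ i) z).
  by apply: measurable_sum => i; exact: mp.
rewrite (_ : mkset _ =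
    ([set: Z] `&` [set z | \sum_(i <- l) p (d_ i) z <= \sum_(i <- l') p (d_ i) z]) `&`
    ([set: Z] `&` [set z | \sum_(i <- l') p (d_ i) z <= \sum_(i <- l) p (d_ i) z])).
  by apply: measurableI; apply: measurable_fun_le => //; exact: ms.
apply/seteqP; split => [z /(_ ll') /= ->|z /= [[_ h] [_ h']] _] //.
by apply/eqP; rewrite eq_le h.
Qed.

Lemma measurable_quadratic_point :
  measurable [set z | quadratic_at d_ p z /\ (0 < sd z < +oo)%E].
Proof.
apply: measurableI; first exact: measurable_quadratic_at.
have mI := measurable_sup_intensity_density d_ mp measurableT (emeasurable_itv `]0%E, +oo%E[).
rewrite setTI in mI; suff : (fun z => is_true (0 < sd z < +oo)%E) = sd @^-1` `]0%E, +oo%E[ by move=> ->.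
by apply/funext => z; rewrite /preimage/= in_itv.
Qed.

(** On the subgroup [Q] is an explicit quotient cut to a measurable set; other arguments are reached
    along sequences chosen independently of z. *)
Lemma measurable_covariance_operator (Q : Z -> bop H (dual H)) (x y : H) :
  (forall z, covariance_operator d_ p z (Q z)) ->
  measurable_fun setT (fun z => Q z x y).
Proof.
move=> QP.
have mD u v : range d_ u -> range d_ v -> measurable_fun setT (fun z => Q z u v).
  move=> Du Dv; rewrite (_ : (fun z => Q z u v) = (fun z => polar_density p u v z / fine (sd z)) \_
      [set z | quadratic_at d_ p z /\ (0 < sd z < +oo)%E]).
    apply/(measurable_restrictT _ measurable_quadratic_point)/measurable_funTS.
    apply: measurable_funM.
      by apply: measurable_funM => //; exact: measurable_funB.
    apply: measurable_funV_ge0.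
      apply: measurableT_comp; last exact: measurable_sup_intensity_density.
      exact: fine_measurable.
    by move=> z; apply: fine_ge0; exact: sup_intensity_density_ge0.
  apply/funext => z; have [Qgood Qbad _] := QP z; rewrite patchE; case: ifPn.
    by rewrite inE => -[qz sz]; have [-> //] := Qgood qz sz.
  by rewrite notin_setE => bad; rewrite Qbad.
have [u uP] := dense_approx d_dense x; have [v vP] := dense_approx d_dense y.
apply: (@measurable_fun_cvg _ _ _ _ (fun n z => Q z (u n) (v n))).
  by move=> n; apply: mD; [have [] := uP n|have [] := vP n].
move=> z _; apply: (@bilinear_cvg _ _ (fun x y => Q z x y) 1 x y).
- by move=> a b c; rewrite linearB.
- by move=> a b c; rewrite linearB.
- by move=> a b; rewrite mul1r; have [_ _] := QP z; exact.
- by move=> n; have [] := uP n.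
- by move=> n; have [] := vP n.
Qed.

End covariance_measurability.

Section covariance_density.
Context {R : realType} {H : normedModType R} {d} {S : measurableType d}.
Variables (d_ : nat -> H) (p : H -> S -> R).
Hypotheses (D0 : range d_ 0)
  (DD : forall x y, range d_ x -> range d_ y -> range d_ (x + y))
  (DN : forall x, range d_ x -> range d_ (- x))
  (d_dense : forall (x : H) e, 0 < e -> exists2 y, range d_ y & `|x - y| < e).
Hypotheses (p0 : forall x z, 0 <= p x z) (mp : forall x, measurable_fun setT (p x)).
Variables (m eta : {measure set S -> \bar R}) (A : set S) (alpha : set S -> bil H).
Hypothesis mA : measurable A.

Local Notation sd := (sup_intensity_density d_ p).

Hypothesis pE : forall x C, range d_ x -> measurable C -> C `<=` A ->
  (\int[m]_(s in C) (p x s)%:E = (alpha C x x)%:E)%E.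
Hypothesis etaE : forall C, measurable C -> C `<=` A ->
  eta C = (\int[m]_(s in C) sd s)%E.
Hypothesis eta_fin : (eta A < +oo)%E.

Let msd : measurable_fun setT sd. Proof. exact: measurable_sup_intensity_density. Qed.

Let sd0 s : (0 <= sd s)%E. Proof. exact: sup_intensity_density_ge0. Qed.

(** Both sides of a quadratic identity have the same finite integral over every [C], because
    [alpha C] is itself a bilinear form; they therefore agree almost everywhere. There are countably
    many pairs of lists. *)
Lemma ae_quadratic_at : \forall s \ae m, A s -> quadratic_at d_ p s.
Proof.
have sumE (k : seq nat) C : measurable C -> C `<=` A ->
    (\int[m]_(s in C) (\sum_(i <- k) p (d_ i) s)%:E =
      (\sum_(i <- k) alpha C (d_ i) (d_ i))%:E)%E.
  move=> mC CA; under eq_integral do rewrite -sumEFin.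
  rewrite ge0_integral_sum//; last 2 first.
  - by move=> i; apply/measurable_funTS/measurable_EFinP.
  - by move=> i s _; rewrite lee_fin.
  by rewrite -sumEFin; apply: eq_bigr => i _; apply: pE => //; exists i.
have msum (k : seq nat) : measurable_fun A (fun s => (\sum_(i <- k) p (d_ i) s)%:E).
  apply/measurable_funTS/measurable_EFinP.
  by apply: measurable_sum => i; exact: mp.
have : \forall s \ae m, forall n, A s -> forall l l', unpickle n = Some (l, l') ->
    quadratic_identity d_ l l' -> \sum_(i <- l) p (d_ i) s = \sum_(i <- l') p (d_ i) s.
  apply: ae_foralln => n; case: unpickle => [[l l']|]; last exact: filterE.
  have [ll'|ll'] := pselect (quadratic_identity d_ l l'); last first.
    by apply: filterE => s _ k k' [<- <-].
  have : ae_eq m A (fun s => (\sum_(i <- l) p (d_ i) s)%:E)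
      (fun s => (\sum_(i <- l') p (d_ i) s)%:E).
    apply: (integral_ae_eq mA) => //.
      apply/integrableP; split => //.
      rewrite (eq_integral (fun s => (\sum_(i <- l) p (d_ i) s)%:E)) ?sumE ?ltry//.
      by move=> s _; rewrite gee0_abs// lee_fin sumr_ge0.
    by move=> C CA mC; rewrite !sumE// (ll' (alpha C)).
  by apply: filterS => s sE As k k' [<- <-] _; have [] := sE As.
apply: filterS => s sE As l l' ll'.
by apply: (sE (pickle (l, l')) As) => //; rewrite pickleK.
Qed.

Lemma ae_sup_intensity_density_fin : \forall s \ae m, A s -> (sd s < +oo)%E.
Proof.
have : m.-integrable A sd.
  apply/integrableP; split; first exact: measurable_funTS.
  by rewrite (eq_integral sd) -?etaE// => s _; rewrite gee0_abs.
by move/(integrable_ae mA); apply: filterS => s sfin As; rewrite -ge0_fin_numE// sfin.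
Qed.

(** The zero set of [sd] may be large for [m], but [eta], whose density is [sd], does not charge
    it. *)
Lemma ae_quadratic_point : \forall s \ae eta,
  A s -> quadratic_at d_ p s /\ (0 < sd s < +oo)%E.
Proof.
pose B := A `\` [set s | quadratic_at d_ p s /\ (0 < sd s < +oo)%E].
have mB : measurable B.
  by apply: measurableD => //; exact: measurable_quadratic_point.
have BA : B `<=` A by move=> s [].
exists B; split => //; last first.
  by move=> s /not_implyP[As bad]; split.
rewrite etaE// (ae_eq_integral (cst 0%E)) ?integral0//; first exact: measurable_funTS.
move: ae_quadratic_at ae_sup_intensity_density_fin.
apply: filterS2 => s qs sfin [As bad] /=.
apply/eqP; rewrite eq_le sd0 andbT leNgt; apply/negP => s_gt0.
by apply: bad; split; [exact: qs|rewrite s_gt0 sfin].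
Qed.

Variable Q : S -> bop H (dual H).
Hypothesis QP : forall s, covariance_operator d_ p s (Q s).
Hypothesis alphaC : forall C x y, range d_ x -> range d_ y ->
  measurable C -> C `<=` A -> alpha C x y = alpha C y x.

Let Q_ge0 s x : 0 <= Q s x x.
Proof.
have [good bad _] := QP s.
have [[qs ss]|/bad->//] := pselect (quadratic_at d_ p s /\ (0 < sd s < +oo)%E).
by have [_ _ Q0 _] := good qs ss; exact: Q0.
Qed.

Let QC s x y : Q s x y = Q s y x.
Proof.
have [good bad _] := QP s.
have [[qs ss]|/bad->//] := pselect (quadratic_at d_ p s /\ (0 < sd s < +oo)%E).
by have [_ Qsym _ _] := good qs ss; exact: Qsym.
Qed.

Let mQ x y : measurable_fun setT (fun s => Q s x y).
Proof. exact: (measurable_covariance_operator d_dense p0 mp). Qed.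

Let Q_diag x C : range d_ x -> measurable C -> C `<=` A ->
  (\int[eta]_(s in C) (Q s x x)%:E = (alpha C x x)%:E)%E.
Proof.
move=> Dx mC CA.
rewrite (ge0_integral_density (mu := m) mC msd sd0); last 3 first.
- by move=> E mE EC; rewrite etaE//; exact: subset_trans CA.
- by apply/measurable_EFinP; exact: mQ.
- by move=> s; rewrite lee_fin.
rewrite -pE//; apply: ge0_ae_eq_integral => //.
- apply: emeasurable_funM; apply: measurable_funTS => //.
  by apply/measurable_EFinP; exact: mQ.
- by apply/measurable_funTS/measurable_EFinP.
- by move=> s _; rewrite mule_ge0// lee_fin.
- by move=> s _; rewrite lee_fin.
move: ae_quadratic_at ae_sup_intensity_density_fin.
apply: filterS2 => s /[swap] sfin /[swap] Cs; have As := CA _ Cs.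
move=> /(_ As) qs; have {}sfin := sfin As.
have pq := polar_density_diag D0 DD qs Dx.
(* Where the supremum vanishes so does [p x], and the value of the operator there is irrelevant. *)
have [s0|s0] := eqVneq (sd s) 0%E.
  rewrite s0 mule0; have [|x0] := intensity_density_le p s Dx.
    by rewrite s0 mule0 => ple; apply/eqP; rewrite eq_le ple lee_fin p0.
  by rewrite -pq /polar_density x0 addr0 subr0 subrr mulr0.
have s_gt0 : (0 < sd s)%E by rewrite lt0e s0 sd0.
have sE : sd s = (fine (sd s))%:E by rewrite fineK// ge0_fin_numE.
have f0 : fine (sd s) != 0 by apply: contra s0; rewrite {2}sE => /eqP->.
have [good _ _] := QP s; have [||-> // _ _ _] := good; rewrite ?s_gt0//.
by rewrite {2}sE -EFinM pq divfK.
Qed.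

Let Q_integrable x y C : measurable C -> C `<=` A ->
  eta.-integrable C (fun s => (Q s x y)%:E).
Proof.
move=> mC CA; apply: measurable_bounded_integrable => //.
- by apply: le_lt_trans eta_fin; rewrite le_measure ?inE.
- exact: measurable_funTS.
- exists (`|x| * `|y|); split=> [|K ltK s _]; first exact: num_real.
  by have [_ _ Qle] := QP s; apply: le_trans (Qle x y) (ltW ltK).
Qed.

Let Q_dense x y C : range d_ x -> range d_ y -> measurable C -> C `<=` A ->
  (\int[eta]_(s in C) (Q s x y)%:E = (alpha C x y)%:E)%E.
Proof.
move=> Dx Dy mC CA.
have -> : alpha C x y = 4^-1 * (alpha C (x + y) (x + y) - alpha C (x - y) (x - y)).
  by rewrite bil_polarization (alphaC Dy Dx)//; field.
rewrite EFinM EFinB -!Q_diag//; [|exact/DD/DN|exact: DD].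
rewrite -integralB_EFin//; [|exact: Q_integrable|exact: Q_integrable].
rewrite -integralZl//; last by apply: integrableB => //; exact: Q_integrable.
apply: eq_integral => s _; rewrite -EFinB -EFinM; congr (_%:E).
have QDl a b c : Q s (a + b) c = Q s a c + Q s b c by rewrite linearD.
have QBl a b c : Q s (a - b) c = Q s a c - Q s b c by rewrite linearB.
have QDr a b c : Q s c (a + b) = Q s c a + Q s c b by rewrite linearD.
have QBr a b c : Q s c (a - b) = Q s c a - Q s c b by rewrite linearB.
by rewrite QBl QDl !QBr !QDr (QC s y x); field.
Qed.

(** Polarization settles the subgroup. The rest follows by dominated convergence on the left, with a
    constant bound and [eta] finite on [A], and by boundedness of [alpha C] on the right, so no
    further null set is spent. *)
Lemma covariance_integral x y C : measurable C -> C `<=` A ->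
  (\int[eta]_(s in C) (Q s x y)%:E = (alpha C x y)%:E)%E.
Proof.
move=> mC CA.
have [u uP] := dense_approx d_dense x; have [v vP] := dense_approx d_dense y.
have uv : (\int[eta]_(s in C) (Q s (u n) (v n))%:E)%E @[n --> \oo] -->
    (\int[eta]_(s in C) (Q s x y)%:E)%E.
  apply: (@dominated_cvg _ _ _ _ _ mC _ _ (cst ((`|x| + 1) * (`|y| + 1))%:E)) => //.
  - by move=> n; apply/measurable_funTS/measurable_EFinP; exact: mQ.
  - move=> s _; apply: cvg_EFin; first exact: nearW.
    apply: (@bilinear_cvg _ _ (fun x y => Q s x y) 1).
    + by move=> a b c; rewrite linearB.
    + by move=> a b c; rewrite linearB.
    + by move=> a b; rewrite mul1r; have [_ _] := QP s; exact.
    + by move=> n; have [] := uP n.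
    + by move=> n; have [] := vP n.
  - apply: measurable_bounded_integrable => //.
    + by apply: le_lt_trans eta_fin; rewrite le_measure ?inE.
    + exists ((`|x| + 1) * (`|y| + 1)); split=> [|K ltK s _]; first exact: num_real.
      by rewrite ger0_norm ?ltW// mulr_ge0// addr_ge0.
  - move=> n s _ /=; rewrite lee_fin.
    have [_ _ Qle] := QP s; apply: le_trans (Qle _ _) _.
    have near1 (z : H) (z_ : nat -> H) : `|z - z_ n| <= n.+1%:R^-1 -> `|z_ n| <= `|z| + 1.
      move=> h; rewrite -[z_ n](subKr z) (le_trans (ler_normB _ _))// lerD2l.
      by rewrite (le_trans h)// invf_le1// ler1n.
    by rewrite ler_pM// near1//; [have [] := uP n|have [] := vP n].
have [_ _ [k ak]] := bilP (alpha C).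
have auv : (alpha C (u n) (v n))%:E @[n --> \oo] --> (alpha C x y)%:E.
  apply: cvg_EFin; first exact: nearW.
  apply: (@bilinear_cvg _ _ (alpha C) k) => //.
  - by move=> a b c; rewrite bilDl bilNl.
  - by move=> a b c; rewrite bilDr bilNr.
  - by move=> n; have [] := uP n.
  - by move=> n; have [] := vP n.
apply: cvg_unique uv _ => //.
rewrite (_ : (fun n => _) = fun n => (alpha C (u n) (v n))%:E)//.
by apply/funext => n; apply: Q_dense => //; [have [] := uP n|have [] := vP n].
Qed.

End covariance_density.

Lemma ae_eq_set_function {d} {S : measurableType d} {R : realType}
    (m1 m2 : set S -> \bar R) (A : set S) :
  (forall E, measurable E -> m1 E = m2 E) ->
  (\forall s \ae m1, A s) -> \forall s \ae m2, A s.
Proof. by move=> mE [B [mB B0 AB]]; exists B; split => //; rewrite -mE. Qed.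

Theorem theorem5p21 (R : realType)
  (d : measure_display) (Omega : measurableType d) (P : probability Omega R)
  (F : R -> set_system Omega)
  (U : ptopologicalType) (calA : set (set U))
  (X : completeNormedModType R)
  (M : R -> set U -> dual X -> Omega -> R)
  (nu : dual X -> Omega -> set (R * borel U) -> \bar R)
  (eta : Omega -> set (R * borel U) -> \bar R)
  (T : R)
  (alpha : Omega -> set (R * borel U) -> bil (dual X))
  (Gamma : Omega -> set (R * borel U) -> bop (dual X) (dual (dual X))) :
  measure_is_complete P ->
  filtration F ->
  usual_conditions P F ->
  lusin_space R U ->
  borel_ring calA ->
  separable_space (dual X) ->
  cylindrical_orthogonal_martingale_valued_measure P F calA M ->
  is_intensity P F calA M nu ->
  is_quadratic_variation P calA nu eta ->
  sequential_boundedness P calA nu ->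
  0 < T ->
  signed_intensities P nu T ->
  (\forall w \ae P,
    (ereal_sup [set eta w (`[0%R, T]%classic `*` A) | A in calA] < +oo)%E) ->
  is_alpha P nu T alpha ->
  is_Gamma T alpha Gamma ->
  exists Q : Omega -> R -> U -> bop (dual X) (dual (dual X)),
    [/\ \forall w \ae P, forall (x y : dual X) (C : set (R * borel U)),
          borel_strip T C ->
          ((Gamma w C x y)%:E =
             \int[eta w]_(p in C) (Q w p.1 p.2 x y)%:E)%E,
        forall x y : dual X,
          measurable_wrt
            (([set: Omega] `*` `[0, T]%classic) `*` [set: borel U])
            (prod_sigma_algebra
              ([set: Omega] `*` `[0, T]%classic) (predictable F `[0, T]%classic)
              [set: borel U] measurable)
            (fun p : Omega * R * borel U => Q p.1.1 p.1.2 p.2 x y),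
        \forall w \ae P, \forall p \ae eta w, strip T p ->
          positive_op (Q w p.1 p.2) /\ symmetric_op (Q w p.1 p.2)
      & \forall w \ae P, \forall p \ae eta w, strip T p ->
          `|Q w p.1 p.2| = 1].
Proof.
move=> _ filF ucF lusU _ sepH cM iM etaM _ T0 _ eta_bounded aM GammaE.
have [d_ [D0 DD DN d_dense]] := countable_dense_subgroup sepH.
have [mu [p [pmu mp p0 pE]]] :=
  intensity_density filF ucF lusU cM iM T0 aM etaM eta_bounded d_.
have etaE := quadratic_variation_density filF cM iM T0 aM etaM pmu mp p0 pE d_dense.
(* A single [Q] is chosen on the predictable space before any path is fixed, so its measurability
   needs no exceptional set. *)
have /choice[Q QP] := covariance_operator_exists D0 DD DN d_dense p0.
have mst : measurable (strip T : set (R * borel U)) by rewrite /strip; apply: measurableX.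
have mpw w x : measurable_fun setT (fun s => p x (graph F w s)).
  exact: measurableT_comp (mp x) (measurable_graph w).
(* All almost sure facts about the countable family are gathered on one null set; off it the
   functionals in the conclusion are arbitrary. *)
have path : \forall w \ae P, exists m : {measure set (R * borel U) -> \bar R},
    [/\ forall E, measurable E -> eta w E = m E,
        forall C, measurable C -> C `<=` strip T ->
          m C = (\int[mu w]_(s in C)
            sup_intensity_density d_ (fun x s => p x (graph F w s)) s)%E,
        (m (strip T) < +oo)%E,
        forall x C, range d_ x -> measurable C -> C `<=` strip T ->
          (\int[mu w]_(s in C) (p x (graph F w s))%:E = (alpha w C x x)%:E)%E
      & forall C x y, range d_ x -> range d_ y -> measurable C -> C `<=` strip T ->
          alpha w C x y = alpha w C y x].
  have eta_fin := quadratic_variation_fin cM etaM eta_bounded.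
  have [[[_ _ eta_meas] _] _ _ _] := etaM.
  have aC : \forall w \ae P, forall i j C, borel_strip T C ->
      alpha w C (d_ i) (d_ j) = alpha w C (d_ j) (d_ i).
    by do 2!(apply: ae_foralln => ?); exact: (alphaC filF cM iM T0 aM).
  have : \forall w \ae P, is_measure (eta w) /\ (eta w (strip T) < +oo)%E.
    by move: eta_meas eta_fin; apply: filterS2.
  have : \forall w \ae P,
      (forall C, borel_strip T C ->
        eta w C = (\int[mu w]_(s in C) sup_intensity_density d_ p (graph F w s))%E) /\
      (forall x C, range d_ x -> borel_strip T C ->
        (\int[mu w]_(s in C) (p x (graph F w s))%:E = (alpha w C x x)%:E)%E).
    by move: etaE pE; apply: filterS2.
  move: aC; apply: filterS3 => w aC [etaw pw] [[m mE] finw]; exists m; split => //.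
  - by move=> C mC CT; rewrite -mE// etaw.
  - by rewrite -mE.
  - by move=> x C Dx mC CT; apply: pw.
  - by move=> C _ _ [i _ <-] [j _ <-] mC CT; apply: aC.
pose Qf w r u : bop (dual X) (dual (dual X)) := Q ((w, r), u).
exists Qf; split.
- move: path; apply: filterS => w [m [mE etaw fin pw aC]] x y C sC.
  have [mC CT] := sC.
  rewrite GammaE//.
  rewrite (eq_integral_set_function C (fun s => (Qf w s.1 s.2 x y)%:E) mE).
  apply/esym.
  exact: (covariance_integral D0 DD DN d_dense (fun x s => p0 x (graph F w s))
    (mpw w) mst pw etaw fin (fun s => QP (graph F w s)) aC).
- move=> x y.
  have -> : (fun z : Omega * R * borel U => Qf z.1.1 z.1.2 z.2 x y) =
      fun z : g_sigma_algebraType (pred_rect F) * borel U => Q z x y.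
    by apply/funext => -[[w r] u].
  have mQ := measurable_covariance_operator d_dense p0 mp x y QP.
  exact: (@measurable_prod_predictable _ _ _ _ filF _ (borel U) T _ _ _ T0 mQ).
- move: path; apply: filterS => w [m [mE etaw fin pw aC]].
  apply: (ae_eq_set_function (fun E mE' => esym (mE E mE'))).
  have := ae_quadratic_point (fun x s => p0 x (graph F w s)) (mpw w) mst pw etaw fin.
  apply: filterS => s h sT; have [qs ss] := h sT.
  by have [good _ _] := QP (graph F w s); have [_ ? ? _] := good qs ss.
- move: path; apply: filterS => w [m [mE etaw fin pw aC]].
  apply: (ae_eq_set_function (fun E mE' => esym (mE E mE'))).
  have := ae_quadratic_point (fun x s => p0 x (graph F w s)) (mpw w) mst pw etaw fin.
  apply: filterS => s h sT; have [qs ss] := h sT.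
  by have [good _ _] := QP (graph F w s); have [_ _ _ ?] := good qs ss.
Qed.
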